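(* Let $\Gamma=(X,R)$ be a bipartite distance-regular graph with diameter $D\ge 4$ and valency $k\ge 3$. Assume $D$ is odd. Then the following (i)--(iii) are equivalent: (i) $\Gamma$ is taut or $2$-homogeneous; (ii) $\Gamma$ is an antipodal $2$-cover and $2$-thin with respect to each vertex; (iii) $\Gamma$ is an antipodal $2$-cover and $2$-thin with respect to at least one vertex.
   Context: Graphs are finite, undirected, connected, without loops or multiple edges; $\partial$ denotes path-length distance. A graph $\Gamma=(X,R)$ of diameter $D$ is distance-regular if for all $0\le h,i,j\le D$ and all $x,y\in X$ with $\partial(x,y)=h$ the number $p^h_{ij}=|\{z\in X:\partial(x,z)=i,\ \partial(z,y)=j\}|$ depends only on $h,i,j$. Write $c_i=p^i_{1,i-1}$, $b_i=p^i_{1,i+1}$, $k=b_0$ (the valency). $\Gamma$ is bipartite if $X$ can be partitioned into two subsets neither of which contains an edge. The distinct eigenvalues of the adjacency matrix $A$ are real and indexed $\theta_0>\theta_1>\cdots>\theta_D$; put $d=\lfloor D/2\rfloor$. For bipartite $\Gamma$ with $D\ge4$, $\theta_1^2>b_2>\theta_d^2$. Taut: put $\Delta=(k-2)(c_3-1)-(c_2-1)p^2_{22}$. It is known that $$b_3\bigl(b_2(k-2)-(c_2-1)\theta_1^2\bigr)\bigl(b_2(k-2)-(c_2-1)\theta_d^2\bigr)\ \ge\ b_1\Delta(\theta_1^2-b_2)(b_2-\theta_d^2),$$ with every factor nonnegative. $\Gamma$ is called taut if $\Delta\ne0$ and equality holds in this inequality. $2$-homogeneous (in the sense of Nomura):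 for each $i$ with $1\le i\le D-1$, the number of vertices $r$ with $\partial(r,x)=1$, $\partial(r,y)=1$, $\partial(r,z)=i-1$ is the same for all $x,y,z\in X$ with $\partial(x,y)=2$, $\partial(x,z)=i$, $\partial(y,z)=i$. Known equivalents (Curtin), for bipartite $\Gamma$ with $D\ge4$, $k\ge3$: $\Gamma$ is $2$-homogeneous iff $b_2(k-2)=(c_2-1)\theta_1^2$; equivalently, iff $\Delta=0$ and equality holds in the displayed inequality. Antipodal $2$-cover: for every $x\in X$ there is a unique $y\in X$ with $\partial(x,y)=D$. Let $V=\mathbb C^X$. For $x\in X$, $E_i^*=E_i^*(x)$ is the diagonal matrix in $\mathrm{Mat}_X(\mathbb C)$ with $(y,y)$ entry $1$ if $\partial(x,y)=i$ and $0$ otherwise. $T=T(x)$ is the subalgebra of $\mathrm{Mat}_X(\mathbb C)$ generated by $A,E_0^*,\ldots,E_D^*$. A $T$-module is a subspace $W\subseteq V$ with $BW\subseteq W$ for all $B\in T$; it is irreducible if it is nonzero and contains no $T$-modules other than $0$ and $W$. The endpoint of an irreducible $W$ is $\min\{i:E_i^*W\ne0\}$; $W$ is thin if $\dim E_i^*W\le1$ for $0\le i\le D$. $\Gamma$ is $2$-thin with respect to $x$ if every irreducible $T(x)$-module with endpoint $2$ is thin. *)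

(* Defs.v *)
From mathcomp Require Import all_boot all_order all_algebra.
From mathcomp Require Import reals.
From mathcomp Require Import polyrcf complex.

Set Implicit Arguments.
Unset Strict Implicit.
Unset Printing Implicit Defensive.

Import Order.TTheory GRing.Theory Num.Theory.

Section Graph.
Variables (X : finType) (adj : rel X).

Definition connected_simple_graph : Prop :=
  [/\ symmetric adj, irreflexive adj & forall x y, connect adj x y].

Definition bipartite : Prop :=
  exists Y : {set X},
    (forall x y, x \in Y -> y \in Y -> ~~ adj x y) /\
    (forall x y, x \in ~: Y -> y \in ~: Y -> ~~ adj x y).

Definition walk (n : nat) (x y : X) : bool :=
  [exists p : n.-tuple X, path adj x p && (last x p == y)].

(* The least length of a walk from x to y. A shortest walk has length < #|X|;
   the value is #|X| when y cannot be reached from x. *)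
Definition gdist (x y : X) : nat :=
  find (fun n => walk n x y) (iota 0 #|X|).

Lemma gdist_min (n : nat) (x y : X) : walk n x y -> gdist x y <= n.
Proof.
move=> w; rewrite leqNgt; apply/negP => lt_n.
have := before_find 0 lt_n; rewrite nth_iota ?add0n ?w //.
by apply: leq_trans lt_n _; rewrite -[X in _ <= X](size_iota 0) find_size.
Qed.

Lemma walk_gdist (x y : X) : connect adj x y -> walk (gdist x y) x y.
Proof.
case/connectP => p0 /shortenP[p ep up _] ly.
have sp : size p < #|X| by move/card_uniqP: up => /= <-; exact: max_card.
have w : walk (size p) x y.
  by apply/existsP; exists (in_tuple p); rewrite ep ly /=.
have h : has (fun n => walk n x y) (iota 0 #|X|).
  by apply/hasP; exists (size p); rewrite // mem_iota.
have := nth_find 0 h; rewrite nth_iota ?add0n //.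
by rewrite -[X in _ < X](size_iota 0) -has_find.
Qed.

Definition diameter : nat := \max_(x : X) \max_(y : X) gdist x y.

Definition triple_count (i j : nat) (x y : X) : nat :=
  #|[set z | (gdist x z == i) && (gdist z y == j)]|.

Definition distance_regular : Prop :=
  forall h i j, h <= diameter -> i <= diameter -> j <= diameter ->
  forall x y x' y', gdist x y = h -> gdist x' y' = h ->
    triple_count i j x y = triple_count i j x' y'.

(* p^h_{ij}, read off from an arbitrary pair of vertices at distance h (0 if
   there is none); it is independent of that pair in a distance-regular graph. *)
Definition inter_num (h i j : nat) : nat :=
  if [pick u : X * X | gdist u.1 u.2 == h] is Some u
  then triple_count i j u.1 u.2 else 0.

Definition c_num (i : nat) : nat := inter_num i 1 i.-1.
Definition b_num (i : nat) : nat := inter_num i 1 i.+1.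
Definition valency : nat := b_num 0.

Definition two_homog_count (i : nat) (x y z : X) : nat :=
  #|[set r | [&& gdist r x == 1, gdist r y == 1 & gdist r z == i.-1]]|.

Definition two_homogeneous : Prop :=
  forall i, 1 <= i <= diameter.-1 ->
  forall x y z x' y' z',
    gdist x y = 2 -> gdist x z = i -> gdist y z = i ->
    gdist x' y' = 2 -> gdist x' z' = i -> gdist y' z' = i ->
    two_homog_count i x y z = two_homog_count i x' y' z'.

Definition antipodal_2_cover : Prop :=
  forall x, exists! y, gdist x y = diameter.

End Graph.

Local Open Scope ring_scope.

(* Rows and columns of matrices are indexed by X through enum_val. *)
Definition adjmx (F : nzRingType) (X : finType) (adj : rel X) : 'M[F]_#|X| :=
  \matrix_(i, j) (adj (enum_val i) (enum_val j))%:R.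

Section Spectrum.
Variables (R : realType) (X : finType) (adj : rel X).

(* The distinct eigenvalues in decreasing order: rootsR lists the distinct real
   roots of a polynomial in increasing order, and A is real symmetric, so that
   all its eigenvalues are real. *)
Definition eigenvalues : seq R := rev (rootsR (char_poly (adjmx R adj))).
Definition theta (i : nat) : R := eigenvalues`_i.

Lemma mem_eigenvalues (a : R) :
  (a \in eigenvalues) = eigenvalue (adjmx R adj) a.
Proof.
rewrite mem_rev eigenvalue_root_char.
by rewrite -(roots_on_rootsR (monic_neq0 (char_poly_monic _))) in_itv.
Qed.

Lemma sorted_eigenvalues : sorted (fun a b : R => b < a) eigenvalues.
Proof. by rewrite rev_sorted; exact: sorted_roots. Qed.

Local Notation b i := ((b_num adj i)%:R : R).
Local Notation c i := ((c_num adj i)%:R : R).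
Local Notation k := ((valency adj)%:R : R).
Local Notation theta_1 := (theta 1).
Local Notation theta_d := (theta (diameter adj)./2).

Definition Delta : R :=
  (k - 2) * (c 3 - 1) - (c 2 - 1) * (inter_num adj 2 2 2)%:R.

Definition taut : Prop :=
  Delta <> 0 /\
  b 3 * (b 2 * (k - 2) - (c 2 - 1) * theta_1 ^+ 2)
      * (b 2 * (k - 2) - (c 2 - 1) * theta_d ^+ 2)
  = b 1 * Delta * (theta_1 ^+ 2 - b 2) * (b 2 - theta_d ^+ 2).

End Spectrum.

Section Terwilliger.
Variables (R : realType) (X : finType) (adj : rel X) (x : X).

Local Notation C := R[i].
Local Notation Mat := 'M[C]_#|X|.
Local Notation V := 'cV[C]_#|X|.

Definition dual_idem (i : nat) : Mat :=
  diag_mx (\row_j (gdist adj x (enum_val j) == i)%:R).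

Inductive terwilliger : Mat -> Prop :=
| Terw_adj : terwilliger (adjmx C adj)
| Terw_dual i : (i <= diameter adj)%N -> terwilliger (dual_idem i)
| Terw_one : terwilliger 1%:M
| Terw_add A B : terwilliger A -> terwilliger B -> terwilliger (A + B)
| Terw_scale (a : C) A : terwilliger A -> terwilliger (a *: A)
| Terw_mul A B : terwilliger A -> terwilliger B -> terwilliger (A *m B).

Definition Tmodule (W : {vspace V}) : Prop :=
  forall B, terwilliger B -> forall w, w \in W -> B *m w \in W.

Definition irreducible_Tmodule (W : {vspace V}) : Prop :=
  [/\ Tmodule W, W <> 0%VS &
      forall U : {vspace V}, (U <= W)%VS -> Tmodule U -> U = 0%VS \/ U = W].

Definition dual_image (i : nat) (W : {vspace V}) : {vspace V} :=
  (linfun (mulmx (dual_idem i)) @: W)%VS.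

Definition has_endpoint (W : {vspace V}) (r : nat) : Prop :=
  dual_image r W <> 0%VS /\ forall i, (i < r)%N -> dual_image i W = 0%VS.

Definition thin (W : {vspace V}) : Prop :=
  forall i, (i <= diameter adj)%N -> (\dim (dual_image i W) <= 1)%N.

Definition two_thin : Prop :=
  forall W, irreducible_Tmodule W -> has_endpoint W 2 -> thin W.

End Terwilliger.

(* Main.v *)
Require Import Defs.
From mathcomp Require Import all_boot all_order all_algebra.
From mathcomp Require Import reals complex polyrcf.
From mathcomp Require Import zify ring lra.

(** Write F_n for the matrix of the cosines of theta_n, a positive multiple
    of the primitive idempotent, E_i for the dual idempotents of a vertex x,
    and U = U(x) for the space of vectors supported on the second
    neighbourhood of x and killed by E_1 A. All the conditions of the theorem
    are compared with one equation, the equality in the defining inequality of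
    tautness, called here the tautness equation.

    The tautness equation is a statement about U: if P is the projection onto
    U, the trace of P F_1 P F_d P can be computed by counting, and it is a
    positive multiple of the difference of the two sides of the inequality
    ([trace_defect]). Being a squared norm it vanishes only if F_1 P F_d = 0
    ([defect_cosmx_proj_cosmx]). Conversely, if F_1 and F_d are orthogonal on
    U at a single vertex x then the equation holds ([defect_of_U]).

    On a vector v of U, F_n acts in each sphere through the two vectors
    E_i A_(i-2) v and E_i A_(i+2) v with the differences u_j - u_(j+2) of the
    cosines as coefficients ([U_rad]), and for n = 1 and n = d none of these
    differences vanishes ([gap_theta1_gt0], [gap_thetad_neq0]). This is
    proved by evaluating a positive semidefinite polynomial in A on a vector
    for which only boundary terms survive ([gap_sign]).

    From the equation to the modules: F_1 P F_d = 0 allows one to write every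
    vector of U as a sum of a vector killed by F_1 and one killed by F_d
    ([U_split]). A vector of U killed by F_1 or F_d generates a thin module,
    because the two vectors above are then proportional; this gives thinness
    ([defect_two_thin]). The same decomposition yields, by induction on i,
    the symmetry c_(D-i) = b_i of the intersection array, which makes the
    graph an antipodal 2-cover ([symmetric_step], [defect_antipodal]).

    From the modules to the equation: suppose that for some v in U the vectors
    E_i A_m v span at most a line for each i, and vanish for i = 0, 1 and
    D - 1. The module generated by v under A then has dimension at most
    D - 2, which forces F_th v = 0 for one of the D - 1 eigenvalues th other
    than k and -k ([small_module_vanish]). By positivity th^2 is then
    extreme, so that E_2 F_1 E_2 F_d v = 0 ([extremal_vanish]). The hypothesis
    on v holds if v lies in a thin module of an antipodal 2-cover, the
    vanishing for D - 1 being transported from the sphere of radius 1 by the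
    antipodal map ([two_thin_U_vanish]), and it holds for all v in U if the
    graph is 2-homogeneous ([two_homogeneous_defect]).

    Finally, if the equation holds and the graph is not taut then Delta = 0,
    and the equation reduces to b_2 (k - 2) = (c_2 - 1) theta_1^2. The trace
    formula with theta_1 in both places shows that F_1 kills U. The resulting
    linear relations determine the counts in the definition of
    2-homogeneity ([homog_count_interior], [defect_two_homogeneous]). *)

Set Implicit Arguments.
Unset Strict Implicit.
Unset Printing Implicit Defensive.

Import Order.TTheory GRing.Theory Num.Theory.
Local Open Scope ring_scope.
Local Open Scope complex_scope.

(** * Matrix identities over a commutative ring *)

Lemma sub_of_add (V : zmodType) (a1 a2 a3 : V) : a1 + a2 = a3 -> a1 = a3 - a2.
Proof. by move=> <-; rewrite addrK. Qed.

Lemma mulmx_lin3 (F : comNzRingType) m n p a b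
    (M : 'M[F]_(m, n)) (A B C : 'M[F]_(n, p)) :
  M *m (A - a *: B + b *: C) = M *m A - a *: (M *m B) + b *: (M *m C).
Proof. by rewrite mulmxDr mulmxBr -!scalemxAr. Qed.

Lemma mulmx_lin3l (F : comNzRingType) m n p a b
    (A B C : 'M[F]_(m, n)) (M : 'M[F]_(n, p)) :
  (A - a *: B + b *: C) *m M = A *m M - a *: (B *m M) + b *: (C *m M).
Proof. by rewrite mulmxDl mulmxBl -!scalemxAl. Qed.

Lemma mulmx_lin2l (F : comNzRingType) m n p a b
    (A B : 'M[F]_(m, n)) (M : 'M[F]_(n, p)) :
  (a *: A + b *: B) *m M = a *: (A *m M) + b *: (B *m M).
Proof. by rewrite mulmxDl -!scalemxAl. Qed.

Lemma mulmx_lin2 (F : comNzRingType) m n p a b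
    (M : 'M[F]_(m, n)) (A B : 'M[F]_(n, p)) :
  M *m (a *: A + b *: B) = a *: (M *m A) + b *: (M *m B).
Proof. by rewrite mulmxDr -!scalemxAr. Qed.

Lemma map_mx_lin3 (F : comNzRingType) (f : {rmorphism F -> F}) m n a b
    (A B C : 'M[F]_(m, n)) :
  map_mx f (A - a *: B + b *: C)
  = map_mx f A - f a *: map_mx f B + f b *: map_mx f C.
Proof. by rewrite map_mxD map_mxB !map_mxZ. Qed.

Lemma mxtrace_lin3 (F : comNzRingType) n a b (A B C : 'M[F]_n) :
  \tr (A - a *: B + b *: C) = \tr A - a * \tr B + b * \tr C.
Proof. by rewrite mxtraceD raddfB /= !mxtraceZ. Qed.

Lemma mxtrace_lin2 (F : comNzRingType) n a b (A B : 'M[F]_n) :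
  \tr (a *: A + b *: B) = a * \tr A + b * \tr B.
Proof. by rewrite mxtraceD !mxtraceZ. Qed.

Lemma trmx_lin3 (F : comNzRingType) m n a b (A B C : 'M[F]_(m, n)) :
  (A - a *: B + b *: C)^T = A^T - a *: B^T + b *: C^T.
Proof. by rewrite raddfD raddfB /= !linearZ. Qed.

Lemma mx_ext (F : comNzRingType) m n (M M' : 'M[F]_(m, n)) :
  (forall w : 'cV[F]_n, M *m w = M' *m w) -> M = M'.
Proof.
move=> h; apply/matrixP => i j; have := h (delta_mx j 0).
by rewrite -!colE => /colP/(_ i); rewrite !mxE.
Qed.

Lemma map_mx_fixed3 (F : comNzRingType) (f : {rmorphism F -> F}) m n a b
    (A B C : 'M[F]_(m, n)) : map_mx f A = A -> map_mx f B = B -> map_mx f C = C ->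
  f a = a -> f b = b -> map_mx f (A - a *: B + b *: C) = A - a *: B + b *: C.
Proof. by move=> eA eB eC ea eb; rewrite map_mx_lin3 eA eB eC ea eb. Qed.

Lemma mulmx_comb3 (F : comNzRingType) m n p q (a b c : F) (M : 'M_(m, n))
    (X Y Z : 'M_(n, p)) (v : 'M_(p, q)) :
  M *m (a *: X + b *: Y + c *: Z) *m v
  = a *: (M *m X *m v) + b *: (M *m Y *m v) + c *: (M *m Z *m v).
Proof. by rewrite !mulmxDr !mulmxDl -!scalemxAr -!scalemxAl. Qed.

Lemma mulmx_sandwich (F : comNzRingType) m n p (w : F) (M N : 'M[F]_n)
    (e : 'M_(m, n)) (v : 'M_(n, p)) :
  e *m M *m (w *: N) *m (M *m v) = e *m (w *: (M *m (N *m M))) *m v.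
Proof. by rewrite -!scalemxAr -!scalemxAl !mulmxA. Qed.

Lemma mulmxBl2 (F : comNzRingType) m n p q
    (M1 M2 : 'M[F]_(m, n)) (B : 'M[F]_(n, p)) (B' : 'M[F]_(p, q)) :
  (M1 - M2) *m B *m B' = M1 *m B *m B' - M2 *m B *m B'.
Proof. by rewrite !mulmxBl. Qed.

Lemma mulmx_comb_eq0 (F : comNzRingType) m n p (a b c : F) (M1 M2 M3 : 'M_(m, n))
    (u : 'M_(n, p)) : M1 *m u = 0 -> M2 *m u = 0 -> M3 *m u = 0 ->
  a *: M1 *m u + (b *: M2 - c *: M3) *m u = 0.
Proof. by move=> e1 e2 e3; rewrite mulmxBl -!scalemxAl e1 e2 e3 !scaler0 subr0 addr0. Qed.

(** Cramer's rule: v is recovered from two of its combinations with w. *)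
Lemma cramer_combo (F : fieldType) n (v w : 'cV[F]_n) (a0 a2 d0 d2 e : F) :
  e = d2 * a0 - a2 * d0 -> e != 0 ->
  v = - (a2 / e) *: (d0 *: v + d2 *: w) + (d2 / e) *: (a0 *: v + a2 *: w).
Proof. by move=> -> e0; apply/colP => j; rewrite !mxE; field. Qed.

Lemma lin2_entry (F : comNzRingType) n (a b : F) (p q : 'cV[F]_n) i :
  (a *: p + b *: q) i 0 = a * p i 0 + b * q i 0.
Proof. by rewrite !mxE. Qed.

Section DiagConj.
Variables (F : comNzRingType) (n : nat) (S S' : 'M[F]_n).

Lemma diag_conj_mul (a b e : 'rV[F]_n) : S *m S' = 1%:M ->
  (forall i, a 0 i * b 0 i = e 0 i) ->
  (S' *m diag_mx a *m S) *m (S' *m diag_mx b *m S) = S' *m diag_mx e *m S.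
Proof.
move=> SS h; rewrite !mulmxA -[_ *m S *m _]mulmxA SS mulmx1 -(mulmxA S') mulmx_diag.
by congr (_ *m diag_mx _ *m _); apply/rowP => i; rewrite mxE.
Qed.

Lemma diag_conj_sub (a b e : 'rV[F]_n) : (forall i, a 0 i - b 0 i = e 0 i) ->
  S' *m diag_mx a *m S - S' *m diag_mx b *m S = S' *m diag_mx e *m S.
Proof.
move=> h; rewrite -mulmxBl -mulmxBr -linearB /=.
by congr (_ *m diag_mx _ *m _); apply/rowP => i; rewrite !mxE.
Qed.

Lemma diag_conj_scale w (a e : 'rV[F]_n) : (forall i, w * a 0 i = e 0 i) ->
  w *: (S' *m diag_mx a *m S) = S' *m diag_mx e *m S.
Proof.
move=> h; rewrite scalemxAl scalemxAr -linearZ /=.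
by congr (_ *m diag_mx _ *m _); apply/rowP => i; rewrite !mxE.
Qed.

Lemma diag_conj_scalar a : S' *m S = 1%:M -> a%:M = S' *m diag_mx (const_mx a) *m S.
Proof.
by move=> SS'; rewrite diag_const_mx -mulmxA mul_scalar_mx -scalemxAr SS' scalemx1.
Qed.

End DiagConj.

(** * Matrices with rows and columns indexed by vertices *)

Section Kernel.
Variables (F : comNzRingType) (X : finType).

(** Matrices are handled through their kernels: an identity between matrices
    becomes an identity between functions of two vertices, proved by counting. *)
Definition kmx (f : X -> X -> F) : 'M[F]_#|X| :=
  \matrix_(i, j) f (enum_val i) (enum_val j).

Lemma kmxE f x y : kmx f (enum_rank x) (enum_rank y) = f x y.
Proof. by rewrite mxE !enum_rankK. Qed.

Lemma eq_kmx f g : (forall x y, f x y = g x y) -> kmx f = kmx g.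
Proof. by move=> e; apply/matrixP => i j; rewrite !mxE e. Qed.

Lemma sum_enum_val (g : X -> F) : \sum_(i < #|X|) g (enum_val i) = \sum_x g x.
Proof.
rewrite [RHS](reindex (@enum_val X predT)); last first.
  by exists enum_rank => z _; rewrite ?enum_valK ?enum_rankK.
by apply: eq_bigr.
Qed.

Lemma kmxM f g : kmx f *m kmx g = kmx (fun x y => \sum_z f x z * g z y).
Proof.
apply/matrixP => i j; rewrite !mxE -sum_enum_val.
by apply: eq_bigr => l _; rewrite !mxE.
Qed.

Lemma kmxD f g : kmx f + kmx g = kmx (fun x y => f x y + g x y).
Proof. by apply/matrixP => i j; rewrite !mxE. Qed.

Lemma kmxZ a f : a *: kmx f = kmx (fun x y => a * f x y).
Proof. by apply/matrixP => i j; rewrite !mxE. Qed.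

Lemma kmx0 f : (forall x y, f x y = 0) -> kmx f = 0.
Proof. by move=> e; apply/matrixP => i j; rewrite !mxE e. Qed.

Lemma kmx_tr f : (kmx f)^T = kmx (fun x y => f y x).
Proof. by apply/matrixP => i j; rewrite !mxE. Qed.

Lemma mxtrace_kmx f : \tr (kmx f) = \sum_x f x x.
Proof. by rewrite -sum_enum_val; apply: eq_bigr => i _; rewrite mxE. Qed.

Lemma kmx_mulv f (v : 'cV[F]_#|X|) y :
  (kmx f *m v) (enum_rank y) 0 = \sum_z f y z * v (enum_rank z) 0.
Proof.
rewrite mxE -sum_enum_val; apply: eq_bigr => l _.
by rewrite mxE enum_rankK enum_valK.
Qed.

Lemma colP_rank (v w : 'cV[F]_#|X|) :
  (forall y, v (enum_rank y) 0 = w (enum_rank y) 0) -> v = w.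
Proof. by move=> e; apply/colP => i; have := e (enum_val i); rewrite enum_valK. Qed.

End Kernel.

Section Main.
Variables (R : realType) (X : finType) (adj : rel X).
Hypothesis graph_adj : connected_simple_graph adj.
Hypothesis drg_adj : distance_regular adj.
Hypothesis bip_adj : bipartite adj.
Hypothesis diam_ge4 : (4 <= diameter adj)%N.
Hypothesis val_ge3 : (3 <= valency adj)%N.
Hypothesis diam_odd : odd (diameter adj).

Local Notation d := (gdist adj).
Local Notation D := (diameter adj).
Local Notation C := R[i].
Local Notation c i := (c_num adj i).
Local Notation b i := (b_num adj i).
Local Notation k := (valency adj).
Local Notation A := (adjmx C adj).
Local Notation E x i := (dual_idem R adj x i).

(** * Distances and intersection numbers *)

Local Open Scope nat_scope.

Let adjC : symmetric adj. Proof. by case: graph_adj. Qed.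
Let adj_irr : irreflexive adj. Proof. by case: graph_adj. Qed.
Let conn x y : connect adj x y. Proof. by case: graph_adj. Qed.

Lemma walkP n x y :
  reflect (exists p, [/\ size p = n, path adj x p & last x p = y])
          (walk adj n x y).
Proof.
apply: (iffP existsP) => [[p /andP[pp /eqP lp]]|[p [sp pp lp]]].
  by exists p; split=> //; rewrite size_tuple.
have /eqP sp' := sp.
by exists (Tuple sp'); rewrite /= pp lp eqxx.
Qed.

Lemma gdist_eq0 x y : (d x y == 0) = (x == y).
Proof.
apply/eqP/eqP => [d0|->].
  have := walk_gdist (conn x y); rewrite d0 => /walkP[p [/size0nil-> _ /= ->]] //.
have w : walk adj 0 y y by apply/walkP; exists [::].
by have := gdist_min w; case: (d y y).
Qed.

Lemma gdistxx x : d x x = 0.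
Proof. by apply/eqP; rewrite gdist_eq0. Qed.

Lemma gdist_eq1 x y : (d x y == 1) = adj x y.
Proof.
apply/eqP/idP => [d1|xy].
  have := walk_gdist (conn x y); rewrite d1 => /walkP[[|z [|t p]] [] //= _].
  by rewrite andbT => a <-.
have w : walk adj 1 x y by apply/walkP; exists [:: y]; rewrite /= xy.
have := gdist_min w.
have : d x y != 0 by rewrite gdist_eq0; apply: contraTneq xy => ->; rewrite adj_irr.
by case: (d x y) => [|[]].
Qed.

Lemma gdist_triangle x y z : d x z <= d x y + d y z.
Proof.
have /walkP[p [sp pp lp]] := walk_gdist (conn x y).
have /walkP[q [sq pq lq]] := walk_gdist (conn y z).
apply: gdist_min; apply/walkP; exists (p ++ q).
by rewrite size_cat cat_path last_cat sp sq pp lp pq lq.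
Qed.

Lemma gdistC x y : d x y = d y x.
Proof.
suff le a b : d a b <= d b a by apply/eqP; rewrite eqn_leq !le.
have /walkP[p [sp pp lp]] := walk_gdist (conn b a).
apply: gdist_min; apply/walkP; exists (rev (belast b p)).
split; first by rewrite size_rev size_belast.
  rewrite -lp rev_path; apply: sub_path pp => u v.
  by rewrite /= adjC.
by rewrite -lp; case: (p) => //= u q; rewrite rev_cons last_rcons.
Qed.

Lemma gdist_step n x y : d x y = n.+1 -> exists2 z, adj x z & d z y = n.
Proof.
move=> dn; have := walk_gdist (conn x y); rewrite dn.
case/walkP=> -[|z p] /= [] // [sp] /andP[xz pp] lp; exists z => //.
have le : d z y <= n by apply: gdist_min; apply/walkP; exists p.
have := gdist_triangle x z y; rewrite dn.
have /eqP-> : d x z == 1 by rewrite gdist_eq1.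
by rewrite ltnS => ge; apply/eqP; rewrite eqn_leq le ge.
Qed.

Lemma gdist_diameter x y : d x y <= D.
Proof.
rewrite /diameter; apply: leq_trans (leq_bigmax (F := fun x => \max_y d x y) x).
exact: (leq_bigmax (F := fun y => d x y)).
Qed.

Lemma gdist_prefix n x y : n <= d x y -> exists2 z, d x z = n & d z y = d x y - n.
Proof.
elim: n => [|n IH] lt_n; first by exists x; rewrite ?gdistxx ?subn0.
have [z xz zy] := IH (ltnW lt_n).
have [t zt ty] : exists2 t, adj z t & d t y = (d x y - n).-1.
  by apply: gdist_step; rewrite zy; lia.
exists t; last by rewrite ty; lia.
have := gdist_triangle x z t; have := gdist_triangle x t y.
have /eqP-> : d z t == 1 by rewrite gdist_eq1.
by rewrite xz ty; lia.
Qed.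

Lemma gdist_adj_le x y z : adj y z -> d x z <= (d x y).+1.
Proof.
move=> yz; have := gdist_triangle x y z.
have /eqP-> : d y z == 1 by rewrite gdist_eq1.
by rewrite addn1.
Qed.

Lemma bip_colour : exists f : X -> bool, forall x y, odd (d x y) = (f x != f y).
Proof.
have [Y [hY hY']] := bip_adj.
have fl x y : adj x y -> (x \in Y) != (y \in Y).
  move=> xy; case: (boolP (x \in Y)) => xY; case: (boolP (y \in Y)) => yY //.
    by have := hY _ _ xY yY; rewrite xy.
  by have := hY' x y; rewrite !inE xY yY xy => /(_ isT isT).
exists (fun x => x \in Y) => x y.
move: {2}(d x y) (erefl (d x y)) => n; elim: n x => [|n IH] x dn.
  by move/eqP: (dn); rewrite gdist_eq0 => /eqP->; rewrite gdistxx eqxx.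
have [z xz zy] := gdist_step dn.
have := fl _ _ xz; have := IH _ zy; rewrite dn zy /=.
by case: (x \in Y); case: (y \in Y); case: (z \in Y) => //= ->.
Qed.

(** In a bipartite graph the parity of the distance is additive. With the
    triangle inequality it leaves two values for d(x, z) when y and z are
    adjacent and d(x, y) is known, and three when y and z are at distance 2. *)
Lemma odd_gdistD x y z : odd (d x z) = odd (d x y) (+) odd (d y z).
Proof.
have [f hf] := bip_colour; rewrite !hf.
by case: (f x); case: (f y); case: (f z).
Qed.

Lemma gdist_adj_cases x y z :
  adj y z -> (d x z = (d x y).+1) \/ (d x y = (d x z).+1).
Proof.
move=> yz; have := gdist_adj_le x yz.
have zy : adj z y by rewrite adjC.
have := gdist_adj_le x zy.
have := odd_gdistD x y z.
have /eqP-> : d y z == 1 by rewrite gdist_eq1.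
lia.
Qed.

Lemma gdist2_cases x y z :
  d y z = 2 -> [\/ d x z = (d x y).+2, d x z = d x y | d x y = (d x z).+2].
Proof.
move=> yz; have := gdist_triangle x y z; have := gdist_triangle x z y.
have := odd_gdistD x y z.
rewrite (gdistC z y) yz => o t1 t2.
case: (ltngtP (d x z) (d x y)) => h; [apply: Or33|apply: Or31|apply: Or32]; lia.
Qed.

Lemma exists_diameter : exists x y, d x y = D.
Proof.
have X0 : 0 < #|X|.
  case: (posnP #|X|) => // /card0_eq e; move: diam_ge4.
  by rewrite /diameter big_pred0.
have [x hx] := bigop.eq_bigmax (fun x => \max_y d x y) X0.
have [y hy] := bigop.eq_bigmax (fun y => d x y) X0.
by exists x, y; rewrite /diameter hx hy.
Qed.

Lemma triple_countE h i j x y :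
  h <= D -> i <= D -> d x y = h -> triple_count adj i j x y = inter_num adj h i j.
Proof.
move=> hD iD xy.
have [jD|jD] := leqP j D; last first.
  have z x' y' : triple_count adj i j x' y' = 0.
    apply: eq_card0 => z; rewrite inE; apply/negP => /andP[_ /eqP e].
    by have := gdist_diameter z y'; lia.
  by rewrite z /inter_num; case: pickP => // u _; rewrite z.
rewrite /inter_num; case: pickP => [[x' y'] /= /eqP e|/(_ (x, y))].
  exact: (drg_adj hD iD jD).
by rewrite /= xy eqxx.
Qed.

Lemma card_closer x y :
  #|[set z | adj x z & d z y == (d x y).-1]| = c (d x y).
Proof.
rewrite /c_num -(@triple_countE _ _ _ x y) ?gdist_diameter //; last by lia.
by apply: eq_card => z; rewrite !inE gdist_eq1.
Qed.

Lemma card_farther x y :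
  #|[set z | adj x z & d z y == (d x y).+1]| = b (d x y).
Proof.
rewrite /b_num -(@triple_countE _ _ _ x y) ?gdist_diameter //; last by lia.
by apply: eq_card => z; rewrite !inE gdist_eq1.
Qed.

Lemma card_neighbours x : #|[set z | adj x z]| = k.
Proof.
rewrite /valency; have := card_farther x x; rewrite gdistxx => <-.
by apply: eq_card => z; rewrite !inE gdistC gdist_eq1 andbb.
Qed.

Lemma c_num0 : c 0 = 0.
Proof.
have [x _] := exists_diameter.
have := card_closer x x; rewrite gdistxx => <-; apply: eq_card0 => z.
by rewrite !inE gdist_eq0 /=; apply/negP => /andP[h /eqP e]; rewrite e adj_irr in h.
Qed.

Lemma c_num1 : c 1 = 1.
Proof.
have [x [y xy]] := exists_diameter.
have [z xz _] : exists2 z, d x z = 1 & d z y = d x y - 1.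
  by apply: gdist_prefix; rewrite xy; lia.
have := card_closer x z; rewrite xz /= => <-; apply/eqP/cards1P; exists z.
apply/setP => t; rewrite !inE gdist_eq0; case: eqP => [->|]; last by rewrite andbF.
by rewrite andbT -gdist_eq1 xz.
Qed.

Lemma b_num_diameter : b D = 0.
Proof.
have [x [y xy]] := exists_diameter.
rewrite -xy -card_farther xy; apply: eq_card0 => z; rewrite !inE.
by apply/negP => /andP[_ /eqP e]; have := gdist_diameter z y; lia.
Qed.

Lemma c_addn_b i : i <= D -> c i + b i = k.
Proof.
have [x0 [y xy]] := exists_diameter => iD.
have [x dx] : exists x, d x y = i.
  have [|z _ e] := @gdist_prefix (D - i) x0 y; first by rewrite xy leq_subr.
  by exists z; rewrite e xy subKn.
rewrite -dx -card_closer -card_farther -(card_neighbours x).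
rewrite -cardsUI [X in _ + X]eq_card0 ?addn0; last first.
  by move=> z; rewrite !inE; apply/negP; lia.
apply: eq_card => z; rewrite !inE -andb_orr; case xz : (adj x z) => //=.
have := gdist_adj_cases y xz; rewrite !(gdistC y).
by case=> ->; rewrite /= eqxx ?orbT.
Qed.

Lemma c_num_gt0 i : 0 < i <= D -> 0 < c i.
Proof.
have [x0 [y xy]] := exists_diameter => /andP[i0 iD].
have [x dx] : exists x, d x y = i.
  have [|z _ e] := @gdist_prefix (D - i) x0 y; first by rewrite xy leq_subr.
  by exists z; rewrite e xy subKn.
rewrite -dx -card_closer; apply/card_gt0P.
have [|z xz zy] := @gdist_step i.-1 x y; first by rewrite dx; lia.
by exists z; rewrite !inE xz zy dx /=.
Qed.

Lemma b_num_gt0 i : i < D -> 0 < b i.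
Proof.
have [x0 [y xy]] := exists_diameter => iD.
have [z _ e] : exists2 z, d x0 z = D - i.+1 & d z y = i.+1.
  have [|z e1 e2] := @gdist_prefix (D - i.+1) x0 y; first by rewrite xy leq_subr.
  by exists z; rewrite // e2 xy subKn.
have [t zt ty] := gdist_step e.
rewrite -ty -card_farther; apply/card_gt0P; exists z.
by rewrite !inE adjC zt e ty eqxx.
Qed.

Lemma c_num_diameter : c D = k.
Proof. by have := c_addn_b (leqnn D); rewrite b_num_diameter addn0. Qed.

(** Since b_i > 0 for i < D, a geodesic from x to y can be prolonged one step
    at a time up to length D. *)
Lemma exists_gdist_from x y i : d x y <= i <= D -> exists2 z, d x z = i & d y z = i - d x y.
Proof.
move=> /andP[]; elim: i => [|i IH] le iD.
  by exists y; [lia|rewrite gdistxx; lia].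
have [e|lt] := eqVneq (d x y) i.+1; first by exists y; rewrite ?gdistxx ?e; lia.
have [||z xz yz] := IH; [lia|lia|].
have : 0 < b (d z x) by apply: b_num_gt0; rewrite gdistC xz.
rewrite -card_farther => /card_gt0P[t]; rewrite !inE => /andP[zt /eqP tx].
have dxt : d x t = i.+1 by rewrite gdistC tx gdistC xz.
exists t => //.
have := gdist_triangle x y t; have := gdist_adj_le y zt; rewrite dxt yz; lia.
Qed.

Local Open Scope ring_scope.

(** * Radial matrices and dual idempotents *)

Lemma sum_neighbours (f : nat -> C) x y :
  \sum_z (adj x z)%:R * f (d z y)
  = (c (d x y))%:R * f (d x y).-1 + (b (d x y))%:R * f (d x y).+1.
Proof.
have hc : \sum_(z | adj x z && (d z y == (d x y).-1)) f (d z y)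
          = (c (d x y))%:R * f (d x y).-1.
  rewrite (eq_bigr (fun _ => f (d x y).-1)) => [|z /andP[_ /eqP->]//].
  rewrite sumr_const mulr_natl -card_closer; congr (GRing.natmul _ _).
  by apply: eq_card => z; rewrite !inE.
have hb : \sum_(z | adj x z && (d z y == (d x y).+1)) f (d z y)
          = (b (d x y))%:R * f (d x y).+1.
  rewrite (eq_bigr (fun _ => f (d x y).+1)) => [|z /andP[_ /eqP->]//].
  rewrite sumr_const mulr_natl -card_farther; congr (GRing.natmul _ _).
  by apply: eq_card => z; rewrite !inE.
rewrite -hc -hb (bigID (fun z => adj x z)) /= [X in _ + X]big1 ?addr0; last first.
  by move=> z /negbTE->; rewrite mul0r.
rewrite (bigID (fun z => d z y == (d x y).-1)) /=; congr (_ + _).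
  by apply: eq_bigr => z /andP[-> _]; rewrite mul1r.
apply: congr_big => // [z|z /andP[-> _]]; last by rewrite mul1r.
case xz : (adj x z) => //=.
have := gdist_adj_cases y xz; rewrite (gdistC y x) (gdistC y z).
case: eqP => e; case: eqP => e' //=; lia.
Qed.

(** An element of the Bose-Mesner algebra: the entry at (y, z) depends only on
    the distance. *)
Definition rad (f : nat -> C) : 'M[C]_#|X| := kmx (fun x y => f (d x y)).

Lemma rad_tr f : (rad f)^T = rad f.
Proof. by rewrite kmx_tr; apply: eq_kmx => x y; rewrite gdistC. Qed.

Lemma eq_rad f g : (forall i, (i <= D)%N -> f i = g i) -> rad f = rad g.
Proof. by move=> e; apply: eq_kmx => x y; rewrite e // gdist_diameter. Qed.

Lemma rad_comb a f b' g : a *: rad f + b' *: rad g = rad (fun i => a * f i + b' * g i).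
Proof. by apply/matrixP => i j; rewrite !mxE. Qed.

Lemma adjmxE : A = kmx (fun x y => (adj x y)%:R).
Proof. by []. Qed.

Lemma adj_rad f :
  A *m rad f = rad (fun i => (c i)%:R * f i.-1 + (b i)%:R * f i.+1).
Proof. by rewrite adjmxE kmxM; apply: eq_kmx => x y; rewrite sum_neighbours. Qed.

Lemma A_tr : A^T = A.
Proof.
rewrite adjmxE kmx_tr; apply: eq_kmx => x y.
by rewrite -!gdist_eq1 gdistC.
Qed.

Lemma rad_adj f : rad f *m A = A *m rad f.
Proof. by rewrite -[LHS]trmxK trmx_mul rad_tr A_tr adj_rad rad_tr. Qed.

(** The distance matrices; they span the radial matrices. *)
Definition Am (j : nat) := rad (fun i => (i == j)%:R).
Arguments Am j%_N.

Lemma AmE j : Am j = kmx (fun x y => (d x y == j)%:R).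
Proof. by []. Qed.

Lemma Am0 : Am 0 = 1%:M.
Proof.
apply/matrixP => i j; rewrite !mxE gdist_eq0.
by rewrite (inj_eq enum_val_inj).
Qed.

Lemma Am1 : Am 1 = A.
Proof. by rewrite adjmxE; apply: eq_kmx => x y; rewrite gdist_eq1. Qed.

Lemma Am_big j : (D < j)%N -> Am j = 0.
Proof.
move=> jD; apply: kmx0 => x y; case: eqP => // e.
by have := gdist_diameter x y; lia.
Qed.

(** The three-term recurrence. Bipartiteness makes a_i = 0, so that no middle
    term occurs. *)
Lemma adj_Am j :
  A *m Am j.+1 = (b j)%:R *: Am j + (c j.+2)%:R *: Am j.+2.
Proof.
rewrite adj_rad rad_comb; apply: eq_rad => -[|i] iD /=.
  by rewrite c_num0 mul0r add0r mulr0 addr0 !eqSS; case: eqP => [<-|]; rewrite ?mulr0.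
rewrite !eqSS addrC; congr (_ + _).
  by case: (i.+1 =P j) => [->//|]; rewrite !mulr0.
by case: (i =P j.+1) => [->//|]; rewrite !mulr0.
Qed.

Lemma rad_sum f : rad f = \sum_(j < D.+1) f j *: Am j.
Proof.
apply/matrixP => i j; rewrite summxE !mxE.
set m := d _ _; have mD : (m < D.+1)%N by rewrite ltnS gdist_diameter.
rewrite (bigD1 (Ordinal mD)) //= !mxE /= eqxx mulr1 big1 ?addr0 // => l.
rewrite -val_eqE /= !mxE => /negbTE; rewrite eq_sym => -> /=; exact: mulr0.
Qed.

Section Base.
Variable x : X.

Lemma dual_idemE i : E x i = kmx (fun y z => (y == z)%:R * (d x y == i)%:R).
Proof.
apply/matrixP => p q; by rewrite !mxE (inj_eq enum_val_inj) mulr_natl.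
Qed.

Lemma dual_mulv i (v : 'cV[C]_#|X|) y :
  (E x i *m v) (enum_rank y) 0 = (d x y == i)%:R * v (enum_rank y) 0.
Proof.
rewrite dual_idemE kmx_mulv (bigD1 y) //= eqxx mul1r big1 ?addr0 // => z.
by rewrite eq_sym => /negbTE->; rewrite !mul0r.
Qed.

Lemma dual_kmx i f : E x i *m kmx f = kmx (fun y z => (d x y == i)%:R * f y z).
Proof.
rewrite dual_idemE kmxM; apply: eq_kmx => y z.
rewrite (bigD1 y) //= eqxx mul1r big1 ?addr0 // => t.
by rewrite eq_sym => /negbTE->; rewrite !mul0r.
Qed.

Lemma kmx_dual i f : kmx f *m E x i = kmx (fun y z => f y z * (d x z == i)%:R).
Proof.
rewrite dual_idemE kmxM; apply: eq_kmx => y z.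
rewrite (bigD1 z) //= eqxx mul1r big1 ?addr0 // => t.
by move=> /negbTE->; rewrite !(mul0r, mulr0).
Qed.

Lemma dual_tr i : (E x i)^T = E x i.
Proof. by rewrite tr_diag_mx. Qed.

Lemma dual_mul i j : E x i *m E x j = if i == j then E x i else 0.
Proof.
case: eqP => [<-|ij]; rewrite [X in _ *m X]dual_idemE dual_kmx.
  rewrite dual_idemE; apply: eq_kmx => y z.
  by case: eqP; rewrite ?(mul0r, mul1r, mulr0, mulr1).
apply: kmx0 => y z; case: eqP => [->|]; rewrite ?mul0r //.
by rewrite (introF eqP ij) !mulr0.
Qed.

Lemma dual_idem2 i : E x i *m E x i = E x i.
Proof. by rewrite dual_mul eqxx. Qed.

Lemma dual_big i : (D < i)%N -> E x i = 0.
Proof.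
move=> iD; rewrite dual_idemE; apply: kmx0 => y z; case: (d x y =P i) => [e|].
  by have := gdist_diameter x y; lia.
by rewrite mulr0.
Qed.

Lemma sum_dual : \sum_(i < D.+1) E x i = 1%:M.
Proof.
apply/matrixP => p q; rewrite summxE !mxE.
under eq_bigr => i _ do rewrite !mxE.
have mD : (d x (enum_val p) < D.+1)%N by rewrite ltnS gdist_diameter.
rewrite (bigD1 (Ordinal mD)) //= eqxx big1 ?addr0 // => l.
by rewrite -val_eqE /= eq_sym => /negbTE->; rewrite mul0rn.
Qed.

Let kE := (adjmxE, AmE).

(** A vertex z at distance r + j + 1 from x and j + 1 from some y at distance
    r from x lies beyond y on a geodesic from x, so that its c_(j+1)
    neighbours nearer to y are nearer to x as well. *)
Lemma raise_Am r j :
  E x (r + j).+1 *m A *m E x (r + j) *m Am j *m E x r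
  = (c j.+1)%:R *: (E x (r + j).+1 *m Am j.+1 *m E x r).
Proof.
rewrite !kE dual_kmx kmx_dual kmxM !kmx_dual dual_kmx kmx_dual kmxZ.
apply: eq_kmx => z y.
case: (d x z =P (r + j).+1) => [xz|_]; last first.
  by rewrite !mul0r mulr0 big1 ?mul0r // => t _; rewrite !mul0r.
case: (d x y =P r) => [xy|_]; last by rewrite !mulr0.
rewrite !mul1r !mulr1.
have e t : (adj z t)%:R * (d x t == r + j)%N%:R * (d t y == j)%:R
         = (adj z t)%:R * (d t y == j)%:R :> C.
  case zt : (adj z t); rewrite ?mul0r // !mul1r.
  case: (d t y =P j) => [ty|]; rewrite ?mulr0 ?mulr1 //.
  suff -> : d x t = (r + j)%N by rewrite eqxx.
  have := gdist_triangle x y t; have := gdist_adj_cases x zt.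
  by rewrite (gdistC y) xy ty xz; lia.
under eq_bigr => t _ do rewrite mul1r e.
rewrite (sum_neighbours (fun i => (i == j)%:R)).
have := gdist_triangle x y z; rewrite xz xy (gdistC y) => tr.
have [zy|zy] := eqVneq (d z y) j.+1.
    have h : (j.+2 == j) = false by lia.
  by rewrite zy /= eqxx h mulr0 addr0.
have h1 : ((d z y).-1 == j) = false by lia.
have h2 : ((d z y).+1 == j) = false by lia.
by rewrite h1 h2 !mulr0 addr0.
Qed.

(** Here x lies on a geodesic from the vertex to y, so that the b_(i+r)
    neighbours of the vertex that are farther from y are farther from x as
    well. *)
Lemma lower_Am r i :
  E x i *m A *m E x i.+1 *m Am (i.+1 + r)%N *m E x r
  = (b (i + r)%N)%:R *: (E x i *m Am (i + r)%N *m E x r).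
Proof.
rewrite !kE dual_kmx kmx_dual kmxM !kmx_dual dual_kmx kmx_dual kmxZ.
apply: eq_kmx => z y.
case: (d x z =P i) => [xz|_]; last first.
  by rewrite !mul0r mulr0 big1 ?mul0r // => t _; rewrite !mul0r.
case: (d x y =P r) => [xy|_]; last by rewrite !mulr0.
rewrite !mul1r !mulr1.
have e t : (adj z t)%:R * (d x t == i.+1)%N%:R * (d t y == i.+1 + r)%N%:R
         = (adj z t)%:R * (d t y == i.+1 + r)%N%:R :> C.
  case zt : (adj z t); rewrite ?mul0r // !mul1r.
  case: (d t y =P _) => [ty|]; rewrite ?mulr0 ?mulr1 //.
  suff -> : d x t = i.+1 by rewrite eqxx.
  have := gdist_triangle t x y; have := gdist_adj_cases x zt.
  by rewrite (gdistC t x) xy ty xz; lia.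
under eq_bigr => t _ do rewrite mul1r e.
rewrite (sum_neighbours (fun l => (l == i.+1 + r)%N%:R)).
have := gdist_triangle z x y; rewrite (gdistC z x) xz xy => tr.
have [zy|zy] := eqVneq (d z y) (i + r)%N.
  have h1 : ((i + r).-1 == i.+1 + r)%N = false by lia.
  have h2 : ((i + r).+1 == i.+1 + r)%N = true by lia.
  by rewrite zy h1 h2 mulr0 add0r.
have h1 : ((d z y).-1 == i.+1 + r)%N = false by lia.
have h2 : ((d z y).+1 == i.+1 + r)%N = false by lia.
by rewrite h1 h2 !mulr0 addr0.
Qed.

Lemma adj_dual i : A *m E x i.+1 = E x i.+2 *m A *m E x i.+1 + E x i *m A *m E x i.+1.
Proof.
rewrite adjmxE !dual_kmx !kmx_dual kmxD; apply: eq_kmx => z y.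
case: (d x y =P i.+1) => [xy|_]; last by rewrite !mulr0 addr0.
rewrite !mulr1 -mulrDl; case zy : (adj z y); rewrite ?mulr0 // mulr1.
have := gdist_adj_cases x zy; rewrite xy.
case=> [[<-]|->].
  have h : (i == i.+2) = false by lia.
  by rewrite eqxx h add0r.
have h : (i.+2 == i) = false by lia.
by rewrite eqxx h addr0.
Qed.

(** From a vertex at distance 2 from x, a vertex at distance j + 2 from x is
    at distance j, j + 2 or j + 4. *)
Lemma dual_rad_dual2 j f :
  E x j.+2 *m rad f *m E x 2 = E x j.+2 *m (f j *: Am j + f j.+2 *: Am j.+2
                                      + f j.+4 *: Am j.+4) *m E x 2.
Proof.
rewrite /rad !kE !kmxZ !kmxD !dual_kmx !kmx_dual; apply: eq_kmx => z y.
case: (d x z =P j.+2) => [xz|_]; last by rewrite !mul0r.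
case: (d x y =P 2) => [xy|_]; last by rewrite !mulr0.
have := gdist2_cases z xy; rewrite !(gdistC z x) xz => cs.
congr (_ * _ * _); case: (d z y =P j) => [->|n1].
  have h1 : (j == j.+2) = false by lia.
  have h2 : (j == j.+4) = false by lia.
  by rewrite h1 h2 !mulr0 !addr0 mulr1.
case: (d z y =P j.+2) => [->|n2].
  have h : (j.+2 == j.+4) = false by lia.
  by rewrite h !mulr0 addr0 add0r mulr1.
case: (d z y =P j.+4) => [->|n3]; first by rewrite !mulr0 !add0r mulr1.
by exfalso; case: cs; lia.
Qed.

End Base.

(** * Cosine sequences and their matrices *)

(** The defining recurrence for the cosines u_i of an eigenvalue th; the
    equation at i = D expresses that th is an eigenvalue. *)
Definition cosine_seq (th : R) (u : nat -> R) : Prop :=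
  u 0%N = 1 /\
  forall i, (i <= D)%N -> (c i)%:R * u i.-1 + (b i)%:R * u i.+1 = th * u i.

(** The recurrence carries two consecutive values. *)
Fixpoint cosine_pair (th : R) (i : nat) : R * R :=
  if i is i'.+1 then
    let p := cosine_pair th i' in (p.2, (th * p.2 - (c i)%:R * p.1) / (b i)%:R)
  else (1, th / k%:R).

Definition cosine th i : R := (cosine_pair th i).1.

Lemma cosine_rec th i :
  (i < D)%N -> (c i)%:R * cosine th i.-1 + (b i)%:R * cosine th i.+1 = th * cosine th i.
Proof.
case: i => [|i] iD; rewrite /cosine /=.
  have k0 : (valency adj)%:R != 0 :> R.
    by rewrite pnatr_eq0 -lt0n; apply: b_num_gt0; apply: leq_trans diam_ge4.
  by rewrite c_num0 mul0r add0r; field.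
have b0 : (b i.+1)%:R != 0 :> R by rewrite pnatr_eq0 -lt0n b_num_gt0.
by field.
Qed.

(** The number of vertices at distance i from a vertex, through k_(i+1)
    c_(i+1) = k_i b_i. *)
Fixpoint sphere_size (i : nat) : R :=
  if i is i'.+1 then sphere_size i' * (b i')%:R / (c i)%:R else 1.

Lemma sphere_size_neq0 i : (i <= D)%N -> sphere_size i != 0.
Proof.
elim: i => [|i IH] iD /=; first exact: oner_neq0.
rewrite mulf_neq0 ?invr_eq0 ?mulf_neq0 ?IH ?pnatr_eq0 -?lt0n ?b_num_gt0 ?c_num_gt0 //; lia.
Qed.

Lemma sphere_sizeE i : (i < D)%N -> sphere_size i.+1 * (c i.+1)%:R = sphere_size i * (b i)%:R.
Proof.
by move=> iD /=; rewrite divfK // pnatr_eq0 -lt0n c_num_gt0 //; lia.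
Qed.

(** Each A_i is a polynomial in A, so that an eigenvector of A is one of A_i,
    with eigenvalue k_i u_i. *)
Lemma Am_eigen (th : R) (w : 'cV[C]_#|X|) :
  A *m w = th%:C *: w ->
  forall i, (i <= D)%N -> Am i *m w = (sphere_size i * cosine th i)%:C *: w.
Proof.
move=> Aw i.
suff: (i <= D)%N -> Am i *m w = (sphere_size i * cosine th i)%:C *: w
      /\ ((i < D)%N -> Am i.+1 *m w = (sphere_size i.+1 * cosine th i.+1)%:C *: w).
  by move=> h iD; case: (h iD).
elim: i => [|i IH] iD.
  rewrite Am0 mul1mx mulr1 scale1r; split=> // _.
  rewrite Am1 Aw /cosine /= c_num1; congr (_%:C *: _).
  have k0 : (valency adj)%:R != 0 :> R.
    by rewrite pnatr_eq0 -lt0n; apply: b_num_gt0; apply: leq_trans diam_ge4.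
  by rewrite /valency in k0 *; field.
have [IH1 IH2] := IH (ltnW iD); split; first exact: IH2.
move=> iD2; have ci : (c i.+2)%:R != 0 :> R.
  by rewrite pnatr_eq0 -lt0n c_num_gt0.
have ciC : (c i.+2)%:R != 0 :> C by rewrite pnatr_eq0 -lt0n c_num_gt0.
apply: (scalerI ciC).
have : A *m Am i.+1 *m w = (th%:C * (sphere_size i.+1 * cosine th i.+1)%:C) *: w.
  rewrite -rad_adj -mulmxA Aw -scalemxAr IH2 //.
  by rewrite scalerA.
rewrite adj_Am mulmxDl -!scalemxAl IH1.
move=> e; have -> : (c i.+2)%:R *: (Am i.+2 *m w)
   = (th%:C * (sphere_size i.+1 * cosine th i.+1)%:C) *: w
     - (b i)%:R *: ((sphere_size i * cosine th i)%:C *: w) by rewrite -e addrC addKr.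
rewrite !scalerA -scalerBl; congr (_ *: w).
rewrite -!(rmorph_nat (real_complex R)) -!rmorphM -rmorphB; congr (_%:C).
have r1 := cosine_rec th iD2; rewrite /= in r1.
have := sphere_sizeE (ltnW iD2); have := sphere_sizeE iD2; have := sphere_sizeE iD => h1 h2 h3.
have -> : (c i.+2)%:R * (sphere_size i.+2 * cosine th i.+2)
          = sphere_size i.+1 * ((b i.+1)%:R * cosine th i.+2) by rewrite mulrCA mulrA h2 -mulrA.
have -> : (b i)%:R * (sphere_size i * cosine th i) = sphere_size i.+1 * ((c i.+1)%:R * cosine th i).
  by rewrite !mulrA h1 (mulrC (sphere_size i)).
rewrite -[cosine th i]/(cosine th i.+1.-1) in r1 *.
by rewrite mulrCA -r1; ring.
Qed.

Lemma adjmx_map : A = map_mx (real_complex R) (adjmx R adj).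
Proof. by apply/matrixP => i j; rewrite !mxE rmorph_nat. Qed.

(** A_(D+1) = 0, so that the recurrence for the eigenvalues k_i u_i of the A_i
    closes at i = D. *)
Lemma eigen_cosine (th : R) : eigenvalue (adjmx R adj) th -> cosine_seq th (cosine th).
Proof.
case/eigenvalueP => v vA v0.
pose w : 'cV[C]_#|X| := map_mx (real_complex R) v^T.
have AT : (adjmx R adj)^T = adjmx R adj.
  apply/matrixP => i j; rewrite !mxE.
  by case: graph_adj => s _ _; rewrite s.
have Aw : A *m w = th%:C *: w.
  rewrite adjmx_map -map_mxM -map_mxZ; congr map_mx.
  by rewrite -[LHS]trmxK trmx_mul AT trmxK vA linearZ.
have w0 : w != 0.
  by rewrite map_mx_eq0 trmx_eq0.
split=> // i; rewrite leq_eqVlt => /predU1P[->|]; last exact: cosine_rec.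
have [n Dn] : exists n, D = n.+1 by exists D.-1; lia.
have : A *m Am D *m w = (th%:C * (sphere_size D * cosine th D)%:C) *: w.
  rewrite -rad_adj -mulmxA Aw -scalemxAr.
  by rewrite (Am_eigen Aw) // scalerA.
rewrite {1}Dn adj_Am (Am_big (j := n.+2)); last by lia.
rewrite scaler0 addr0 -scalemxAl (Am_eigen Aw) ?scalerA; last by lia.
move/eqP; rewrite -subr_eq0 -scalerBl scaler_eq0 (negbTE w0) orbF subr_eq0 => /eqP.
rewrite -!(rmorph_nat (real_complex R)) -!rmorphM => /complexI e.
have kD := sphere_size_neq0 (leqnn D).
have h : sphere_size D * (c D)%:R = sphere_size n * (b n)%:R by rewrite [in LHS]Dn sphere_sizeE // Dn.
have pn : D.-1 = n by rewrite Dn.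
by apply: (mulfI kD); rewrite b_num_diameter mul0r addr0 mulrA [RHS]mulrCA -e h pn; ring.
Qed.

Section Seq.
Variables (th : R) (u : nat -> R).

Lemma u0 : cosine_seq th u -> u 0%N = 1. Proof. by case. Qed.
Lemma urec i : cosine_seq th u -> (i <= D)%N ->
  (c i)%:R * u i.-1 + (b i)%:R * u i.+1 = th * u i.
Proof. by case=> _; apply. Qed.

(** Cosines are real numbers, while modules are complex vector spaces. *)
Definition toC i : C := (u i)%:C.
(** Up to a positive scalar this is the primitive idempotent of the
    eigenvalue. *)
Definition cosmx := rad toC.

Lemma adj_cosmx : cosine_seq th u -> A *m cosmx = th%:C *: cosmx.
Proof.
move=> cos_u.
rewrite adj_rad.
rewrite -[RHS]addr0 -(scale0r (rad toC)) rad_comb; apply: eq_rad => // i iD.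
rewrite mul0r addr0 /toC -!(rmorph_nat (real_complex R)) -!rmorphM -rmorphD.
by rewrite (urec cos_u) // .
Qed.

Lemma cosmx_adj : cosine_seq th u -> cosmx *m A = th%:C *: cosmx.
Proof. by move=> cos_u; rewrite rad_adj (adj_cosmx cos_u). Qed.

Lemma Am_cosmx i : cosine_seq th u -> exists a : R, Am i *m cosmx = a%:C *: cosmx.
Proof.
move=> cos_u.
have [iD|iD] := leqP i D; last first.
  by exists 0; rewrite Am_big // mul0mx scale0r.
suff [_ //] : (exists a : R, Am i *m cosmx = a%:C *: cosmx)
     /\ (exists a : R, Am i.-1 *m cosmx = a%:C *: cosmx) by [].
elim: i iD => [|[|i] IH] iD.
- by rewrite Am0 mul1mx; split; exists 1; rewrite scale1r.
- rewrite Am1 (adj_cosmx cos_u) Am0 mul1mx.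
  by split; [exists th|exists 1; rewrite scale1r].
have [[a1 e1] [a0 e0]] := IH (ltnW iD); split; last by exists a1.
have ciC : (c i.+2)%:R != 0 :> C by rewrite pnatr_eq0 -lt0n c_num_gt0.
have : A *m Am i.+1 *m cosmx = (th * a1)%:C *: cosmx.
  rewrite -rad_adj -mulmxA (adj_cosmx cos_u).
  by rewrite -scalemxAr e1 scalerA rmorphM.
rewrite adj_Am mulmxDl -!scalemxAl.
rewrite /= in e0; rewrite e0 => e.
exists ((th * a1 - (b i)%:R * a0) / (c i.+2)%:R).
apply: (scalerI ciC).
have -> : (c i.+2)%:R *: (Am i.+2 *m cosmx)
   = (th * a1)%:C *: cosmx - (b i)%:R *: (a0%:C *: cosmx) by rewrite -e addrC addKr.
rewrite !scalerA -scalerBl; congr (_ *: _).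
rewrite -!(rmorph_nat (real_complex R)) -!rmorphM -rmorphB; congr (_%:C).
have ci : (c i.+2)%:R != 0 :> R by rewrite pnatr_eq0 -lt0n c_num_gt0.
by field.
Qed.

(** The matrix is an eigenvector of every radial matrix, hence of itself; the
    eigenvalue is a diagonal entry of the square, a sum of squares that
    contains u_0^2 = 1. *)
Lemma cosmx_sqr : cosine_seq th u -> exists2 a : R, 0 < a & cosmx *m cosmx = a%:C *: cosmx.
Proof.
move=> cos_u.
have [f hf] : exists f : nat -> R, forall i, Am i *m cosmx = (f i)%:C *: cosmx.
  have /boolp.choice [f hf] : forall i, exists a : R, Am i *m cosmx = a%:C *: cosmx by move=> i; exact: Am_cosmx.
  by exists f.
pose a := \sum_(j < D.+1) u j * f j.
have e : cosmx *m cosmx = a%:C *: cosmx.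
  rewrite {1}/cosmx rad_sum mulmx_suml rmorph_sum scaler_suml.
  by apply: eq_bigr => j _; rewrite -scalemxAl hf scalerA rmorphM.
exists a => //.
have [x _] := exists_diameter.
have : (cosmx *m cosmx) (enum_rank x) (enum_rank x) = a%:C.
  by rewrite e !mxE !enum_rankK gdistxx /toC (u0 cos_u) mulr1.
rewrite kmxM kmxE => h.
suff : 0 < a%:C by rewrite ltcR.
rewrite -h (bigD1 x) //= gdistxx /toC (u0 cos_u) mulr1 ltr_wpDr //.
apply: sumr_ge0 => z _; rewrite (gdistC z x) -rmorphM lecR.
by rewrite -expr2 sqr_ge0.
Qed.

(** Only these differences of cosines matter on the vectors orthogonal to the
    all-ones vector. *)
Definition gap i : R := u i - u i.+2.

(** The differences satisfy a three-term recurrence of their own, because c_i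
    + b_i is constant. *)
Lemma gap_rec i : cosine_seq th u -> (i.+2 <= D)%N ->
  th * gap i = (c i)%:R * gap i.-1 + (b i.+2)%:R * gap i.+1.
Proof.
move=> cos_u.
move=> iD; rewrite /gap mulrBr -!(urec cos_u) //; last by lia.
have iD' : (i <= D)%N by lia.
have -> : (b i)%:R = (valency adj)%:R - (c i)%:R :> R.
  by rewrite -(c_addn_b iD') natrD addrAC subrr add0r.
have -> : (c i.+2)%:R = (valency adj)%:R - (b i.+2)%:R :> R.
  by rewrite -(c_addn_b iD) natrD addrK.
case: i iD {iD'} => [|i] iD /=; last by ring.
by rewrite c_num0; ring.
Qed.

Lemma gap0 : cosine_seq th u -> (valency adj)%:R * (b 1)%:R * gap 0 = (valency adj)%:R ^+ 2 - th ^+ 2.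
Proof.
move=> cos_u.
have k0 : (valency adj)%:R != 0 :> R.
  by rewrite pnatr_eq0 -lt0n; apply: b_num_gt0; apply: leq_trans diam_ge4.
have D1 : (1 <= D)%N by lia.
have e0 := urec cos_u (leq0n D); have e1 := urec cos_u D1.
have kE : 1 + (b 1)%:R = (valency adj)%:R :> R by rewrite -(c_addn_b D1) c_num1 natrD.
rewrite c_num0 (u0 cos_u) /= mul0r add0r mulr1 -[b 0]/(valency adj) in e0.
rewrite c_num1 /= (u0 cos_u) mul1r in e1; rewrite /gap (u0 cos_u).
transitivity ((valency adj)%:R * ((b 1)%:R + 1) - (valency adj)%:R * (1 + (b 1)%:R * u 2)); first by ring.
by rewrite e1 mulrCA e0 [(b 1)%:R + 1]addrC kE; ring.
Qed.

Lemma gap1 : cosine_seq th u -> (b 2)%:R * gap 1 = th * gap 0.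
Proof.
move=> cos_u.
have D2 : (2 <= D)%N by lia.
by rewrite (gap_rec cos_u D2) c_num0 mul0r add0r.
Qed.

Lemma gap2 : cosine_seq th u -> (b 2)%:R * (b 3)%:R * gap 2 = (th ^+ 2 - (b 2)%:R) * gap 0.
Proof.
move=> cos_u.
have D3 : (3 <= D)%N by lia.
have e := gap_rec cos_u D3; rewrite c_num1 mul1r /= in e.
transitivity ((b 2)%:R * (th * gap 1) - (b 2)%:R * gap 0); first by rewrite e; ring.
by rewrite mulrCA (gap1 cos_u); ring.
Qed.

(** Otherwise the recurrence, read backwards from D, would annihilate every
    u_i. *)
Lemma u_neq0_D : cosine_seq th u -> u D != 0.
Proof.
move=> cos_u.
apply/eqP => uD.
suff h j : (j <= D)%N -> u (D - j)%N = 0 /\ u (D - j.+1)%N = 0.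
  have [e _] := h D (leqnn D); move: e; rewrite subnn (u0 cos_u).
  by apply/eqP; exact: oner_neq0.
elim: j => [|j IH] jD.
  rewrite subn0 subn1; split=> //.
  have := urec cos_u (leqnn D); rewrite b_num_diameter uD mul0r addr0 mulr0 c_num_diameter => /eqP.
  rewrite mulf_eq0 pnatr_eq0 => /predU1P[k0|/eqP//].
  by have := b_num_gt0 (leq_trans (isT : (0 < 4)%N) diam_ge4); rewrite -[b 0]/(valency adj) k0.
have [h1 h2] := IH (ltnW jD); split=> //.
case: (leqP D j.+1) => [le|lt].
  have -> : (D - j.+2 = D - j.+1)%N by lia.
  exact: h2.
have := urec (i := (D - j.+1)%N) cos_u (leq_subr _ _).
have -> : (D - j.+1).+1 = (D - j)%N by lia.
rewrite h1 h2 !mulr0 addr0 -subnS => /eqP.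
rewrite mulf_eq0 pnatr_eq0 => /predU1P[k0|/eqP//].
by have := @c_num_gt0 (D - j.+1); rewrite k0; lia.
Qed.

End Seq.

Lemma cosmx_tr u : (cosmx u)^T = cosmx u.
Proof. exact: rad_tr. Qed.

(** * The eigenvalues *)

Local Notation eigs := (eigenvalues R adj).
Local Notation th_ i := (theta R adj i).

Fixpoint cospoly_pair (i : nat) : {poly R} * {poly R} :=
  if i is i'.+1 then
    let p := cospoly_pair i' in
    (p.2, 'X * p.2 - ((b i')%:R * (c i)%:R) *: p.1)
  else (1, 'X).

(** The numerators of the cosines, as polynomials in the eigenvalue; every
    eigenvalue is a root of the polynomial of degree D + 1. *)
Definition cospoly i := (cospoly_pair i).1.

Lemma cospolySS i :
  cospoly i.+2 = 'X * cospoly i.+1 - ((b i)%:R * (c i.+1)%:R) *: cospoly i.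
Proof. by []. Qed.

Lemma size_cospoly i : size (cospoly i) = i.+1 /\ size (cospoly i.+1) = i.+2.
Proof.
elim: i => [|i [IH1 IH2]]; first by rewrite /cospoly /= size_poly1 size_polyX.
split=> //; rewrite cospolySS.
have p0 : cospoly i.+1 != 0 by rewrite -size_poly_eq0 IH2.
have e : size ('X * cospoly i.+1) = i.+3 by rewrite mulrC size_mulX // IH2.
rewrite size_polyDl e // size_polyN.
by rewrite (leq_ltn_trans (size_scale_leq _ _)) // IH1.
Qed.

Lemma horner_cospoly th u : cosine_seq th u ->
  forall i, (i <= D.+1)%N -> (cospoly i).[th] = (\prod_(j < i) (b j)%:R) * u i.
Proof.
move=> cu.
suff h i : ((i <= D.+1)%N -> (cospoly i).[th] = (\prod_(j < i) (b j)%:R) * u i)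
  /\ ((i < D.+1)%N -> (cospoly i.+1).[th] = (\prod_(j < i.+1) (b j)%:R) * u i.+1).
  by move=> i; case: (h i).
elim: i => [|i [IH1 IH2]].
  rewrite big_ord0 mul1r (u0 cu) hornerC; split=> // _.
  rewrite /cospoly /= hornerX big_ord1.
  by have := urec cu (leq0n D); rewrite c_num0 mul0r add0r (u0 cu) mulr1.
split=> // iD; rewrite cospolySS hornerD hornerN hornerZ hornerM hornerX.
rewrite IH2 ?(ltnW iD) // IH1 ?(ltnW (ltnW iD)) //.
have := urec cu (i := i.+1); rewrite -ltnS => /(_ iD) /= e.
by rewrite mulrCA -e !big_ord_recr /=; ring.
Qed.

Lemma root_cospoly th u : cosine_seq th u -> root (cospoly D.+1) th.
Proof.
move=> cu; rewrite /root (horner_cospoly cu) // big_ord_recr /= b_num_diameter.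
by rewrite mulr0 mul0r.
Qed.

Lemma uniq_eigs : uniq eigs.
Proof.
apply: (sorted_uniq _ _ (sorted_eigenvalues R adj)).
  by move=> x y z /= h1 h2; apply: lt_trans h2 h1.
by move=> x /=; apply: ltxx.
Qed.

Lemma eig_cosine th : th \in eigs -> cosine_seq th (cosine th).
Proof. by rewrite mem_eigenvalues; apply: eigen_cosine. Qed.

Lemma size_eigs_le : (size eigs <= D.+1)%N.
Proof.
have s : size (cospoly D.+1) = D.+2 by case: (size_cospoly D.+1).
rewrite -ltnS -s; apply: max_poly_roots; last exact: uniq_eigs.
  by rewrite -size_poly_eq0 s.
apply/allP => th /eig_cosine; exact: root_cospoly.
Qed.

(** The spectral theorem for the symmetric real matrix A, with real
    eigenvalues. *)
Lemma adjmx_spectral : exists (S : 'M[C]_#|X|) (r : 'I_#|X| -> R),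
  [/\ S *m map_mx Num.conj S^T = 1%:M, map_mx Num.conj S^T *m S = 1%:M,
      A = map_mx Num.conj S^T *m diag_mx (\row_i (r i)%:C) *m S
    & forall i, r i \in eigs].
Proof.
have hA : A \is hermsymmx.
  apply/is_hermitianmxP; rewrite expr0 scale1r A_tr.
  by apply/matrixP => i j; rewrite !mxE rmorph_nat.
have nA : A \is normalmx by apply: hermitian_normalmx.
have /orthomx_spectralP eA := nA.
set S := spectralmx A in eA *; set v := spectral_diag A in eA *.
have US : S \is unitarymx by apply: spectral_unitarymx.
have SS : S *m map_mx Num.conj S^T = 1%:M by apply/unitarymxP.
have SS' : map_mx Num.conj S^T *m S = 1%:M by apply: mulmx1C.
have vr i : v 0 i \is Num.real by apply: (mxOverP (hermitian_spectral_diag_real hA)).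
exists S, (fun i => complex.Re (v 0 i)).
have ev : \row_i (complex.Re (v 0 i))%:C = v.
  by apply/rowP => i; rewrite mxE RRe_real.
split=> //.
  by rewrite ev {1}eA invmx_unitary.
move=> i; rewrite mem_eigenvalues eigenvalue_root_char.
have er : real_complex R (complex.Re (v 0 i)) = v 0 i by apply: RRe_real.
suff : root (map_poly (real_complex R) (char_poly (adjmx R adj))) (v 0 i).
  by rewrite -er fmorph_root.
rewrite map_char_poly -adjmx_map -eigenvalue_root_char; apply/eigenvalueP; exists (row i S).
  rewrite -row_mul eA invmx_unitary // !mulmxA SS mul1mx row_mul.
  by apply/rowP => j; rewrite !mxE (bigD1 i) //= !mxE eqxx mulr1n big1 ?addr0 // => l;
     rewrite !mxE eq_sym => /negbTE->; rewrite mulr0n mul0r.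
apply/eqP => r0; have := congr1 (fun M : 'M[C]_#|X| => M i i) SS.
rewrite !mxE eqxx big1 => [/eqP|l _].
  by rewrite eq_sym oner_eq0.
by have := congr1 (fun M : 'rV[C]_#|X| => M 0 l) r0; rewrite !mxE => ->; rewrite mul0r.
Qed.

Fixpoint prod_shift (s : seq R) : 'M[C]_#|X| :=
  if s is a :: s' then (A - a%:C%:M) *m prod_shift s' else 1%:M.

(** A product of s shifts of A has a nonzero entry at distance s and vanishes
    at larger distances. *)
Lemma prod_shift_entry s : exists2 a : C, a != 0 & forall x y,
  (size s <= d x y)%N ->
  prod_shift s (enum_rank x) (enum_rank y) = if size s == d x y then a else 0.
Proof.
elim: s => [|t s [a a0 IH]] /=.
  exists 1 => [|x y _]; first exact: oner_neq0.
  by rewrite mxE (inj_eq enum_rank_inj) -gdist_eq0 eq_sym; case: eqP.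
have [sD|sD] := ltnP (size s) D; last first.
  exists 1 => [|x y h]; first exact: oner_neq0.
  by have := gdist_diameter x y; lia.
exists ((c (size s).+1)%:R * a) => [|x y h].
  by rewrite mulf_neq0 // pnatr_eq0 -lt0n c_num_gt0.
have e : \sum_z (adj x z)%:R * prod_shift s (enum_rank z) (enum_rank y)
  = \sum_z (adj x z)%:R * (if size s == d z y then a else 0).
  apply: eq_bigr => z _; case xz : (adj x z); rewrite ?mul0r // IH //.
  by have := gdist_adj_cases y xz; rewrite !(gdistC y); lia.
rewrite mulmxBl mul_scalar_mx mxE.
have -> : (A *m prod_shift s) (enum_rank x) (enum_rank y)
   = \sum_z (adj x z)%:R * prod_shift s (enum_rank z) (enum_rank y).
  rewrite mxE -[RHS]sum_enum_val; apply: eq_bigr => l _.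
  by rewrite adjmxE mxE enum_rankK enum_valK.
rewrite e (sum_neighbours (fun i => if size s == i then a else 0)).
rewrite [in X in _ + X]mxE mxE IH ?(ltnW h) //.
have -> : (size s == d x y) = false by lia.
have -> : (size s == (d x y).+1) = false by lia.
rewrite !mulr0 subr0 addr0.
case: (eqVneq (size s).+1 (d x y)) => [<-|ne]; first by rewrite eqxx.
have -> : (size s == (d x y).-1) = false by lia.
by rewrite mulr0.
Qed.

Lemma prod_shift_spectral (S : 'M[C]_#|X|) (r : 'I_#|X| -> R) s :
  S *m map_mx Num.conj S^T = 1%:M -> map_mx Num.conj S^T *m S = 1%:M ->
  A = map_mx Num.conj S^T *m diag_mx (\row_i (r i)%:C) *m S ->
  prod_shift s = map_mx Num.conj S^T
      *m diag_mx (\row_i (\prod_(a <- s) (r i - a)%:C)) *m S.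
Proof.
move=> SS SS' eA; elim: s => [|a s IH] /=.
  have -> : \row_i \prod_(a <- [::]) (r i - a)%:C = const_mx 1.
    by apply/rowP => i; rewrite !mxE big_nil.
  by rewrite diag_const_mx mulmx1.
have -> : A - a%:C%:M = map_mx Num.conj S^T *m diag_mx (\row_i (r i - a)%:C) *m S.
  rewrite {1}eA (diag_conj_scalar a%:C SS'); apply: diag_conj_sub => i.
  by rewrite !mxE rmorphB.
by rewrite IH; apply: (diag_conj_mul SS) => i; rewrite !mxE big_cons.
Qed.

(** At most D + 1 eigenvalues since they are roots of one polynomial of degree
    D + 1; at least D + 1 since the product of the shifts by the eigenvalues
    vanishes whereas a product of at most D shifts has a nonzero entry. *)
Lemma size_eigs : size eigs = D.+1.
Proof.
apply/eqP; rewrite eqn_leq size_eigs_le ltnNge; apply/negP => le.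
have [S [r [SS SS' eA re]]] := adjmx_spectral.
have p0 : prod_shift eigs = 0.
  rewrite (prod_shift_spectral eigs SS SS' eA).
  have -> : \row_i \prod_(a <- eigs) (r i - a)%:C = 0.
    apply/rowP => i; rewrite !mxE (big_rem _ (re i)) /= subrr.
    by rewrite rmorph0 mul0r.
  by rewrite linear0 mulmx0 mul0mx.
have [a a0 h] := prod_shift_entry eigs.
have [x [y xy]] := exists_diameter.
have [|z xz _] := @gdist_prefix (size eigs) x y; first by rewrite xy.
have := h x z; rewrite xz leqnn eqxx p0 mxE => /(_ isT) /esym /eqP.
exact/negP.
Qed.

Lemma root_cospolyE th : (th \in eigs) = root (cospoly D.+1) th.
Proof.
apply/idP/idP => [/eig_cosine|r]; first exact: root_cospoly.
apply/negPn/negP => n.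
have s : size (cospoly D.+1) = D.+2 by case: (size_cospoly D.+1).
have : (size (th :: eigs) < size (cospoly D.+1))%N.
  apply: max_poly_roots; first by rewrite -size_poly_eq0 s.
    rewrite /= r; apply/allP => t /eig_cosine; exact: root_cospoly.
  by rewrite /= n uniq_eigs.
by rewrite s /= size_eigs ltnn.
Qed.

Lemma cospolyN th i : (cospoly i).[- th] = (-1) ^+ i * (cospoly i).[th].
Proof.
suff [] : (cospoly i).[- th] = (-1) ^+ i * (cospoly i).[th]
  /\ (cospoly i.+1).[- th] = (-1) ^+ i.+1 * (cospoly i.+1).[th] by [].
elim: i => [|i [IH1 IH2]].
  by rewrite /cospoly /= !hornerX !hornerC expr0 expr1 mul1r mulN1r; split.
split=> //; rewrite cospolySS !hornerD !hornerN !hornerZ !hornerM !hornerX IH1 IH2.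
by rewrite !exprS; ring.
Qed.

Lemma eigsN th : (- th \in eigs) = (th \in eigs).
Proof.
by rewrite !root_cospolyE /root cospolyN mulf_eq0 signr_eq0.
Qed.

Lemma eigs_valency : (valency adj)%:R \in eigs.
Proof.
rewrite root_cospolyE; apply: (@root_cospoly _ (fun _ => 1)); split=> // i iD.
by rewrite !mulr1 -natrD c_addn_b.
Qed.

Lemma cosine_sum th u : cosine_seq th u -> exists2 a : R, 0 < a &
  forall x y, \sum_z u (d x z) * u (d z y) = a * u (d x y).
Proof.
move=> cu; have [a a0 e] := cosmx_sqr cu; exists a => // x y.
have := congr1 (fun M : 'M[C]_#|X| => M (enum_rank x) (enum_rank y)) e.
rewrite kmxM kmxE !mxE !enum_rankK /toC.
under eq_bigr => z _ do rewrite -rmorphM.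
by rewrite -rmorph_sum -rmorphM => /complexI.
Qed.

Lemma eigs_le th : th \in eigs -> th ^+ 2 <= (valency adj)%:R ^+ 2.
Proof.
move=> thE; have cu := eig_cosine thE; set u := cosine th in cu.
have [a a0 h] := cosine_sum cu.
have [x [y xy]] := exists_diameter.
have [|z xz _] := @gdist_prefix 1 x y; first by rewrite xy; lia.
have k0 : 0 < (valency adj)%:R :> R by rewrite ltr0n; apply: leq_trans val_ge3.
have u1 : (valency adj)%:R * u 1%N = th.
  by have := urec cu (leq0n D); rewrite c_num0 mul0r add0r (u0 cu) mulr1.
have pos s : s ^+ 2 = 1 -> 0 <= 1 - s * u 1%N.
  move=> s2; have : 0 <= \sum_w (u (d x w) - s * u (d w z)) ^+ 2.
    by apply: sumr_ge0 => w _; apply: sqr_ge0.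
  have -> : \sum_w (u (d x w) - s * u (d w z)) ^+ 2 = 2%:R * a * (1 - s * u 1%N).
    transitivity (\sum_w u (d x w) * u (d w x) + \sum_w u (d z w) * u (d w z)
       - 2%:R * s * \sum_w u (d x w) * u (d w z)).
      rewrite mulr_sumr -sumrN -!big_split /=; apply: eq_bigr => w _.
      by rewrite (gdistC w x) (gdistC z w) sqrrB exprMn s2; ring.
    by rewrite !h !gdistxx xz (u0 cu); ring.
  by rewrite pmulr_rge0 // mulr_gt0.
have p1 : 0 <= 1 - 1 * u 1%N by apply: pos; rewrite expr1n.
have p2 : 0 <= 1 - (-1) * u 1%N by apply: pos; rewrite sqrrN expr1n.
rewrite -u1 exprMn ger_pMr ?exprn_gt0 //; nra.
Qed.

Lemma theta_lt i j : (i < j)%N -> (j <= D)%N -> th_ j < th_ i.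
Proof.
move=> ij jD; apply: (sorted_ltn_nth _ 0 (sorted_eigenvalues R adj)) => //.
- by move=> x y z /= h1 h2; apply: lt_trans h2 h1.
- by rewrite inE size_eigs; lia.
- by rewrite inE size_eigs; lia.
Qed.

Lemma theta_le i j : (i <= j)%N -> (j <= D)%N -> th_ j <= th_ i.
Proof.
by rewrite leq_eqVlt => /predU1P[->//|ij] jD; apply/ltW/theta_lt.
Qed.

Lemma theta_eigs i : (i <= D)%N -> th_ i \in eigs.
Proof. by move=> iD; rewrite mem_nth // size_eigs. Qed.

(** The spectrum of a bipartite graph is symmetric about 0, and the
    enumeration is decreasing. *)
Lemma thetaN i : (i <= D)%N -> th_ (D - i) = - th_ i.
Proof.
move=> iD; have e : eigs = rev (map -%R eigs).
  apply: (irr_sorted_eq (leT := fun a b : R => b < a)).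
  - by move=> x y z /= h1 h2; apply: lt_trans h2 h1.
  - by move=> x /=; apply: ltxx.
  - exact: sorted_eigenvalues.
  - rewrite rev_sorted sorted_map; apply: sub_sorted (sorted_eigenvalues R adj).
    by move=> x y /=; rewrite ltrN2.
  move=> x; rewrite [RHS]mem_rev -[in RHS](opprK x) mem_map ?eigsN //; exact: oppr_inj.
rewrite /theta {1}e nth_rev ?size_map size_eigs; last by lia.
have -> : (D.+1 - (D - i).+1 = i)%N by lia.
by rewrite (nth_map 0) // size_eigs.
Qed.

Lemma theta0 : th_ 0 = (valency adj)%:R.
Proof.
have k0 : 0 <= (valency adj)%:R :> R by apply: ler0n.
have h := eigs_valency; rewrite -[_ \in _]index_mem size_eigs in h.
have le : (valency adj)%:R <= th_ 0.
  by rewrite -[leLHS](nth_index 0 eigs_valency) theta_le.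
have := eigs_le (theta_eigs (leq0n D)).
rewrite ler_sqr ?nnegrE ?(le_trans k0 le) // => ge.
by apply/eqP; rewrite eq_le ge le.
Qed.

Local Notation dd := (D./2).

Lemma dd_def : D = dd.*2.+1.
Proof. by rewrite -[LHS]odd_double_half diam_odd. Qed.

Lemma dd_gt1 : (1 < dd)%N. Proof. have := dd_def; lia. Qed.

Lemma theta_d_gt0 : 0 < th_ dd.
Proof.
have := @theta_lt dd dd.+1 (ltnSn _); have e := dd_def.
have -> : dd.+1 = (D - dd)%N by lia.
rewrite thetaN; last by lia.
move=> h; have : - th_ dd < th_ dd by apply: h; lia.
by lra.
Qed.

Definition nontriv th := (th \in eigs) && (th ^+ 2 != (valency adj)%:R ^+ 2).

Lemma nontriv_theta i : (0 < i < D)%N -> nontriv (th_ i).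
Proof.
case/andP=> i0 iD; rewrite /nontriv (theta_eigs (ltnW iD)).
rewrite andTb.
rewrite eqf_sqr.
rewrite -theta0.
rewrite -thetaN // subn0 negb_or.
have := theta_lt i0 (ltnW iD); have := theta_lt iD (leqnn _) => h1 h2.
by rewrite (lt_eqF h2) (gt_eqF h1).
Qed.

Lemma nontriv_lt th : nontriv th -> th ^+ 2 < (valency adj)%:R ^+ 2.
Proof. by case/andP=> h n; rewrite lt_neqAle n eigs_le. Qed.

Lemma nontriv_eig th : nontriv th -> th \in eigs. Proof. by case/andP. Qed.

Lemma theta1_gt0 : 0 < th_ 1.
Proof. apply: lt_le_trans theta_d_gt0 _; apply: theta_le; have := dd_def; lia. Qed.

(** Here D is odd: the spectrum is symmetric and avoids 0, so that theta_d is
    the least positive eigenvalue and theta_d^2 is the least of the squares. *)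
Lemma nontriv_bounds th : nontriv th -> th_ dd ^+ 2 <= th ^+ 2 <= th_ 1 ^+ 2.
Proof.
case/andP=> hth nt.
suff pos a : a \in eigs -> a ^+ 2 != (valency adj)%:R ^+ 2 -> 0 <= a ->
   th_ dd ^+ 2 <= a ^+ 2 <= th_ 1 ^+ 2.
  case: (leP 0 th) => h; first exact: pos.
  by rewrite -(sqrrN th); apply: pos; rewrite ?eigsN ?sqrrN //; lra.
move=> aE na a0; have ai : (index a eigs <= D)%N.
  by have := aE; rewrite -index_mem size_eigs.
have ea := nth_index 0 aE; rewrite -[eigs`_ _]/(th_ _) in ea.
move: ai ea; set i := index a eigs => ai ea.
have i0 : (0 < i)%N.
  rewrite lt0n; apply/eqP => i0; move: na; rewrite -ea i0 theta0 eqxx //.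
have id : (i <= dd)%N.
  rewrite leqNgt; apply/negP => id.
  have e := dd_def; have : th_ i <= th_ (D - dd) by apply: theta_le => //; lia.
  rewrite thetaN; last by lia.
  by rewrite ea; have := theta_d_gt0; lra.
have dD : (dd <= D)%N by have := dd_def; lia.
have h1 := theta_le id dD; have h2 := theta_le i0 ai; rewrite ea in h1 h2.
have h3 := theta_d_gt0.
rewrite !ler_sqr ?nnegrE ?h1 ?h2 //; lra.
Qed.

Lemma nontriv1 : nontriv (th_ 1). Proof. by apply: nontriv_theta; lia. Qed.
Lemma nontrivd : nontriv (th_ dd).
Proof. by apply: nontriv_theta; have := dd_def; lia. Qed.

Lemma theta_d_lt1 : th_ dd ^+ 2 < th_ 1 ^+ 2.
Proof.
have h := theta_d_gt0; have h1 := theta1_gt0; have h2 := dd_gt1; have e := dd_def.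
by rewrite ltr_sqr ?nnegrE ?theta_lt ?ltW //; lia.
Qed.

(** Positivity is read off in an orthonormal eigenbasis: a polynomial in A
    that is nonnegative on the spectrum is positive semidefinite, and its form
    vanishes only on its kernel. *)
Lemma psd_form (q : R -> R) (Q : 'M[C]_#|X|) (v : 'cV[C]_#|X|) :
  (forall S : 'M[C]_#|X|, forall r : 'I_#|X| -> R,
    S *m map_mx Num.conj S^T = 1%:M -> map_mx Num.conj S^T *m S = 1%:M ->
    A = map_mx Num.conj S^T *m diag_mx (\row_i (r i)%:C) *m S ->
    Q = map_mx Num.conj S^T *m diag_mx (\row_i (q (r i))%:C) *m S) ->
  (forall r, r \in eigs -> 0 <= q r) ->
  let f := (map_mx Num.conj v^T *m Q *m v) 0 0 in
  0 <= f /\ (f = 0 -> Q *m v = 0).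
Proof.
move=> hQ hq; have [S [r [SS SS' eA re]]] := adjmx_spectral.
have eQ := hQ S r SS SS' eA; pose z := S *m v.
have zE : map_mx Num.conj v^T *m map_mx Num.conj S^T = map_mx Num.conj z^T.
  by rewrite -map_mxM trmx_mul.
have fE : (map_mx Num.conj v^T *m Q *m v) 0 0 = \sum_i (q (r i))%:C * (z i 0 * (z i 0)^*%R).
  rewrite eQ !mulmxA zE -mulmxA -/z mxE; apply: eq_bigr => i _.
  by rewrite mul_mx_diag !mxE; ring.
have pos i : 0 <= (q (r i))%:C * (z i 0 * (z i 0)^*%R).
  by rewrite mulr_ge0 ?mul_conjC_ge0 // lecR hq.
rewrite /= fE; split; first by apply: sumr_ge0.
move=> /psumr_eq0P h; rewrite eQ -!mulmxA -/z.
suff -> : diag_mx (\row_i (q (r i))%:C) *m z = 0 by rewrite mulmx0.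
apply/colP => i; rewrite mul_diag_mx; clearbody z; rewrite !mxE.
have /eqP := h (fun i _ => pos i) i isT.
rewrite !mulf_eq0 conjC_eq0 orbb => /orP[]/eqP->; by rewrite ?mul0r ?mulr0.
Qed.

(** * Signs of the differences of the extreme cosine sequences *)

Definition sq_shift (t : R) : 'M[C]_#|X| := (t ^+ 2)%:C%:M - A *m A.

Lemma sq_shift_spectral (S : 'M[C]_#|X|) (r : 'I_#|X| -> R) t :
  S *m map_mx Num.conj S^T = 1%:M -> map_mx Num.conj S^T *m S = 1%:M ->
  A = map_mx Num.conj S^T *m diag_mx (\row_i (r i)%:C) *m S ->
  sq_shift t = map_mx Num.conj S^T *m diag_mx (\row_i (t ^+ 2 - r i ^+ 2)%:C) *m S.
Proof.
move=> SS SS' eA; rewrite /sq_shift.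
have eAA : A *m A = map_mx Num.conj S^T *m diag_mx (\row_i (r i ^+ 2)%:C) *m S.
  by rewrite {1 2}eA; apply: (diag_conj_mul SS) => i; rewrite !mxE -rmorphM.
rewrite (diag_conj_scalar (t ^+ 2)%:C SS') eAA; apply: diag_conj_sub => i.
by rewrite !mxE rmorphB.
Qed.

(** The matrix A_(j-2) + A_(j-4) + ..., on which A acts by a three-term
    recurrence with the same c_i and b_i, and which k^2 - A^2 takes back to
    distance matrices. *)
Definition lower_sum j := rad (fun i => ((i.+2 <= j)%N && ~~ odd (i + j))%:R).

Lemma lower_sum0 : lower_sum 0 = 0. Proof. exact: kmx0. Qed.
Lemma lower_sum1 : lower_sum 1 = 0. Proof. exact: kmx0. Qed.

Lemma adj_lower_sum j : (j <= D)%N ->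
  A *m lower_sum j.+1 = (c j)%:R *: lower_sum j.+2 + (b j)%:R *: lower_sum j.
Proof.
move=> jD; rewrite adj_rad rad_comb; apply: eq_rad => i iD.
have cbj := c_addn_b jD; have cbi := c_addn_b iD.
have e0 : (c i)%:R * ((i.-1.+2 <= j.+1)%N && ~~ odd (i.-1 + j.+1))%:R
          = (c i)%:R * ((i <= j)%N && ~~ odd (i + j))%:R :> C.
  case: (posnP i) => [->|i0]; first by rewrite c_num0 !mul0r.
  congr (_ * (nat_of_bool _)%:R); lia.
have e1 : (i.+1.+2 <= j.+1)%N && ~~ odd (i.+1 + j.+1)
          = (i.+2 <= j)%N && ~~ odd (i + j) by lia.
have e2 : (i.+2 <= j.+2)%N && ~~ odd (i + j.+2) = (i <= j)%N && ~~ odd (i + j) by lia.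
rewrite e0 e1 e2; case: (boolP (odd (i + j))) => oj.
  by rewrite !andbF !mulr0.
rewrite !andbT; case: (ltngtP i j) => ij; last by rewrite ij.
  have -> : (i.+2 <= j)%N by lia.
  by rewrite !mulr1 -!natrD cbi cbj.
have -> : (i.+2 <= j)%N = false by lia.
by rewrite !mulr0.
Qed.

Lemma lower_sum_diff j : lower_sum j.+2 - lower_sum j = Am j.
Proof.
apply/matrixP => p q; rewrite !mxE; set i := d _ _.
have -> : (i.+2 <= j.+2)%N && ~~ odd (i + j.+2) = (i <= j)%N && ~~ odd (i + j) by lia.
case: (boolP (odd (i + j))) => oj.
  have -> : (i == j) = false by lia.
  by rewrite !andbF subr0.
rewrite !andbT; case: (ltngtP i j) => ij.
- have -> : (i.+2 <= j)%N by lia.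
  by rewrite subrr.
- have -> : (i.+2 <= j)%N = false by lia.
  by rewrite subr0.
- have -> : (i.+2 <= j)%N = false by lia.
  by rewrite subr0.
Qed.

Lemma sq_adj_lower_sum j : (j.+2 <= D)%N ->
  A *m A *m lower_sum j.+2 = ((c j.+1)%:R * (c j.+2)%:R) *: lower_sum j.+4
    + ((c j.+1)%:R * (b j.+2)%:R + (b j.+1)%:R * (c j)%:R) *: lower_sum j.+2
    + ((b j.+1)%:R * (b j)%:R) *: lower_sum j.
Proof.
move=> jD; rewrite -mulmxA adj_lower_sum; last by lia.
rewrite mulmxDr -!scalemxAr !adj_lower_sum //; last by lia.
move: (lower_sum j) (lower_sum j.+2) (lower_sum j.+4) => M0 M2 M4.
apply/matrixP => p q; rewrite !mxE; ring.
Qed.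

Lemma sq_shift_lower_sum j : (j.+2 <= D)%N ->
  sq_shift (valency adj)%:R *m lower_sum j.+2
  = ((b j)%:R * (b j.+1)%:R) *: Am j - ((c j.+1)%:R * (c j.+2)%:R) *: Am j.+2.
Proof.
move=> jD; rewrite mulmxBl sq_adj_lower_sum // mul_scalar_mx -!lower_sum_diff.
have kE i : (i <= D)%N -> (c i)%:R = (valency adj)%:R - (b i)%:R :> C.
  by move=> iD; rewrite -(c_addn_b iD) natrD addrK.
rewrite !kE //; try lia.
rewrite rmorphXn rmorph_nat; move: (lower_sum j) (lower_sum j.+2) (lower_sum j.+4) => M0 M2 M4.
apply/matrixP => p q; rewrite !mxE; ring.
Qed.

Section SignChange.
Variables (th : R) (u : nat -> R).

Local Notation t := (gap u).

(** A function supported below J that solves the recurrence of the eigenvalue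
    th^2 of A^2 up to two boundary terms. It is built by adding the matrices
    lower_sum with the differences of the cosines as coefficients. *)
Definition partial_sol J (g : nat -> R) :=
  [/\ forall i, (J <= i)%N -> g i = 0,
      forall I, J = I.+2 -> g I = t I
    & A *m A *m rad (toC g) - (th ^+ 2)%:C *: rad (toC g)
      = ((c J)%:R * (c J.-1)%:R * t J.-2)%:C *: lower_sum J.+2
        - ((b J)%:R * (b J.+1)%:R * t J)%:C *: lower_sum J].

Lemma partial_sol_start J : (J <= 1)%N -> partial_sol J (fun _ => 0).
Proof.
move=> J1; split; [by []|by move=> I e; lia|].
have -> : rad (toC (fun _ => 0)) = 0 by apply: kmx0.
rewrite mulmx0 scaler0 subr0.
by case: J J1 => [|[|//]] _ /=; rewrite c_num0 ?lower_sum0 ?lower_sum1 ?(mulr0, mul0r) scale0r scaler0 subr0.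
Qed.

Lemma partial_sol_step J g : cosine_seq th u -> (J.+3 <= D)%N ->
  partial_sol J g ->
  partial_sol J.+2 (fun i => g i + t J * ((i.+2 <= J.+2)%N && ~~ odd (i + J.+2))%:R).
Proof.
move=> cu JD.
have e : th ^+ 2 * t J = (c J)%:R * ((c J.-1)%:R * t J.-2 + (b J.+1)%:R * t J)
     + (b J.+2)%:R * ((c J.+1)%:R * t J + (b J.+3)%:R * t J.+2).
  rewrite expr2 -mulrA (gap_rec cu); last by lia.
  rewrite mulrDr mulrCA [th * (_ * t J.+1)]mulrCA (gap_rec cu (i := J.+1)) //=.
  case: (posnP J) => [->|J0]; first by rewrite c_num0 !mul0r.
  by rewrite (gap_rec cu (i := J.-1)) ?prednK //; lia.
case=> g1 g2 g3.
set s := fun i => ((i.+2 <= J.+2)%N && ~~ odd (i + J.+2))%:R : R.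
split.
- move=> i Ji; rewrite g1; last by lia.
  have -> : (i.+2 <= J.+2)%N = false by lia.
  by rewrite mulr0 addr0.
- move=> I [<-]; rewrite (g1 J (leqnn J)) add0r /=.
  have -> : (J.+2 <= J.+2)%N && ~~ odd (J + J.+2) by lia.
  exact: mulr1.
have -> : rad (toC (fun i => g i + t J * s i)) = rad (toC g) + (t J)%:C *: lower_sum J.+2.
  apply/matrixP => p q; rewrite !mxE /toC rmorphD rmorphM /s.
  by rewrite rmorph_nat.
rewrite mulmxDr -scalemxAr sq_adj_lower_sum; last by lia.
rewrite [(th ^+ 2)%:C *: (_ + _)]scalerDr opprD addrACA g3.
have eC : (c J)%:R * (c J.-1)%:R * (t J.-2)%:C =
   (th ^+ 2)%:C * (t J)%:C - (c J)%:R * (b J.+1)%:R * (t J)%:C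
   - (b J.+2)%:R * (c J.+1)%:R * (t J)%:C - (b J.+2)%:R * (b J.+3)%:R * (t J.+2)%:C :> C.
  rewrite -!(rmorph_nat (real_complex R)) -!rmorphM -!rmorphB; congr (_%:C).
  by rewrite e; ring.
rewrite /= !rmorphM !rmorph_nat eC; move: (lower_sum J) (lower_sum J.+2) (lower_sum J.+4) => M0 M2 M4.
apply/matrixP => p q; rewrite !mxE; ring.
Qed.

End SignChange.

Lemma partial_sol_exists th u J : cosine_seq th u -> (J < D)%N ->
  exists g, partial_sol th u J g.
Proof.
move=> cu; elim/ltn_ind: J => -[|[|J]] IH JD.
- by exists (fun _ => 0); apply: partial_sol_start.
- by exists (fun _ => 0); apply: partial_sol_start.
have [||g hg] := IH J; [lia|lia|].
by eexists; apply: (partial_sol_step cu _ hg); lia.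
Qed.

Lemma conj_realC (a : R) : Num.conj a%:C = a%:C.
Proof. by apply/eqP; rewrite eq_complex /= oppr0 !eqxx. Qed.

Lemma delta_form (M : 'M[C]_#|X|) i :
  ((delta_mx i 0 : 'cV_#|X|)^T *m M *m (delta_mx i 0 : 'cV_#|X|)) 0 0 = M i i.
Proof. by rewrite trmx_delta -rowE -colE !mxE. Qed.

Lemma comb_entry (G Y0 Y2 Y4 : 'M[C]_#|X|) (w a1 a2 e1 e2 e3 e4 : C) i :
  (w *: (G *m (a1 *: (e1 *: Y2 - e2 *: Y4) + a2 *: (e3 *: Y0 - e4 *: Y2)))) i i
  = w * (a1 * (e1 * (G *m Y2) i i - e2 * (G *m Y4) i i)
         + a2 * (e3 * (G *m Y0) i i - e4 * (G *m Y2) i i)).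
Proof.
rewrite mulmxDr -!scalemxAr !mulmxBr -!scalemxAr.
by move: (G *m Y0) (G *m Y2) (G *m Y4) => M0 M2 M4; rewrite !mxE.
Qed.

Lemma rad_Am_diag g l x :
  (rad g *m Am l) (enum_rank x) (enum_rank x)
  = g l * #|[set z | d x z == l]|%:R.
Proof.
rewrite kmxM kmxE (bigID (fun z => d x z == l)) /= [X in _ + X]big1 ?addr0.
  rewrite (eq_bigr (fun _ => g l)) => [|z /eqP e].
    rewrite sumr_const mulr_natr; congr (_ *+ _).
    by apply: eq_card => z; rewrite !inE.
  by rewrite e (gdistC z) e eqxx mulr1.
by move=> z /negbTE; rewrite (gdistC z) => ->; rewrite mulr0.
Qed.

(** Test the semidefinite matrix e (k^2 - A^2)(th^2 - A^2) on the column at a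
    vertex of a partial solution. Only boundary terms survive, and the value
    of the form is a positive multiple of e t_J t_(J+2), where t is the
    sequence of differences of cosines. If it were 0, the vector would be in
    the kernel, whereas the outermost boundary term survives. *)
Lemma gap_sign th u (e : R) J : cosine_seq th u ->
  (forall r, r \in eigs -> 0 <= e * (((valency adj)%:R ^+ 2 - r ^+ 2) * (th ^+ 2 - r ^+ 2))) ->
  e != 0 -> (J.+4 <= D)%N -> gap u J != 0 -> 0 < e * (gap u J * gap u J.+2).
Proof.
move=> cu hq e0 JD t0; have J1 : (J.+2 < D)%N by lia.
have [x [x' xx']] := exists_diameter.
have n0 : 0 < #|[set z | d x z == J]|%:R :> R.
  rewrite ltr0n; apply/card_gt0P.
  have [|z xz _] := @gdist_prefix J x x'; first by rewrite xx'; lia.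
  by exists z; rewrite inE xz.
set m := ((b J.+2)%:R * (b J.+3)%:R * (b J)%:R * (b J.+1)%:R * #|[set z | d x z == J]|%:R : R).
have m0 : 0 < m by rewrite !mulr_gt0 // ltr0n b_num_gt0 //; lia.
have [|z xz _] := @gdist_prefix J.+2 x x'; first by rewrite xx'; lia.
have [g [g1 g2 g3]] := partial_sol_exists cu J1.
have s1 : (J.+2 <= D)%N by clear g3; lia.
have gJ : g J = gap u J by apply: g2.
have g42 : (g J.+2 = 0) * (g J.+4 = 0).
  by clear g3; split; apply: g1; lia.
pose Q := e%:C *: (sq_shift (valency adj)%:R *m sq_shift th).
pose ex : 'cV[C]_#|X| := delta_mx (enum_rank x) 0.
pose v := rad (toC g) *m ex.
have := @psd_form (fun r => e * (((valency adj)%:R ^+ 2 - r ^+ 2) * (th ^+ 2 - r ^+ 2))) Q v.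
case.
- move=> S r SS SS' eA; rewrite /Q (sq_shift_spectral _ SS SS' eA) (sq_shift_spectral _ SS SS' eA).
  rewrite (@diag_conj_mul _ _ _ _ _ _ (\row_i (((valency adj)%:R ^+ 2 - r i ^+ 2)%:C
                             * (th ^+ 2 - r i ^+ 2)%:C)) SS) => [|i]; last by rewrite !mxE.
  by apply: diag_conj_scale => i; rewrite !mxE -!rmorphM.
- exact: hq.
have vT : map_mx Num.conj v^T = ex^T *m rad (toC g).
  rewrite trmx_mul rad_tr map_mxM; congr (_ *m _); apply/matrixP => p q; rewrite !mxE.
    by rewrite rmorph_nat.
  exact: conj_realC.
have Qrad : sq_shift (valency adj)%:R *m sq_shift th *m rad (toC g) =
  - ((c J.+2)%:R * (c J.+1)%:R * gap u J)%:C *: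
     (((b J.+2)%:R * (b J.+3)%:R) *: Am J.+2 - ((c J.+3)%:R * (c J.+4)%:R) *: Am J.+4)
  + ((b J.+2)%:R * (b J.+3)%:R * gap u J.+2)%:C *:
     (((b J)%:R * (b J.+1)%:R) *: Am J - ((c J.+1)%:R * (c J.+2)%:R) *: Am J.+2).
  have -> : sq_shift (valency adj)%:R *m sq_shift th *m rad (toC g) = sq_shift (valency adj)%:R *m (sq_shift th *m rad (toC g)).
    by rewrite mulmxA.
  have -> : sq_shift th *m rad (toC g) = - (A *m A *m rad (toC g) - (th ^+ 2)%:C *: rad (toC g)).
    by rewrite opprB /sq_shift mulmxBl mul_scalar_mx.
  rewrite g3 -[J.+2.-1]/(J.+1) -[J.+2.-2]/J mulmxN mulmxBr -!scalemxAr.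
  rewrite (sq_shift_lower_sum s1) (sq_shift_lower_sum JD); clear.
  by move: (_ *: Am J - _) (_ *: Am J.+2 - _) => Y Y'; rewrite opprB scaleNr addrC.
have -> : (map_mx Num.conj v^T *m Q *m v) 0 0
  = (e * (gap u J * gap u J.+2))%:C *
    ((b J.+2)%:R * (b J.+3)%:R * (b J)%:R * (b J.+1)%:R * #|[set z | d x z == J]|%:R).
  have -> : map_mx Num.conj v^T *m Q *m v
    = ex^T *m (e%:C *: (rad (toC g) *m (sq_shift (valency adj)%:R *m sq_shift th *m rad (toC g)))) *m ex.
    by rewrite vT; apply: mulmx_sandwich.
  rewrite delta_form Qrad comb_entry; clear Qrad vT g3.
  rewrite !rad_Am_diag /toC gJ !g42.
  by rewrite !rmorphM !rmorph_nat rmorph0; ring.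
have -> : (b J.+2)%:R * (b J.+3)%:R * (b J)%:R * (b J.+1)%:R
             * #|[set z | d x z == J]|%:R = m%:C by rewrite !rmorphM !rmorph_nat.
rewrite -rmorphM lecR (pmulr_lge0 _ m0) => -[ge0 h].
rewrite lt_neqAle ge0 andbT eq_sym; apply/negP => /eqP z0.
have := h; rewrite z0 mul0r rmorph0 => /(_ erefl) Qv0.
have t2 : gap u J.+2 = 0.
  by move/eqP: z0; rewrite !mulf_eq0 (negbTE e0) (negbTE t0) /= => /eqP.
have := congr1 (fun M : 'cV[C]_#|X| => M (enum_rank z) 0) Qv0.
rewrite /Q /v mulmxA -scalemxAl Qrad t2 mulr0 rmorph0 scale0r addr0.
rewrite -colE !mxE !enum_rankK (gdistC z) xz eqxx.
have -> : (J.+2 == J.+4) = false by lia.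
rewrite mulr0 subr0 mulr1 => /eqP.
rewrite !mulf_eq0 oppr_eq0 -!(rmorph_nat (real_complex R)) !fmorph_eq0.
rewrite (negbTE e0) !mulf_eq0 (negbTE t0) !pnatr_eq0 orbF /=.
have := @c_num_gt0 J.+1; have := @c_num_gt0 J.+2; have := @b_num_gt0 J.+2; have := @b_num_gt0 J.+3.
lia.
Qed.

Lemma gap0_gt0 th u : cosine_seq th u -> nontriv th -> 0 < gap u 0.
Proof.
move=> cu nt; have := gap0 cu; have := nontriv_lt nt.
have b1 : 0 < (b 1)%:R :> R by rewrite ltr0n b_num_gt0 //; lia.
have k0 : 0 < (valency adj)%:R :> R by rewrite ltr0n; lia.
move=> h e; have : 0 < (valency adj)%:R * (b 1)%:R * gap u 0 by rewrite e subr_gt0.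
by rewrite pmulr_rgt0 // mulr_gt0.
Qed.

Lemma gap1_gt0 th u : cosine_seq th u -> nontriv th -> 0 < th -> 0 < gap u 1.
Proof.
move=> cu nt th0; have := gap1 cu.
have b2 : 0 < (b 2)%:R :> R by rewrite ltr0n b_num_gt0 //; lia.
move=> e; have : 0 < (b 2)%:R * gap u 1 by rewrite e mulr_gt0 // (gap0_gt0 cu).
by rewrite pmulr_rgt0.
Qed.

Local Notation u1 := (cosine (th_ 1)).
Local Notation ud := (cosine (th_ dd)).

Lemma cosine1 : cosine_seq (th_ 1) u1.
Proof. exact/eig_cosine/nontriv_eig/nontriv1. Qed.
Lemma cosined : cosine_seq (th_ dd) ud.
Proof. exact/eig_cosine/nontriv_eig/nontrivd. Qed.

(** The sign lemma applies with e = 1, since theta_1^2 is the largest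
    nontrivial squared eigenvalue. *)
Lemma gap_theta1_gt0 j : (j.+2 <= D)%N -> 0 < gap u1 j.
Proof.
elim/ltn_ind: j => -[|[|j]] IH jD.
- exact: (gap0_gt0 cosine1 nontriv1).
- exact: (gap1_gt0 cosine1 nontriv1 theta1_gt0).
have tj : 0 < gap u1 j by apply: IH; lia.
have := gap_sign (e := 1) cosine1 _ (oner_neq0 _) jD (lt0r_neq0 tj).
rewrite mul1r pmulr_rgt0 //; apply => r rE; rewrite mul1r.
have [e|ne] := eqVneq (r ^+ 2) ((valency adj)%:R ^+ 2).
  by rewrite e subrr mul0r.
have nt : nontriv r by rewrite /nontriv rE.
rewrite mulr_ge0 // subr_ge0; first exact/ltW/nontriv_lt.
by case/andP: (nontriv_bounds nt).
Qed.

(** The sign lemma applies with e = -1, since theta_d^2 is the least squared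
    eigenvalue. *)
Lemma gap_thetad_alt j : (j.+4 <= D)%N -> gap ud j != 0 -> gap ud j * gap ud j.+2 < 0.
Proof.
move=> jD tj; have e0 : (-1 : R) != 0 by rewrite oppr_eq0 oner_eq0.
have := gap_sign (e := -1) cosined _ e0 jD tj.
rewrite mulN1r oppr_gt0; apply => r rE; rewrite mulN1r oppr_ge0.
have [e|ne] := eqVneq (r ^+ 2) ((valency adj)%:R ^+ 2).
  by rewrite e subrr mul0r.
have nt : nontriv r by rewrite /nontriv rE.
rewrite mulr_ge0_le0 // ?subr_le0 ?subr_ge0; first exact/ltW/nontriv_lt.
by case/andP: (nontriv_bounds nt).
Qed.

Lemma gap_thetad_neq0 j : (j.+2 <= D)%N -> gap ud j != 0.
Proof.
elim/ltn_ind: j => -[|[|j]] IH jD.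
- exact/lt0r_neq0/(gap0_gt0 cosined nontrivd).
- exact/lt0r_neq0/(gap1_gt0 cosined nontrivd theta_d_gt0).
have tj : gap ud j != 0 by apply: IH; lia.
have := gap_thetad_alt jD tj; apply: contraTneq => ->; by rewrite mulr0 ltxx.
Qed.

Lemma gap_theta1_neq0 j : (j.+2 <= D)%N -> gap u1 j != 0.
Proof. by move=> jD; apply/lt0r_neq0/gap_theta1_gt0. Qed.

Lemma thetad_b2 : th_ dd ^+ 2 < (b 2)%:R.
Proof.
have e := dd_def; have e2 := dd_gt1.
have t0 : 0 < gap ud 0 by apply: (gap0_gt0 cosined nontrivd).
have t2 : gap ud 0 * gap ud 2 < 0 by apply: gap_thetad_alt; [lia|exact: lt0r_neq0].
rewrite pmulr_rlt0 // in t2.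
have b2 : 0 < (b 2)%:R :> R by rewrite ltr0n b_num_gt0 //; lia.
have b3 : 0 < (b 3)%:R :> R by rewrite ltr0n b_num_gt0 //; lia.
have := gap2 cosined; rewrite -subr_lt0 -(pmulr_llt0 _ t0) => <-.
by rewrite pmulr_rlt0 // mulr_gt0.
Qed.

(** * The space U of second-neighbour vectors killed by lowering *)

Section UVectors.
Variable x : X.

(** The bottom layer of a T-module of endpoint 2 consists of such vectors:
    supported on the second neighbourhood of x and orthogonal to the
    neighbourhood of each neighbour of x. *)
Definition inU (v : 'cV[C]_#|X|) := E x 2 *m v = v /\ E x 1 *m A *m v = 0.

Local Notation J := (rad (fun _ => 1)).

Lemma dual1_sum : J *m (E x 1 *m A *m E x 2) = (c 2)%:R *: (J *m E x 2).
Proof.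
rewrite adjmxE dual_kmx kmx_dual kmxM kmx_dual kmxZ; apply: eq_kmx => z y.
case: (d x y =P 2) => [xy|_]; last first.
  by rewrite !mulr0 big1 // => w _; rewrite !mulr0.
have -> : \sum_w 1 * ((d x w == 1%N)%:R * (adj w y)%:R * true%:R)
   = \sum_w (adj x w)%:R * (d w y == 1%N)%:R :> C.
  by apply: eq_bigr => w _; rewrite mul1r mulr1 !gdist_eq1.
by rewrite (sum_neighbours (fun i => (i == 1%N)%:R)) xy /= mulr0 addr0 !mulr1.
Qed.

(** Summing the conditions over the neighbours of x counts every vertex at
    distance 2 exactly c_2 times. *)
Lemma U_J v : inU v -> J *m v = 0.
Proof.
case=> e2 e1; have c2 : (c 2)%:R != 0 :> C by rewrite pnatr_eq0 -lt0n c_num_gt0 //; lia.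
apply: (scalerI c2); rewrite scaler0 -{1}e2 mulmxA scalemxAl -dual1_sum.
by rewrite -!mulmxA e2 (mulmxA (E x 1)) e1 mulmx0.
Qed.

Lemma U_rad0 v f : inU v -> E x 0 *m rad f *m v = 0.
Proof.
move=> Uv; have [e2 _] := Uv.
have h : E x 0 *m rad f *m E x 2 = f 2%N *: (E x 0 *m J *m E x 2).
  rewrite /rad !dual_kmx !kmx_dual kmxZ; apply: eq_kmx => z y.
  case: (d x z =P 0%N) => [/eqP|]; last by rewrite !mul0r mulr0.
  rewrite gdist_eq0 => /eqP <-.
  by case: (d x y =P 2) => [->|_]; rewrite ?mulr0 // !mulr1 mul1r.
by rewrite -e2 mulmxA h -scalemxAl -!mulmxA e2 (U_J Uv) mulmx0 scaler0.
Qed.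

Lemma U_rad1 v f : inU v -> E x 1 *m rad f *m v = 0.
Proof.
move=> Uv; have [e2 e1] := Uv.
have h : E x 1 *m rad f *m E x 2 = (f 1%N - f 3) *: (E x 1 *m A *m E x 2)
     + f 3 *: (E x 1 *m J *m E x 2).
  rewrite adjmxE /rad !dual_kmx !kmx_dual !kmxZ kmxD; apply: eq_kmx => z y.
  case: (d x z =P 1%N) => [xz|_]; last by rewrite !mul0r !mulr0 addr0.
  case: (d x y =P 2) => [xy|_]; last by rewrite !mulr0 addr0.
  rewrite !mul1r !mulr1 -gdist_eq1.
  have := gdist_triangle z x y; have := odd_gdistD z x y; rewrite (gdistC z x) xz xy.
  have := gdist_triangle x z y; rewrite xz xy.
  case: (d z y) => [|[|[|[|n]]]] //= _ _ _; first by rewrite mulr1 subrK.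
  by rewrite mulr0 add0r.
rewrite -e2 mulmxA h mulmxDl -!scalemxAl -!mulmxA e2 (U_J Uv) mulmx0 scaler0.
by rewrite mulmxA e1 scaler0 addr0.
Qed.

(** A radial matrix takes three values between the second neighbourhood and
    the sphere of radius j + 2. Since v is orthogonal to the constants, one of
    the three terms is eliminated and only differences of the function remain. *)
Lemma U_rad v f j : inU v ->
  E x j.+2 *m rad f *m v = (f j - f j.+2) *: (E x j.+2 *m Am j *m v)
    - (f j.+2 - f j.+4) *: (E x j.+2 *m Am j.+4 *m v).
Proof.
move=> Uv; have [e2 _] := Uv.
have h g : E x j.+2 *m rad g *m v = g j *: (E x j.+2 *m Am j *m v)
   + g j.+2 *: (E x j.+2 *m Am j.+2 *m v) + g j.+4 *: (E x j.+2 *m Am j.+4 *m v).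
  by rewrite -{1}e2 mulmxA dual_rad_dual2 -mulmxA e2 mulmx_comb3.
have := h (fun _ => 1); rewrite -mulmxA (U_J Uv) mulmx0 h !scale1r => /esym e0.
have -> : E x j.+2 *m Am j.+2 *m v
  = - (E x j.+2 *m Am j *m v + E x j.+2 *m Am j.+4 *m v).
  by apply/eqP; rewrite -subr_eq0 opprK addrCA addrA e0.
move: (E x j.+2 *m Am j *m v) (E x j.+2 *m Am j.+4 *m v) => w w'.
apply/colP => i; rewrite !mxE; ring.
Qed.

Lemma U_raise v j : inU v ->
  E x j.+3 *m A *m (E x j.+2 *m Am j *m v) = (c j.+1)%:R *: (E x j.+3 *m Am j.+1 *m v).
Proof.
by case=> e2 _; have := raise_Am x 2%N j => h; rewrite -e2 !mulmxA h -!scalemxAl.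
Qed.

Lemma U_lower v i : inU v ->
  E x i *m A *m (E x i.+1 *m Am i.+3 *m v) = (b i.+2)%:R *: (E x i *m Am i.+2 *m v).
Proof.
case=> e2 _; have := lower_Am x 2%N i; rewrite !addn2 => h.
by rewrite -e2 !mulmxA h -!scalemxAl.
Qed.

End UVectors.

(** * The projection onto U and its local traces *)

Lemma J_tr : (rad (fun _ => 1))^T = rad (fun _ => 1). Proof. exact: rad_tr. Qed.

Lemma natr_b i : (i <= D)%N -> (b i)%:R = (valency adj)%:R - (c i)%:R :> C.
Proof. by move=> iD; rewrite -(c_addn_b iD) natrD addrAC subrr add0r. Qed.

Lemma adj_sqr : A *m A = ((valency adj)%:R : C)%:M + ((c 2)%:R : C) *: Am 2.
Proof. by rewrite -{2}Am1 adj_Am Am0 scalemx1. Qed.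

Lemma natr_c2_neq0 : (c 2)%:R != 0 :> C.
Proof. by rewrite pnatr_eq0 -lt0n c_num_gt0 //; lia. Qed.
Lemma natr_b2_neq0 : (b 2)%:R != 0 :> C.
Proof. by rewrite pnatr_eq0 -lt0n b_num_gt0 //; lia. Qed.
Lemma natr_k1_neq0 : (valency adj)%:R - 1 != 0 :> C.
Proof.
have -> : (valency adj)%:R - 1 = (valency adj).-1%:R :> C by rewrite -subn1 natrB //; lia.
by rewrite pnatr_eq0; lia.
Qed.

Section Projection.
Variable x : X.

Local Notation J := (rad (fun _ => 1)).
Local Notation c2 := ((c 2)%:R : C).
Local Notation c3 := ((c 3)%:R : C).
Local Notation b2 := ((b 2)%:R : C).
Local Notation kk := ((valency adj)%:R : C).
Local Notation pp := ((inter_num adj 2 2 2)%:R : C).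

(** The adjacency matrix of the local graph: second neighbours of x are joined
    when they are at distance 2. The locks keep conversion from unfolding
    products of matrices. *)
Definition second_dist := locked (E x 2 *m Am 2 *m E x 2).
Lemma second_distE : second_dist = E x 2 *m Am 2 *m E x 2. Proof. by rewrite /second_dist -lock. Qed.

Lemma dual_adj i : E x i.+1 *m A = E x i.+1 *m A *m E x i.+2 + E x i.+1 *m A *m E x i.
Proof.
have := congr1 trmx (adj_dual x i).
by rewrite linearD /= !trmx_mul !dual_tr A_tr !mulmxA.
Qed.

Lemma U_second_dist v : inU x v -> E x 2 *m Am 2 *m v = second_dist *m v.
Proof. by case=> e _; rewrite second_distE -[in RHS]mulmxA e. Qed.

(** U is closed under E_2 K E_2 for K radial, because A K is radial as well. *)
Lemma U_stable v f : inU x v -> inU x (E x 2 *m rad f *m v).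
Proof.
move=> Uv; split; first by rewrite !mulmxA dual_idem2.
have h := U_rad1 (fun i => (c i)%:R * f i.-1 + (b i)%:R * f i.+1) Uv.
rewrite -adj_rad mulmxA dual_adj !mulmxDl -!mulmxA (mulmxA (E x 0)) in h.
by rewrite (U_rad0 f Uv) !mulmx0 addr0 in h; rewrite -!mulmxA.
Qed.

Lemma U_stable_second_dist v : inU x v -> inU x (second_dist *m v).
Proof. by move=> Uv; rewrite -U_second_dist //; apply: U_stable. Qed.

Lemma U_far v : inU x v -> E x 2 *m Am 4 *m v = - (v + second_dist *m v).
Proof.
move=> Uv; have := U_rad (fun i => (i == 2)%:R) 0 Uv.
rewrite -[rad _]/(Am 2) U_second_dist // /= sub0r subr0 scaleN1r scale1r Am0 mulmx1.
by case: Uv => -> _ ->; rewrite addrA addrN sub0r opprK.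
Qed.

Lemma U_cosmx v u : inU x v ->
  E x 2 *m cosmx u *m v = (gap u 0)%:C *: v + (gap u 2)%:C *: (v + second_dist *m v).
Proof.
move=> Uv; rewrite /cosmx (U_rad (toC u) 0 Uv) U_far // scalerN opprK Am0 mulmx1.
by case: Uv => -> _; rewrite /toC -!rmorphB.
Qed.

Definition second_gram := locked (E x 2 *m A *m E x 1 *m A *m E x 2).
Lemma second_gramE : second_gram = E x 2 *m A *m E x 1 *m A *m E x 2. Proof. by rewrite /second_gram -lock. Qed.
Definition second_ones := locked (E x 2 *m J *m E x 2).
Lemma second_onesE : second_ones = E x 2 *m J *m E x 2. Proof. by rewrite /second_ones -lock. Qed.
Definition ones_coef : C := c2 * (c2 - 1) / ((kk - 1) * b2).
(** The orthogonal projection onto U, as a combination of E_2, of the Gram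
    matrix of the neighbourhoods of the neighbours of x, and of the all-ones
    matrix on the second neighbourhood. *)
Definition proj_U := locked (E x 2 - b2^-1 *: second_gram + ones_coef *: second_ones).
Lemma proj_UE : proj_U = E x 2 - b2^-1 *: second_gram + ones_coef *: second_ones. Proof. by rewrite /proj_U -lock. Qed.

Lemma proj_U_tr : proj_U^T = proj_U.
Proof.
have hT : second_gram^T = second_gram by rewrite second_gramE !trmx_mul !dual_tr A_tr !mulmxA.
have jT : second_ones^T = second_ones by rewrite second_onesE !trmx_mul !dual_tr J_tr !mulmxA.
by rewrite proj_UE trmx_lin3 dual_tr hT jT.
Qed.

Lemma dual2_proj_U : E x 2 *m proj_U = proj_U.
Proof.
have hE : E x 2 *m second_gram = second_gram by rewrite second_gramE !mulmxA dual_idem2.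
have jE : E x 2 *m second_ones = second_ones by rewrite second_onesE !mulmxA dual_idem2.
by rewrite proj_UE mulmx_lin3 dual_idem2 hE jE.
Qed.

Lemma proj_U_dual2 : proj_U *m E x 2 = proj_U.
Proof. by rewrite -[LHS]trmxK trmx_mul proj_U_tr dual_tr dual2_proj_U proj_U_tr. Qed.

Lemma dual0_adj : E x 1 *m A *m E x 0 = E x 1 *m J *m E x 0.
Proof.
rewrite adjmxE !dual_kmx !kmx_dual; apply: eq_kmx => z y.
case: (d x y =P 0%N) => [/eqP|]; rewrite ?mulr0 // gdist_eq0 => /eqP <-.
by rewrite !mulr1 -gdist_eq1 (gdistC z x); case: (d x z == 1%N); rewrite ?mul0r ?mul1r.
Qed.

Lemma J_dual0_J : J *m E x 0 *m J = J.
Proof.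
rewrite kmx_dual kmxM; apply: eq_kmx => z y.
rewrite (bigD1 x) //= gdistxx big1 => [|w]; first by rewrite !mulr1 addr0.
by rewrite eq_sym -gdist_eq0 => /negbTE->; rewrite mulr0 mul0r.
Qed.

Lemma dual01 : E x 1 *m A *m E x 0 *m A *m E x 1 = E x 1 *m J *m E x 1.
Proof.
have e : E x 0 *m A *m E x 1 = E x 0 *m J *m E x 1.
  by have := congr1 trmx dual0_adj; rewrite !trmx_mul !dual_tr A_tr J_tr !mulmxA.
transitivity ((E x 1 *m A *m E x 0) *m (E x 0 *m A *m E x 1)).
  by rewrite !mulmxA -[_ *m E x 0 *m E x 0]mulmxA dual_idem2.
rewrite dual0_adj e !mulmxA -[_ *m E x 0 *m E x 0]mulmxA dual_idem2.
by congr (_ *m _); rewrite -!mulmxA (mulmxA J) J_dual0_J.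
Qed.

Lemma dual1_Am2 : E x 1 *m Am 2 *m E x 1 = E x 1 *m J *m E x 1 - E x 1.
Proof.
rewrite AmE [in X in _ - X]dual_idemE -scaleN1r !dual_kmx !kmx_dual kmxZ kmxD; apply: eq_kmx => z y.
case: (d x z =P 1%N) => [xz|_]; last by rewrite !mul0r !mulr0 addr0.
case: (d x y =P 1%N) => [xy|n]; last first.
  by rewrite !mulr0 add0r; case: eqP => [e|]; rewrite ?mul0r ?mulr0 //; move: xz; rewrite e.
rewrite !mul1r !mulr1 -gdist_eq0.
have := gdist_triangle z x y; have := odd_gdistD z x y; rewrite (gdistC z x) xz xy.
by case: (d z y) => [|[|[|n]]] //= _ _; rewrite ?mulr1 ?mulr0 ?subrr ?addr0 ?mulN1r ?subrr.
Qed.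

(** Two distinct neighbours of x have c_2 - 1 common neighbours at distance 2
    from x. *)
Lemma gram : E x 1 *m A *m E x 2 *m A *m E x 1 = b2 *: E x 1 + (c2 - 1) *: (E x 1 *m J *m E x 1).
Proof.
have : E x 1 *m (A *m A) *m E x 1 = kk *: E x 1 + c2 *: (E x 1 *m J *m E x 1 - E x 1).
  by rewrite adj_sqr mulmxDr mulmxDl mul_mx_scalar -scalemxAr -!scalemxAl dual_idem2 dual1_Am2.
move=> h; rewrite mulmxA dual_adj !mulmxDl dual01 in h.
have b2E : (b 2)%:R = kk - c2 by rewrite (@natr_b 2) //; lia.
rewrite (sub_of_add h) b2E.
move: (E x 1 *m J *m E x 1) (E x 1) => M1 M2.
by apply/matrixP => i j; rewrite !mxE; ring.
Qed.

Lemma J_dual1_J : E x 1 *m A *m E x 2 *m J = (kk - 1) *: (E x 1 *m J).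
Proof.
have AJ : A *m J = kk *: J.
  rewrite adj_rad -[RHS]addr0 -(scale0r J) rad_comb; apply: eq_rad => i iD.
  by rewrite mul0r addr0 !mulr1 -natrD c_addn_b.
have : E x 1 *m A *m J = kk *: (E x 1 *m J) by rewrite -mulmxA AJ scalemxAr.
move=> h; rewrite dual_adj mulmxDl dual0_adj -[E x 1 *m J *m _ *m _]mulmxA in h.
rewrite -[E x 1 *m J *m _]mulmxA (mulmxA J) J_dual0_J in h.
by rewrite (sub_of_add h) scalerBl scale1r.
Qed.

(** The coefficients of proj_U solve the normal equations, whose matrix is
    computed in gram. *)
Lemma adj_proj_U : E x 1 *m A *m proj_U = 0.
Proof.
have h1 : E x 1 *m A *m second_gram = b2 *: (E x 1 *m A *m E x 2)
    + ((c2 - 1) * c2) *: (E x 1 *m J *m E x 2).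
  rewrite second_gramE !mulmxA gram !mulmx_lin2l; congr (_ + _).
  have e : E x 1 *m J *m E x 1 *m A *m E x 2 = c2 *: (E x 1 *m J *m E x 2).
    transitivity (E x 1 *m (J *m (E x 1 *m A *m E x 2))); first by rewrite !mulmxA.
    by rewrite dual1_sum -scalemxAr !mulmxA.
  by rewrite e scalerA.
have h2 : E x 1 *m A *m second_ones = (kk - 1) *: (E x 1 *m J *m E x 2).
  by rewrite second_onesE !mulmxA J_dual1_J -scalemxAl.
rewrite proj_UE mulmx_lin3 h1 h2.
move: (E x 1 *m J *m E x 2) (E x 1 *m A *m E x 2) => M1 M2.
apply/matrixP => i j; rewrite !mxE /ones_coef; field.
by rewrite natr_b2_neq0 natr_k1_neq0.
Qed.

Lemma inU_proj_U w : inU x (proj_U *m w).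
Proof. by split; rewrite mulmxA ?dual2_proj_U ?adj_proj_U ?mul0mx. Qed.

Lemma proj_U_id v : inU x v -> proj_U *m v = v.
Proof.
move=> Uv; have UJ := U_J Uv; case: Uv => e2 e1.
have hv : second_gram *m v = 0 by rewrite second_gramE -!mulmxA e2 (mulmxA (E x 1)) e1 !mulmx0.
have jv : second_ones *m v = 0 by rewrite second_onesE -!mulmxA e2 UJ mulmx0.
by rewrite proj_UE mulmx_lin3l e2 hv jv !scaler0 subr0 addr0.
Qed.

End Projection.

Lemma sum_indicator (Q : pred X) : \sum_z (Q z)%:R = #|[set z | Q z]|%:R :> C.
Proof. by rewrite -natr_sum -sum1dep_card [in RHS]big_mkcond. Qed.

Section PP.
Local Notation c2 := ((c 2)%:R : C).
Local Notation c3 := ((c 3)%:R : C).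
Local Notation b2 := ((b 2)%:R : C).
Local Notation b3 := ((b 3)%:R : C).
Local Notation kk := ((valency adj)%:R : C).
Local Notation pp := ((inter_num adj 2 2 2)%:R : C).

(** Compare the entries at distance 2 on both sides of A^2 A_2, computed with
    the recurrence. *)
Lemma p222_eq : c2 * pp = (kk - 1) * c2 + c3 * b2 - kk.
Proof.
have [x0 [x1 xx]] := exists_diameter.
have [|y xy _] := @gdist_prefix 2 x0 x1; first by rewrite xx; lia.
have h : (kk%:M + c2 *: Am 2) *m Am 2
   = (b 1)%:R *: (kk%:M + c2 *: Am 2) + c3 *: (b2 *: Am 2 + (c 4)%:R *: Am 4).
  by rewrite -adj_sqr -mulmxA (adj_Am 1) mulmxDr -!scalemxAr (adj_Am 2) Am1.
have := congr1 (fun M : 'M[C]_#|X| => M (enum_rank x0) (enum_rank y)) h.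
rewrite mulmxDl mul_scalar_mx -scalemxAl kmxM !mxE !enum_rankK xy /=.
have -> : (enum_rank x0 == enum_rank y) = false.
  by rewrite (inj_eq enum_rank_inj) -gdist_eq0 xy.
have -> : \sum_z (d x0 z == 2)%:R * (d z y == 2)%:R = pp.
  rewrite -(@triple_countE 2 2 2 x0 y) //; try lia.
  by under eq_bigr => w _ do rewrite -natrM mulnb; rewrite sum_indicator.
rewrite !mulr1 !mulr0n !mulr0 addr0 add0r natr_b ?c_num1; last by lia.
by move=> <-; rewrite addrAC subrr add0r.
Qed.

End PP.

Section Trace.
Variable x : X.

Local Notation J := (rad (fun _ => 1)).
Local Notation c2 := ((c 2)%:R : C).
Local Notation c3 := ((c 3)%:R : C).
Local Notation b2 := ((b 2)%:R : C).
Local Notation b3 := ((b 3)%:R : C).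
Local Notation kk := ((valency adj)%:R : C).
Local Notation pp := ((inter_num adj 2 2 2)%:R : C).
Local Notation k2 := ((#|[set z | d x z == 2]|)%:R : C).
Local Notation N := (second_dist x).
Local Notation H := (second_gram x).
Local Notation second_ones := (second_ones x).
Local Notation P := (proj_U x).

Lemma dual2_adj_J : E x 2 *m A *m E x 1 *m J = c2 *: (E x 2 *m J).
Proof.
have h := congr1 trmx (dual1_sum x).
by rewrite linearZ /= !trmx_mul !dual_tr A_tr J_tr !mulmxA in h.
Qed.

Lemma adj_second_dist : E x 1 *m A *m N = (b3 - 1) *: (E x 1 *m A *m E x 2) + (c3 - 1) *: (E x 1 *m J *m E x 2).
Proof.
have e3 : E x 1 *m Am 3 *m E x 2 = E x 1 *m J *m E x 2 - E x 1 *m A *m E x 2.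
  rewrite AmE adjmxE -scaleN1r !dual_kmx !kmx_dual kmxZ kmxD; apply: eq_kmx => z y.
  case: (d x z =P 1%N) => [xz|_]; last by rewrite !mul0r !mulr0 addr0.
  case: (d x y =P 2) => [xy|_]; last by rewrite !mulr0 addr0.
  rewrite !mul1r !mulr1 -gdist_eq1.
  have h1 := gdist_triangle z x y; have h2 := odd_gdistD z x y.
  have h3 := gdist_triangle x z y; rewrite (gdistC z x) xz xy in h1 h2 h3.
  by case: (d z y) h1 h2 h3 => [|[|[|[|n]]]] //= _ _ _; rewrite ?mulr0 ?mulr1 ?subrr ?addr0.
have e0 : E x 0 *m Am 2 *m E x 2 = E x 0 *m J *m E x 2.
  rewrite AmE !dual_kmx !kmx_dual; apply: eq_kmx => z y.
  case: (d x z =P 0%N) => [/eqP|_]; last by rewrite !mul0r.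
  by rewrite gdist_eq0 => /eqP<-; case: (d x y =P 2) => _; rewrite ?mulr0 // !mulr1.
have h : E x 1 *m A *m Am 2 *m E x 2
   = (b 1)%:R *: (E x 1 *m A *m E x 2) + c3 *: (E x 1 *m Am 3 *m E x 2).
  rewrite -(mulmxA (E x 1) A) adj_Am Am1 mulmxDr mulmxDl.
  by rewrite -!scalemxAr -!scalemxAl.
have h0 : E x 1 *m A *m E x 0 *m Am 2 *m E x 2 = E x 1 *m J *m E x 2.
  rewrite dual0_adj -!mulmxA (mulmxA (E x 0)) e0 !mulmxA.
  by rewrite -(mulmxA _ J (E x 0)) -(mulmxA _ _ J) J_dual0_J.
have hN : E x 1 *m A *m N = E x 1 *m A *m E x 2 *m Am 2 *m E x 2 by rewrite second_distE !mulmxA.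
have := congr1 (fun M => M *m Am 2 *m E x 2) (dual_adj x 0); rewrite /= !mulmxDl h0.
rewrite h e3 => /esym hd; rewrite hN (sub_of_add hd).
have e1 : (b 1)%:R = kk - 1 by rewrite natr_b ?c_num1 //; lia.
have e2 : b3 = kk - c3 by rewrite natr_b //; lia.
rewrite e1 e2.
move: (E x 1 *m J *m E x 2) (E x 1 *m A *m E x 2) => M1 M2.
by apply/matrixP => i j; rewrite !mxE; ring.
Qed.

Lemma gram_dist : H *m N = (b3 - 1) *: H + ((c3 - 1) * c2) *: second_ones.
Proof.
transitivity (E x 2 *m A *m E x 1 *m (E x 1 *m A *m N)).
  rewrite !mulmxA -[_ *m E x 1 *m E x 1]mulmxA dual_idem2.
  by rewrite second_gramE second_distE ?mulmxA -[_ *m E x 2 *m E x 2]mulmxA dual_idem2.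
rewrite adj_second_dist mulmx_lin2 !mulmxA.
rewrite -[_ *m E x 1 *m E x 1]mulmxA dual_idem2 dual2_adj_J.
by rewrite -scalemxAl scalerA second_gramE second_onesE.
Qed.

Lemma ones_dist : second_ones *m N = pp *: second_ones.
Proof.
have h : J *m E x 2 *m Am 2 *m E x 2 = pp *: (J *m E x 2).
  rewrite AmE !kmx_dual kmxM kmx_dual kmxZ; apply: eq_kmx => z y.
  case: (d x y =P 2) => [xy|_]; last by rewrite !mulr0.
  rewrite !mulr1 -(@triple_countE 2 2 2 x y) //; try lia.
  under eq_bigr => w _ do rewrite mul1r -natrM mulnb.
  by rewrite sum_indicator.
by rewrite second_onesE second_distE !mulmxA -[_ *m E x 2 *m E x 2]mulmxA dual_idem2
  -!(mulmxA (E x 2)) h -scalemxAr.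
Qed.

Lemma tr_dual2 : \tr (E x 2) = k2.
Proof.
rewrite dual_idemE mxtrace_kmx; under eq_bigr => y _ do rewrite eqxx mul1r.
by rewrite sum_indicator.
Qed.

Lemma tr_ones : \tr second_ones = k2.
Proof.
rewrite second_onesE dual_kmx kmx_dual mxtrace_kmx.
under eq_bigr => y _ do rewrite mulr1 -natrM mulnb andbb.
by rewrite sum_indicator.
Qed.

Lemma tr_dist : \tr N = 0.
Proof.
rewrite second_distE AmE dual_kmx kmx_dual mxtrace_kmx big1 // => y _.
by rewrite gdistxx mulr0 mul0r.
Qed.

Lemma tr_dist_dist : \tr (N *m N) = k2 * pp.
Proof.
have -> : N *m N = E x 2 *m Am 2 *m (E x 2 *m Am 2 *m E x 2).
  by rewrite second_distE !mulmxA -[_ *m E x 2 *m E x 2]mulmxA dual_idem2.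
rewrite AmE dual_kmx kmx_dual kmxM mxtrace_kmx.
rewrite -sum1dep_card natr_sum mulr_suml [RHS]big_mkcond /=; apply: eq_bigr => y _.
case: (d x y =P 2) => [xy|_]; last by rewrite big1 // => z _; rewrite !mul0r.
rewrite mul1r -(@triple_countE 2 2 2 x y) //; try lia.
rewrite /triple_count -sum1dep_card natr_sum [RHS]big_mkcond /=; apply: eq_bigr => z _.
by rewrite (gdistC y z); case: (d x z == 2); case: (d z y == 2); rewrite ?(mul0r, mulr0, mul1r).
Qed.

Lemma tr_gram : \tr H = c2 * k2.
Proof.
have -> : H = E x 2 *m A *m (E x 1 *m A *m E x 2) by rewrite second_gramE !mulmxA.
rewrite adjmxE !dual_kmx kmx_dual kmxM mxtrace_kmx.
rewrite -sum1dep_card natr_sum mulr_sumr [RHS]big_mkcond /=; apply: eq_bigr => y _.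
case: (d x y =P 2) => [xy|_]; last by rewrite big1 // => z _; rewrite !mul0r.
rewrite mulr1; have := sum_neighbours (fun i => (i == 1%N)%:R) x y.
rewrite xy /= mulr1 mulr0 addr0 => <-; apply: eq_bigr => z _.
rewrite !mulr1 mul1r -!gdist_eq1 (gdistC y z).
by case: (d x z == 1%N); case: (d z y == 1%N); rewrite ?(mul0r, mulr0, mul1r).
Qed.

End Trace.

(** * The tautness equation as a vanishing trace *)

(** The difference of the two sides of the tautness equation, with the extreme
    eigenvalues replaced by variables; the case in which both are theta_1 is
    needed too. *)
Definition defect (th th' : R) : R :=
  (b 3)%:R * ((b 2)%:R * ((valency adj)%:R - 2) - ((c 2)%:R - 1) * th ^+ 2)
    * ((b 2)%:R * ((valency adj)%:R - 2) - ((c 2)%:R - 1) * th' ^+ 2)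
  - (b 1)%:R * Delta R adj * (th ^+ 2 - (b 2)%:R) * ((b 2)%:R - th' ^+ 2).

Section TraceForm.
Variable x : X.

Local Notation J := (rad (fun _ => 1)).
Local Notation c2 := ((c 2)%:R : C).
Local Notation c3 := ((c 3)%:R : C).
Local Notation b2 := ((b 2)%:R : C).
Local Notation b3 := ((b 3)%:R : C).
Local Notation kk := ((valency adj)%:R : C).
Local Notation pp := ((inter_num adj 2 2 2)%:R : C).
Local Notation k2 := ((#|[set z | d x z == 2]|)%:R : C).
Local Notation N := (second_dist x).
Local Notation H := (second_gram x).
Local Notation second_ones := (second_ones x).
Local Notation P := (proj_U x).

Lemma dual2_second_dist : E x 2 *m N = N.
Proof. by rewrite second_distE !mulmxA dual_idem2. Qed.

Lemma proj_second_dist : P *m N = N - b2^-1 *: ((b3 - 1) *: H + ((c3 - 1) * c2) *: second_ones) + ones_coef *: (pp *: second_ones).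
Proof. by rewrite proj_UE mulmx_lin3l dual2_second_dist gram_dist ones_dist. Qed.

Lemma tr_proj : \tr P = k2 - b2^-1 * (c2 * k2) + ones_coef * k2.
Proof. by rewrite proj_UE mxtrace_lin3 tr_dual2 tr_gram tr_ones. Qed.

Lemma tr_proj_dist : \tr (P *m N)
  = - b2^-1 * ((b3 - 1) * (c2 * k2) + (c3 - 1) * c2 * k2) + ones_coef * (pp * k2).
Proof.
by rewrite proj_second_dist mxtrace_lin3 tr_dist mxtrace_lin2 tr_gram mxtraceZ tr_ones sub0r mulNr.
Qed.

Lemma tr_proj_dist_dist : \tr (P *m N *m N)
  = k2 * pp - b2^-1 * ((b3 - 1) * ((b3 - 1) * (c2 * k2) + (c3 - 1) * c2 * k2)
                       + (c3 - 1) * c2 * (pp * k2)) + ones_coef * (pp * (pp * k2)).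
Proof.
rewrite proj_second_dist mulmx_lin3l mxtrace_lin3 tr_dist_dist mulmx_lin2l mxtrace_lin2 gram_dist ones_dist.
by rewrite mxtrace_lin2 tr_gram !mxtraceZ tr_ones -scalemxAl ones_dist !mxtraceZ tr_ones.
Qed.

Opaque second_dist second_gram proj_U cosmx.

Lemma proj_idem : P *m P = P.
Proof. by apply: mx_ext => w; rewrite -mulmxA proj_U_id //; apply: inU_proj_U. Qed.

Lemma proj_dist_proj : P *m (N *m P) = N *m P.
Proof.
apply: mx_ext => w; rewrite -(mulmxA P (N *m P)) -(mulmxA N P).
by apply: proj_U_id; apply: U_stable_second_dist; apply: inU_proj_U.
Qed.

Lemma dual_cosmx_proj u : E x 2 *m cosmx u *m P = (gap u 0)%:C *: P + (gap u 2)%:C *: (P + N *m P).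
Proof.
apply: mx_ext => w; rewrite -(mulmxA (E x 2 *m cosmx u) P w) U_cosmx; last exact: inU_proj_U.
by rewrite mulmx_lin2l mulmxDl -!mulmxA.
Qed.

Lemma proj_cosmx_proj u : P *m cosmx u *m P = (gap u 0)%:C *: P + (gap u 2)%:C *: (P + N *m P).
Proof.
rewrite -{1}(proj_U_dual2 x) -!mulmxA (mulmxA (E x 2)) dual_cosmx_proj mulmx_lin2.
by rewrite mulmxDr proj_idem proj_dist_proj.
Qed.

Lemma tr_cosmx_pair u u' : \tr (P *m cosmx u *m P *m cosmx u' *m P)
  = (gap u 0)%:C * (gap u' 0)%:C * \tr P
  + ((gap u 0)%:C * (gap u' 2)%:C + (gap u 2)%:C * (gap u' 0)%:C) * (\tr P + \tr (P *m N))
  + (gap u 2)%:C * (gap u' 2)%:C * (\tr P + 2 * \tr (P *m N) + \tr (P *m N *m N)).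
Proof.
have NP : P *m N *m P = N *m P by rewrite -mulmxA proj_dist_proj.
have e1 : \tr (N *m P) = \tr (P *m N) by rewrite mxtrace_mulC.
have e2 : \tr (N *m (N *m P)) = \tr (P *m N *m N).
  by rewrite mulmxA mxtrace_mulC mulmxA.
have -> : P *m cosmx u *m P *m cosmx u' *m P
  = (P *m cosmx u *m P) *m (P *m cosmx u' *m P).
  by rewrite !mulmxA -(mulmxA _ P P) proj_idem.
rewrite !proj_cosmx_proj mulmx_lin2l !mulmx_lin2.
rewrite [(P + N *m P) *m (P + _)]mulmxDl [(P + N *m P) *m P]mulmxDl !mulmxDr !mulmxA NP proj_idem.
rewrite -!(mulmxA N) ?(mulmxA P N P) ?NP ?proj_idem.
rewrite !(mxtrace_lin2, mxtraceD, mxtraceZ) ?e1 ?e2; ring.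
Qed.

End TraceForm.

Section TraceDefect.
Variable x : X.

Local Notation c2 := ((c 2)%:R : C).
Local Notation c3 := ((c 3)%:R : C).
Local Notation b2 := ((b 2)%:R : C).
Local Notation b3 := ((b 3)%:R : C).
Local Notation kk := ((valency adj)%:R : C).
Local Notation pp := ((inter_num adj 2 2 2)%:R : C).
Local Notation k2 := ((#|[set z | d x z == 2]|)%:R : C).
Local Notation P := (proj_U x).

Lemma defect_complex th th' : (defect th th')%:C =
  b3 * (b2 * (kk - 2) - (c2 - 1) * th%:C ^+ 2) * (b2 * (kk - 2) - (c2 - 1) * th'%:C ^+ 2)
  - (b 1)%:R * ((kk - 2) * (c3 - 1) - (c2 - 1) * pp) * (th%:C ^+ 2 - b2) * (b2 - th'%:C ^+ 2).
Proof.
by rewrite /defect /Delta !(rmorphB, rmorphM, rmorphXn, rmorph1, rmorph_nat).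
Qed.

Lemma gap2C th u : cosine_seq th u ->
  b2 * b3 * (gap u 2)%:C = (th%:C ^+ 2 - b2) * (gap u 0)%:C.
Proof.
move=> cu; have := congr1 (real_complex R) (gap2 cu).
by rewrite !(rmorphB, rmorphM, rmorphXn, rmorph_nat).
Qed.

Lemma natr_b3_neq0 : b3 != 0.
Proof. by rewrite pnatr_eq0 -lt0n b_num_gt0 //; lia. Qed.

(** The traces count vertices, so that both sides are explicit rational
    functions of the intersection numbers. As the trace is a squared norm up
    to a positive factor, this is also the reason for the inequality in the
    definition of tautness. *)
Lemma trace_defect th u th' u' : cosine_seq th u -> cosine_seq th' u' ->
  (kk - 1 - c2) * (kk - 1) * (b2 * b3) ^+ 2 * \tr (P *m cosmx u *m P *m cosmx u' *m P)
  = (gap u 0)%:C * (gap u' 0)%:C * k2 * b3 * (defect th th')%:C.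
Proof.
move=> cu cu'; rewrite tr_cosmx_pair tr_proj tr_proj_dist tr_proj_dist_dist defect_complex /ones_coef.
have n2 := natr_b2_neq0; have n3 := natr_b3_neq0.
have nc := natr_c2_neq0; have nk := natr_k1_neq0.
have pe : pp = ((kk - 1) * c2 + c3 * b2 - kk) / c2 by rewrite -p222_eq mulrC mulKf.
have t2 : (gap u 2)%:C = (th%:C ^+ 2 - b2) * (gap u 0)%:C / (b2 * b3).
  by rewrite -(gap2C cu) mulrC mulKf // mulf_neq0.
have t2' : (gap u' 2)%:C = (th'%:C ^+ 2 - b2) * (gap u' 0)%:C / (b2 * b3).
  by rewrite -(gap2C cu') mulrC mulKf // mulf_neq0.
rewrite t2 t2' pe {t2 t2' pe}.
have e1 : (b 1)%:R = kk - 1 :> C by rewrite (@natr_b 1) ?c_num1 //; lia.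
have e2 : b2 = kk - c2 by rewrite (@natr_b 2) //; lia.
have e3 : b3 = kk - c3 by rewrite (@natr_b 3) //; lia.
move: n2 n3; rewrite e1 e2 e3.
move: (gap u 0)%:C (gap u' 0)%:C k2 th%:C th'%:C => y1 y2 y3 y4 y5 n2 n3.
move: c2 c3 kk n2 n3 nc nk => z1 z2 z3 n2 n3 nc nk.
by field; rewrite nc nk n2 n3.
Qed.

Lemma conj_cosmx u : map_mx Num.conj (cosmx u) = cosmx u.
Proof. by apply/matrixP => i j; rewrite !mxE; exact: conj_realC. Qed.

Lemma conj_kmx_nat (f : X -> X -> nat) :
  map_mx Num.conj (kmx (fun y z => (f y z)%:R : C)) = kmx (fun y z => (f y z)%:R).
Proof. by apply/matrixP => i j; rewrite !mxE rmorph_nat. Qed.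

Lemma conj_dual i : map_mx Num.conj (E x i) = E x i.
Proof.
rewrite dual_idemE; apply/matrixP => p q; rewrite !mxE.
by rewrite rmorphM !rmorph_nat.
Qed.

Lemma conj_A : map_mx Num.conj A = A.
Proof. by apply/matrixP => i j; rewrite !mxE rmorph_nat. Qed.

Lemma conj_proj_U : map_mx Num.conj P = P.
Proof.
have eH : map_mx Num.conj (second_gram x) = second_gram x by rewrite second_gramE !map_mxM /= conj_A !conj_dual.
have eJ : map_mx Num.conj (second_ones x) = second_ones x.
  rewrite second_onesE !map_mxM /= !conj_dual; congr (_ *m _ *m _).
  exact: (conj_kmx_nat (fun _ _ => 1%N)).
have e1 : Num.conj b2^-1 = b2^-1 by rewrite fmorphV rmorph_nat.
have e2 : Num.conj ones_coef = ones_coef.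
  by rewrite /ones_coef !(rmorphB, rmorphM, fmorphV, rmorph1, rmorph_nat).
rewrite proj_UE; have h := @map_mx_fixed3 _ Num.conj _ _ _ _ _ _ _ (conj_dual 2) eH eJ e1 e2.
exact: h.
Qed.

Lemma trace_gram_eq0 (Z : 'M[C]_#|X|) :
  map_mx Num.conj Z = Z -> \tr (Z *m Z^T) = 0 -> Z = 0.
Proof.
move=> cZ; have e i : (Z *m Z^T) i i = \sum_j Z i j * (Z i j)^*%R.
  rewrite mxE; apply: eq_bigr => j _; rewrite mxE; congr (_ * _).
  by have /matrixP/(_ i j) := cZ; rewrite mxE => ->.
have p i j : 0 <= Z i j * (Z i j)^*%R by apply: mul_conjC_ge0.
rewrite /mxtrace; under eq_bigr => i _ do rewrite e.
move=> /psumr_eq0P h; apply/matrixP => i j; rewrite mxE.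
have /psumr_eq0P h' := h (fun i _ => sumr_ge0 _ (fun j _ => p i j)) i isT.
by have /eqP := h' (fun j _ => p i j) j isT; rewrite mul_conjC_eq0 => /eqP.
Qed.

(** The c_2 neighbours of the midpoint of a geodesic of length 4 that are
    nearer to one end are among its b_2 neighbours farther from the other end,
    so that c_2 <= b_2 = k - c_2. *)
Lemma c2_lt_k : ((c 2).+1 < valency adj)%N.
Proof.
have cb2 : (c 2 <= b 2)%N.
  have [x0 [x1 xx]] := exists_diameter.
  have [|z xz _] := @gdist_prefix 4 x0 x1; first by rewrite xx.
  have [|y xy yz] := @gdist_prefix 2 x0 z; first by rewrite xz.
  rewrite xz /= in yz; rewrite gdistC in xy.
  have := card_closer y x0; have := card_farther y z; rewrite xy yz => <- <-.
  apply/subset_leq_card/subsetP => w; rewrite !inE => /andP[yw /eqP wx].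
  rewrite yw; have t1 := gdist_triangle x0 w z; rewrite xz (gdistC x0) wx in t1.
  by have := gdist_adj_cases z yw; rewrite !(gdistC z) yz; lia.
have := @c_addn_b 2; lia.
Qed.

Lemma natr_kc_neq0 : kk - 1 - c2 != 0.
Proof.
have lt := c2_lt_k.
have -> : kk - 1 - c2 = (valency adj - (c 2).+1)%N%:R.
  by rewrite natrB ?(ltnW lt) // -natr1 opprD [RHS]addrA addrAC.
by rewrite pnatr_eq0 subn_eq0 -ltnNge.
Qed.

(** The trace in trace_defect is a multiple of the squared norm of this
    product. *)
Lemma defect_cosmx_proj_cosmx th u th' u' : cosine_seq th u -> cosine_seq th' u' ->
  defect th th' = 0 -> cosmx u *m P *m cosmx u' = 0.
Proof.
move=> cu cu' d0.
have tr0 : \tr (P *m cosmx u *m P *m cosmx u' *m P) = 0.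
  have := trace_defect cu cu'; rewrite d0 rmorph0 mulr0 => /eqP.
  rewrite mulf_eq0 => /orP[|/eqP//].
  rewrite !mulf_eq0 (negbTE natr_k1_neq0) (negbTE natr_b2_neq0).
  by rewrite (negbTE natr_b3_neq0) (negbTE natr_kc_neq0).
have [a a0 Fa] := cosmx_sqr cu; have [a' a0' Fa'] := cosmx_sqr cu'.
have cZ : map_mx Num.conj (cosmx u *m P *m cosmx u') = cosmx u *m P *m cosmx u'.
  by rewrite !map_mxM /= conj_proj_U !conj_cosmx.
apply: (trace_gram_eq0 cZ).
rewrite !trmx_mul !cosmx_tr proj_U_tr.
have -> : cosmx u *m P *m cosmx u' *m (cosmx u' *m (P *m cosmx u))
  = a'%:C *: (cosmx u *m (P *m cosmx u' *m P *m cosmx u)).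
  rewrite -!mulmxA (mulmxA (cosmx u') (cosmx u')) Fa'.
  by rewrite -scalemxAl -!scalemxAr !mulmxA.
rewrite mxtraceZ [X in _ * X]mxtrace_mulC -[_ *m cosmx u *m cosmx u]mulmxA Fa -scalemxAr mxtraceZ.
suff -> : \tr (P *m cosmx u' *m P *m cosmx u) = 0 by rewrite !mulr0.
have e1 := mxtrace_mulC (P *m cosmx u') (P *m cosmx u).
have e2 := mxtrace_mulC (P *m cosmx u *m P *m cosmx u') P.
by rewrite !mulmxA ?proj_idem in e1 e2; rewrite e1 -e2.
Qed.

Lemma defect_of_U th u th' u' : cosine_seq th u -> cosine_seq th' u' ->
  nontriv th -> nontriv th' ->
  (forall v, inU x v -> E x 2 *m cosmx u *m (E x 2 *m cosmx u' *m v) = 0) ->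
  defect th th' = 0.
Proof.
move=> cu cu' nt nt' h.
have z : E x 2 *m cosmx u *m (E x 2 *m cosmx u' *m P) = 0.
  by apply: mx_ext => w; rewrite mul0mx -!mulmxA (mulmxA (E x 2) (cosmx u')) (mulmxA (E x 2) (cosmx u)) h //; apply: inU_proj_U.
have tr0 : \tr (P *m cosmx u *m P *m cosmx u' *m P) = 0.
  have q : E x 2 *m cosmx u' *m P = P *m cosmx u' *m P by rewrite proj_cosmx_proj dual_cosmx_proj.
  have -> : P *m cosmx u *m P *m cosmx u' *m P = P *m (E x 2 *m cosmx u *m (E x 2 *m cosmx u' *m P)).
    by rewrite q !mulmxA proj_U_dual2.
  by rewrite z mulmx0 linear0.
have := trace_defect cu cu'; rewrite tr0 mulr0 => /esym/eqP.
have t0 : (gap u 0)%:C != 0 by rewrite fmorph_eq0 lt0r_neq0 // (gap0_gt0 cu).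
have t0' : (gap u' 0)%:C != 0 by rewrite fmorph_eq0 lt0r_neq0 // (gap0_gt0 cu').
have k2n : k2 != 0.
  have [|y _ xy] := @exists_gdist_from x x 2; first by rewrite gdistxx; lia.
  rewrite pnatr_eq0 -lt0n; apply/card_gt0P; exists y.
  by rewrite inE xy gdistxx.
rewrite !mulf_eq0 (negbTE t0) (negbTE t0') (negbTE k2n) (negbTE natr_b3_neq0) /=.
by rewrite fmorph_eq0 => /eqP.
Qed.

End TraceDefect.

(** * Vectors of U killed by one cosine matrix *)

Lemma dot_ge0 (w : 'cV[C]_#|X|) : 0 <= (map_mx Num.conj w^T *m w) 0 0.
Proof.
rewrite mxE; apply: sumr_ge0 => i _; rewrite !mxE mulrC; exact: mul_conjC_ge0.
Qed.

Lemma dot_eq0 (w : 'cV[C]_#|X|) : (map_mx Num.conj w^T *m w) 0 0 = 0 -> w = 0.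
Proof.
rewrite mxE; under eq_bigr => i _ do rewrite !mxE mulrC.
have p i : 0 <= w i 0 * (w i 0)^*%R by apply: mul_conjC_ge0.
move=> /psumr_eq0P h; apply/colP => i; rewrite mxE.
by have /eqP := h (fun i _ => p i) i isT; rewrite mul_conjC_eq0 => /eqP.
Qed.

Section Extremal.
Variable x : X.

(** The cosine matrix is symmetric, and a positive multiple of an idempotent. *)
Lemma cosmx_dot th u (v : 'cV[C]_#|X|) : cosine_seq th u -> E x 2 *m v = v ->
  exists2 a : R, 0 < a &
  map_mx Num.conj (cosmx u *m v)^T *m (cosmx u *m v)
  = a%:C *: (map_mx Num.conj v^T *m (E x 2 *m cosmx u *m v)).
Proof.
move=> cu e2; have [a a0 Fa] := cosmx_sqr cu; exists a => //.
have ev : map_mx Num.conj v^T *m E x 2 = map_mx Num.conj v^T.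
  by rewrite -[in RHS]e2 trmx_mul map_mxM /= dual_tr conj_dual.
rewrite -(mulmxA (E x 2)) (mulmxA _ (E x 2)) ev trmx_mul map_mxM /= cosmx_tr conj_cosmx.
by rewrite -mulmxA (mulmxA (cosmx u)) Fa -scalemxAl -scalemxAr.
Qed.

Lemma cosmx_eq0 th u (v : 'cV[C]_#|X|) : cosine_seq th u -> E x 2 *m v = v ->
  E x 2 *m cosmx u *m v = 0 -> cosmx u *m v = 0.
Proof.
move=> cu e2 h; have [a a0 e] := cosmx_dot cu e2.
by apply: dot_eq0; rewrite e h mulmx0 scaler0 mxE.
Qed.

Lemma U_cosmx_eig u v (mu : R) : inU x v -> v + second_dist x *m v = mu%:C *: v ->
  E x 2 *m cosmx u *m v = (gap u 0 + gap u 2 * mu)%:C *: v.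
Proof.
by move=> Uv e; rewrite U_cosmx // e scalerA -scalerDl -rmorphM -rmorphD.
Qed.

Lemma U_cosmx_pos th u v (mu : R) : cosine_seq th u -> inU x v -> v != 0 ->
  v + second_dist x *m v = mu%:C *: v -> 0 <= gap u 0 + gap u 2 * mu.
Proof.
move=> cu Uv v0 e; have [e2 _] := Uv; have [a a0 h] := cosmx_dot cu e2.
have := dot_ge0 (cosmx u *m v); rewrite h (U_cosmx_eig u Uv e) -scalemxAr scalerA mxE.
have p : 0 < (map_mx Num.conj v^T *m v) 0 0.
  rewrite lt_neqAle dot_ge0 eq_sym andbT; apply: contraNneq v0 => z.
  by apply/eqP/dot_eq0.
by rewrite pmulr_lge0 // -rmorphM lecR pmulr_rge0.
Qed.

(** If F_th v = 0 for v in U, then v is an eigenvector of the local graph, say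
    with eigenvalue mu - 1, and E_2 F_th' v is a multiple of v for every th'.
    The multiple is nonnegative because F_th' is, and it is a positive
    multiple of mu (th'^2 - th^2). Hence th^2 is the largest or the least
    nontrivial squared eigenvalue, according to the sign of mu. *)
Lemma extremal_vanish th u v : nontriv th -> cosine_seq th u -> inU x v ->
  cosmx u *m v = 0 ->
  E x 2 *m cosmx (cosine (th_ 1)) *m (E x 2 *m cosmx (cosine (th_ dd)) *m v) = 0.
Proof.
move=> nt cu Uv Fv.
have [->|v0] := eqVneq v 0; first by rewrite !mulmx0.
have h : (gap u 0)%:C *: v + (gap u 2)%:C *: (v + second_dist x *m v) = 0.
  by rewrite -U_cosmx // -mulmxA Fv mulmx0.
have t0 : 0 < gap u 0 := gap0_gt0 cu nt.
have t2 : gap u 2 != 0.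
  apply: contraNneq v0 => t2; move: h; rewrite t2 rmorph0 scale0r addr0 => /eqP.
  by rewrite scaler_eq0 fmorph_eq0 gt_eqF.
(* The value of mu for which the coefficient of v in E_2 F_th v is 0. *)
pose mu := - gap u 0 / gap u 2.
have muv : v + second_dist x *m v = mu%:C *: v.
  have t2C : (gap u 2)%:C != 0 by rewrite fmorph_eq0.
  apply: (scalerI t2C); rewrite scalerA -rmorphM /mu mulrC divfK //.
  by apply/eqP; rewrite -subr_eq0 rmorphN scaleNr opprK addrC h.
have bb : 0 < (b 2)%:R * (b 3)%:R :> R by rewrite mulr_gt0 // ltr0n b_num_gt0 //; lia.
have key th' u' : cosine_seq th' u' -> nontriv th' ->
   (b 2)%:R * (b 3)%:R * (gap u' 0 + gap u' 2 * mu) = gap u' 0 * ((th' ^+ 2 - th ^+ 2) * mu).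
  move=> cu' nt'; rewrite mulrDr mulrA (gap2 cu').
  have : (b 2)%:R * (b 3)%:R = - (th ^+ 2 - (b 2)%:R) * mu.
    have := gap2 cu; rewrite /mu => e; apply: (mulIf t2); rewrite e; field.
    by rewrite t2.
  by move=> ->; ring.
have pos th' u' : cosine_seq th' u' -> nontriv th' -> 0 <= (th' ^+ 2 - th ^+ 2) * mu.
  move=> cu' nt'; have := U_cosmx_pos cu' Uv v0 muv.
  by rewrite -(pmulr_rge0 _ bb) (key _ _ cu' nt') pmulr_rge0 // (gap0_gt0 cu').
have zero th' u' : cosine_seq th' u' -> nontriv th' -> th' ^+ 2 = th ^+ 2 ->
     E x 2 *m cosmx u' *m v = 0.
  move=> cu' nt' e; rewrite (U_cosmx_eig u' Uv muv).
  have := key _ _ cu' nt'; rewrite e subrr mul0r mulr0 => /eqP.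
  by rewrite mulf_eq0 gt_eqF //= => /eqP ->; rewrite scale0r.
have /andP[le1 le2] := nontriv_bounds nt.
have p1 := pos _ _ cosine1 nontriv1; have p2 := pos _ _ cosined nontrivd.
have mu0 : mu != 0 by rewrite /mu mulf_neq0 ?oppr_eq0 ?invr_eq0 // gt_eqF.
have [mup|mun|/eqP] := ltgtP mu 0; last by rewrite (negbTE mu0).
- rewrite (U_cosmx_eig _ Uv muv) -scalemxAr (zero _ _ cosine1 nontriv1) ?scaler0 //.
  apply/eqP; rewrite eq_le le2 andbT -subr_le0.
  by rewrite nmulr_lge0 // in p1.
- rewrite (zero _ _ cosined nontrivd) ?mulmx0 //.
  apply/eqP; rewrite eq_le le1 /= -subr_ge0.
  by rewrite pmulr_lge0 // in p2.
Qed.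

Lemma rad_iter (v : 'cV[C]_#|X|) j : exists f, iter j (mulmx A) v = rad f *m v.
Proof.
elim: j => [|j [f e]]; first by exists (fun i => (i == 0%N)%:R); rewrite -[rad _]/(Am 0) Am0 mul1mx.
by eexists; rewrite iterS e mulmxA adj_rad.
Qed.

Lemma cosmx_iter th u (v : 'cV[C]_#|X|) j : cosine_seq th u ->
  cosmx u *m iter j (mulmx A) v = (th ^+ j)%:C *: (cosmx u *m v).
Proof.
move=> cu; elim: j => [|j IH]; first by rewrite expr0 scale1r.
by rewrite iterS mulmxA (cosmx_adj cu) -scalemxAl IH scalerA exprS rmorphM.
Qed.

(** The vectors A^j v, j < D - 1, lie in the span of the e_i, of dimension at
    most D - 2, so that some nonzero polynomial p of degree less than D - 1
    has p(A) v = 0. Were F_th v nonzero for all nontrivial th, p would vanish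
    at the D - 1 nontrivial eigenvalues. *)
Lemma small_module_vanish (v : 'cV[C]_#|X|) (e : nat -> 'cV[C]_#|X|) :
  (forall m i, exists a : C, E x i *m Am m *m v = a *: e i) ->
  e 0%N = 0 -> e 1%N = 0 -> e D.-1 = 0 ->
  exists2 th, nontriv th & cosmx (cosine th) *m v = 0.
Proof.
move=> he e0 e1 eD.
have [/existsP[i /eqP Fi]|/existsPn h] :=
  boolP [exists i : 'I_D.-1, cosmx (cosine (th_ i.+1)) *m v == 0].
  exists (th_ i.+1) => //; apply: nontriv_theta; have := ltn_ord i; lia.
(* If no F_th kills v, the vectors A^j v with j < D - 1 are independent, which
   is one more than the span of the e_i allows. *)
pose xs := [tuple iter (i : 'I_D.-1) (mulmx A) v | i < D.-1].
have fr : free xs.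
  apply/freeP => q q0 i.
  pose p := \poly_(j < D.-1) (if insub j is Some l then q l else 0 : C).
  have pq : p = \sum_(j < D.-1) q j *: 'X^j.
    by rewrite /p poly_def; apply: eq_bigr => j _; rewrite valK.
  have rp j : (0 < j < D)%N -> root p (th_ j)%:C.
    move=> jD; have cj := eig_cosine (nontriv_eig (nontriv_theta jD)).
    have : cosmx (cosine (th_ j)) *m (\sum_(i < D.-1) q i *: xs`_i) = 0 by rewrite q0 mulmx0.
    rewrite mulmx_sumr.
    have -> : \sum_(i < D.-1) cosmx (cosine (th_ j)) *m (q i *: xs`_i)
      = p.[(th_ j)%:C] *: (cosmx (cosine (th_ j)) *m v).
      rewrite pq horner_sum scaler_suml; apply: eq_bigr => l _.
      rewrite -scalemxAr -tnth_nth tnth_mktuple (cosmx_iter _ _ cj) scalerA.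
      by rewrite hornerZ hornerXn rmorphXn.
    move/eqP; rewrite scaler_eq0 => /orP[//|].
    have jm : (j.-1 < D.-1)%N by lia.
    have := h (Ordinal jm); rewrite /= prednK; last by lia.
    by move/negbTE->.
  have p0 : p = 0.
    apply: (roots_geq_poly_eq0 (rs := [seq (th_ j)%:C | j <- iota 1 D.-1])).
    - apply/allP => z /mapP[j]; rewrite mem_iota => jj ->; apply: rp; lia.
    - rewrite map_inj_in_uniq ?iota_uniq // => j l; rewrite !mem_iota => jj ll /complexI.
      by move/eqP; rewrite nth_uniq ?uniq_eigs ?size_eigs => [/eqP|||]; lia.
    - by rewrite size_map size_iota size_poly.
  have := congr1 (fun r : {poly C} => r`_i) p0; rewrite coef_poly ltn_ord coef0.
  by rewrite valK.
have sub : (<<xs>> <= << [seq e i | i <- D :: iota 2 (D - 3)] >>)%VS.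
  apply/span_subvP => _ /tnthP[j ->]; rewrite tnth_mktuple.
  have [f ->] := rad_iter v j.
  rewrite -[rad f *m v]mul1mx -(sum_dual x) mulmx_suml.
  apply: memv_suml => i _.
  have [a ea] : exists a : C, E x i *m (rad f *m v) = a *: e i.
    have /boolp.choice [g hg] : forall m, exists a : C, E x i *m Am m *m v = a *: e i.
      by move=> m; apply: he.
    exists (\sum_(m < D.+1) f m * g m).
    rewrite rad_sum mulmxA mulmx_sumr mulmx_suml scaler_suml; apply: eq_bigr => m _.
    by rewrite -scalemxAr -scalemxAl hg scalerA.
  rewrite ea; case: (boolP ((i : nat) \in D :: iota 2 (D - 3))) => iS.
    by apply/rpredZ/memv_span/map_f.
  move: iS; rewrite inE mem_iota negb_or; have := ltn_ord i => iD iS.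
  suff -> : e i = 0 by rewrite scaler0 mem0v.
  have : [|| (i == 0 :> nat)%N, (i == 1 :> nat)%N | (i == D.-1 :> nat)] by lia.
  by case/or3P => /eqP ->.
have := leq_trans (dimvS sub) (dim_span _).
rewrite size_map /= size_iota; have /eqP -> : \dim <<xs>> == D.-1.
  by have := fr; rewrite /free size_tuple.
lia.
Qed.

End Extremal.

(** * The tautness equation forces an antipodal 2-cover *)

Local Notation sum_at j v z := ((Am j *m v) (enum_rank z) 0).

Lemma dual_entry x i (M : 'M[C]_#|X|) (v : 'cV[C]_#|X|) z : d x z = i ->
  (E x i *m M *m v) (enum_rank z) 0 = (M *m v) (enum_rank z) 0.
Proof. by move=> xz; rewrite -mulmxA dual_mulv xz eqxx mul1r. Qed.

Lemma cosmx_rel x th u v i z : cosine_seq th u -> inU x v -> cosmx u *m v = 0 ->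
  d x z = i.+2 -> (gap u i)%:C * sum_at i v z = (gap u i.+2)%:C * sum_at i.+4 v z.
Proof.
move=> cu Uv Fv xz; have h := U_rad (toC u) i Uv.
rewrite -[rad _]/(cosmx u) -mulmxA Fv mulmx0 in h.
have := congr1 (fun w : 'cV[C]_#|X| => w (enum_rank z) 0) h.
rewrite [LHS]mxE [RHS]mxE [X in _ = X + _]mxE [X in _ = _ + X]mxE [X in _ = _ - X]mxE.
rewrite !dual_entry // /toC -!rmorphB => /esym/eqP; rewrite subr_eq0 => /eqP; exact.
Qed.

(** Since F_1 P F_d = 0, the vector E_2 F_d v is killed by F_1 and E_2 F_1 v
    by F_d. Both are combinations of v and of its image under the local graph,
    and the matrix of coefficients is invertible because theta_1^2 and
    theta_d^2 differ. *)
Lemma U_split x v : defect (th_ 1) (th_ dd) = 0 -> inU x v ->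
  exists v1 vd, [/\ inU x v1, inU x vd, v = v1 + vd,
     cosmx (cosine (th_ 1)) *m v1 = 0 & cosmx (cosine (th_ dd)) *m vd = 0].
Proof.
move=> d0 Uv; set u1 := cosine (th_ 1); set ud := cosine (th_ dd).
have FPF := defect_cosmx_proj_cosmx x cosine1 cosined d0; rewrite -/u1 -/ud in FPF.
have FPF' : cosmx ud *m proj_U x *m cosmx u1 = 0.
  have := congr1 trmx FPF.
  by rewrite !trmx_mul !cosmx_tr proj_U_tr trmx0 mulmxA.
have PE u : E x 2 *m cosmx u *m v = proj_U x *m cosmx u *m v.
  rewrite -{1}(proj_U_id (U_stable (toC u) Uv)) -!mulmxA (mulmxA (proj_U x) (E x 2)).
  by rewrite proj_U_dual2.
(* By gap2 the determinant is a nonzero multiple of theta_d^2 - theta_1^2. *)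
pose det := gap ud 2 * gap u1 0 - gap u1 2 * gap ud 0.
have bb : 0 < (b 2)%:R * (b 3)%:R :> R by rewrite mulr_gt0 // ltr0n b_num_gt0 //; lia.
have det0 : det != 0.
  suff : (b 2)%:R * (b 3)%:R * det != 0 by apply: contraNneq => ->; rewrite mulr0.
  rewrite /det mulrBr !mulrA (gap2 cosined) (gap2 cosine1) -/u1 -/ud.
  have -> : (th_ dd ^+ 2 - (b 2)%:R) * gap ud 0 * gap u1 0
    - (th_ 1 ^+ 2 - (b 2)%:R) * gap u1 0 * gap ud 0
    = (th_ dd ^+ 2 - th_ 1 ^+ 2) * (gap u1 0 * gap ud 0) by ring.
  rewrite mulf_neq0 ?mulf_neq0 //; first by rewrite subr_eq0 lt_eqF // theta_d_lt1.
    exact/lt0r_neq0/(gap0_gt0 cosine1 nontriv1).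
  exact/lt0r_neq0/(gap0_gt0 cosined nontrivd).
have detC : det%:C != 0 by rewrite fmorph_eq0.
exists (- (gap u1 2 / det)%:C *: (E x 2 *m cosmx ud *m v)).
exists ((gap ud 2 / det)%:C *: (E x 2 *m cosmx u1 *m v)); split.
- have [h1 h2] := U_stable (toC ud) Uv; split; rewrite -scalemxAr; first by rewrite h1.
  by rewrite h2 scaler0.
- have [h1 h2] := U_stable (toC u1) Uv; split; rewrite -scalemxAr; first by rewrite h1.
  by rewrite h2 scaler0.
- rewrite !U_cosmx //; move: (v + _) => w.
  rewrite !rmorphM /= fmorphV /=; apply: cramer_combo; last exact: detC.
  by rewrite /det rmorphB !rmorphM.
- by rewrite -scalemxAr PE !mulmxA FPF mul0mx scaler0.
- by rewrite -scalemxAr PE !mulmxA FPF' mul0mx scaler0.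
Qed.

(** The part of the intersection array already known to be that of an
    antipodal 2-cover. *)
Definition sym_upto i := forall j, (j <= i)%N -> c (D - j) = b j.

Lemma sym_b i j : sym_upto i -> (j <= i)%N -> (j <= D)%N -> b (D - j) = c j.
Proof.
move=> H ji jD; have := c_addn_b jD; have := c_addn_b (leq_subr j D).
by rewrite H //; lia.
Qed.

(** Induction along a geodesic from o: the b_(D-j) and c_j neighbours of a
    vertex at distance j are equally many and one set contains the other. *)
Lemma antipode_dist i o z y j : (i < D)%N -> sym_upto i -> d o z = D -> d o y = j -> (j <= i.+1)%N ->
  d y z = (D - j)%N.
Proof.
move=> iD H oz; elim/ltn_ind: j y => -[|j] IH y oy ji.
  by move/eqP: oy; rewrite gdist_eq0 => /eqP <-; rewrite subn0.
have [y0 yy0 y0o] : exists2 y0, adj y y0 & d y0 o = j by apply: gdist_step; rewrite gdistC.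
have oy0 : d o y0 = j by rewrite gdistC.
have y0z : d y0 z = (D - j)%N by apply: IH => //; lia.
have y0y : adj y0 y by rewrite adjC.
pose P := [set w | adj y0 w & d w o == (d y0 o).-1].
pose Q := [set w | adj y0 w & d w z == (d y0 z).+1].
have PQ : P = Q.
  apply/eqP; rewrite eqEcard card_closer card_farther y0o y0z (sym_b H) ?leqnn ?andbT //; try lia.
  apply/subsetP => w; rewrite !inE => /andP[yw /eqP wo]; rewrite yw /= y0z.
  case: (posnP j) => j0.
    move: wo; rewrite y0o j0 /= => /eqP; rewrite gdist_eq0 => /eqP e.
    by move: y0o; rewrite j0 => /eqP; rewrite gdist_eq0 => /eqP e'; rewrite e' e adj_irr in yw.
  have ow : d o w = j.-1 by rewrite gdistC wo y0o.
  by apply/eqP; rewrite (IH j.-1) //; lia.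
have yP : y \notin P.
  by rewrite inE y0y /= gdistC oy y0o; lia.
have := gdist_adj_cases z y0y; rewrite !(gdistC z) y0z.
move: yP; rewrite PQ inE y0y /= y0z; lia.
Qed.

(** The symmetry of the array known so far turns the recurrence at D - j into
    the one at j, and u_(D-1) / u_D is determined by the equation at D. *)
Lemma u_reverse i th u j : cosine_seq th u -> (i < D)%N -> sym_upto i -> (j <= i.+1)%N ->
  u (D - j)%N = u D * u j.
Proof.
move=> cu iD H; elim/ltn_ind: j => -[|j] IH ji; first by rewrite subn0 (u0 cu) mulr1.
have jD : (j <= D)%N by lia.
have e1 := urec cu (leq_subr j D); have e2 := urec cu jD.
rewrite (H j) // (sym_b H) // (IH j) // in e1; last by lia.
have bj : (b j)%:R != 0 :> R by rewrite pnatr_eq0 -lt0n b_num_gt0 //; lia.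
apply: (mulfI bj).
have -> : (D - j.+1 = (D - j).-1)%N by lia.
have e3 : (c j)%:R * u (D - j).+1 = (c j)%:R * (u D * u j.-1).
  case: (posnP j) => [->|j0]; first by rewrite c_num0 !mul0r.
  have -> : ((D - j).+1 = D - j.-1)%N by lia.
  by rewrite (IH j.-1) //; lia.
rewrite e3 in e1.
have -> : (b j)%:R * u (D - j).-1 = th * (u D * u j) - (c j)%:R * (u D * u j.-1).
  by rewrite -e1 addrK.
rewrite mulrCA -e2; ring.
Qed.

Section SymmetricStep.
Variables (i : nat) (x z o : X).
Hypothesis iD : (i.+2 <= D)%N.
Hypothesis Hi : sym_upto i.
Hypothesis oz : d o z = D.
Hypothesis ox : d o x = i.
Hypothesis xz : d x z = (D - i)%N.

Let K y j := @antipode_dist i o z y j (ltnW iD) Hi oz.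

(** The vertices at distance 2 from x that are nearest to o are those farthest
    from z. *)
Lemma dist_near y : (2 <= i)%N -> d x y = 2 ->
  (d z y == D - i + 2)%N = (d o y == i - 2)%N.
Proof.
move=> i2 xy; apply/eqP/eqP => h; last by rewrite gdistC (K h); lia.
have [r xr ry] := gdist_step xy.
have ry' : adj r y by rewrite -gdist_eq1 ry.
case: (gdist_adj_cases o xr) => e1.
  have := K e1; rewrite ox => /(_ (leqnn _)) rz.
  have := gdist_adj_le z ry'; rewrite (gdistC z r) rz h; lia.
have or : d o r = i.-1 by lia.
case: (gdist_adj_cases o ry') => e2; last by lia.
have := K e2; rewrite or prednK; last by lia.
by move=> /(_ (leqnSn _)); rewrite gdistC h; lia.
Qed.

Lemma sum_at_near v : (2 <= i)%N -> inU x v -> sum_at (D - i + 2) v z = sum_at (i - 2) v o.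
Proof.
move=> i2 [e2 _]; rewrite !kmx_mulv; apply: eq_bigr => y _.
case: (eqVneq (d x y) 2) => xy; first by rewrite dist_near.
by rewrite -e2 dual_mulv (negbTE xy) mul0r !mulr0.
Qed.

(** One relation links the sums of v at distances D - i - 2 and D - i + 2 from
    z, another those at distances i - 2 and i + 2 from o. They share the term
    of the vertices nearest to o; eliminating it leaves a relation whose
    coefficients do not depend on the eigenvalue, by the symmetry of the
    cosines. *)
Lemma reflect_relation th u v : cosine_seq th u ->
  (forall j, (j.+2 <= D)%N -> gap u j != 0) -> inU x v -> cosmx u *m v = 0 ->
  (b i.+1)%:R * sum_at (D - i - 2) v z = (c (D - i.+1))%:R * sum_at i.+2 v o.
Proof.
move=> cu tn Uv Fv.
have uD := u_neq0_D cu.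
have rev j : (j <= i.+1)%N -> u (D - j)%N = u D * u j := u_reverse cu (ltnW iD) Hi (j := j).
have [m Dm] : exists m, (D - i = m.+2)%N by exists (D - i - 2)%N; lia.
have xz' : d x z = m.+2 by rewrite xz.
have rz := cosmx_rel cu Uv Fv xz'.
have -> : (D - i - 2 = m)%N by lia.
have e2 : (c (D - i.+1))%:R * gap u m = - (u D * ((b i.+1)%:R * gap u i)).
  have Dm1 : (D - i.+1 = m.+1)%N by lia.
  have h1 := urec cu (leq_subr i.+1 D); have h2 := urec cu (ltnW iD).
  rewrite Dm1 /= in h1 *.
  have r1 := rev i.+1 (leqnn _); have r0 := rev i (leqnSn _).
  rewrite Dm1 in r1; rewrite Dm in r0.
  have cb1 : (c m.+1)%:R + (b m.+1)%:R = (valency adj)%:R :> R by rewrite -natrD c_addn_b //; lia.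
  have cb2 : (c i.+1)%:R + (b i.+1)%:R = (valency adj)%:R :> R by rewrite -natrD c_addn_b //; lia.
  rewrite /gap mulrBr.
  have -> : (c m.+1)%:R * u m = th * u m.+1 - (b m.+1)%:R * u m.+2 by rewrite -h1 addrK.
  have -> : (b i.+1)%:R * (u i - u i.+2) = (b i.+1)%:R * u i - (th * u i.+1 - (c i.+1)%:R * u i).
    by rewrite -h2 /=; ring.
  transitivity (th * u m.+1 - ((c m.+1)%:R + (b m.+1)%:R) * u m.+2); first by ring.
  by rewrite cb1 -cb2 r1 r0; ring.
have cn : (c (D - i.+1))%:R != 0 :> R by rewrite pnatr_eq0 -lt0n c_num_gt0 //; lia.
have ti : gap u i != 0 by apply: tn.
have [i2|i2] := leqP 2 i; last first.
  have z0 : sum_at i.+2 v o = 0.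
    case: i ox i2 => [|[|//]] ox' _.
      by rewrite -(@dual_entry x 0%N (Am 2)) ?U_rad0 ?mxE //; rewrite gdistC.
    by rewrite -(@dual_entry x 1%N (Am 3)) ?U_rad1 ?mxE //; rewrite gdistC.
  rewrite (@Am_big m.+4) in rz; last by lia.
  rewrite mul0mx [X in _ = _ * X]mxE mulr0 in rz.
  move/eqP: rz; rewrite mulf_eq0 fmorph_eq0 (negbTE (tn m _)) /=; last by lia.
  by rewrite z0 mulr0 => /eqP->; rewrite mulr0.
have [i' ei] : exists i', i = i'.+2 by exists (i - 2)%N; lia.
have xo : d x o = i'.+2 by rewrite gdistC ox ei.
have ro := cosmx_rel cu Uv Fv xo.
have near := sum_at_near i2 Uv.
have ei2 : (i - 2 = i')%N by lia.
have em : (D - i + 2 = m.+4)%N by lia.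
rewrite ei2 em in near; rewrite near in rz.
have t2 : gap u m.+2 = - (u D * gap u i').
  have r0 := rev i (leqnSn _); have r2 := rev i' _.
  rewrite Dm in r0; have ei3 : (D - i' = m.+4)%N by lia.
  by rewrite /gap r0 -{1}ei3 r2 ?ei //; [ring|lia].
have key : (c (D - i.+1))%:R * (gap u m)%:C * sum_at m v z
   = - ((u D)%:C * ((c (D - i.+1))%:R * ((gap u i)%:C * sum_at i.+2 v o))).
  rewrite -mulrA rz t2 ei -ro rmorphN rmorphM; ring.
have e2C := congr1 (real_complex R) e2.
rewrite !(rmorphM, rmorphN, rmorph_nat) in e2C.
rewrite e2C in key.
have uDC : (u D)%:C != 0 by rewrite fmorph_eq0.
have tiC : (gap u i)%:C != 0 by rewrite fmorph_eq0.
apply: (mulfI uDC); apply: (mulfI tiC); apply: oppr_inj.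
transitivity (- ((u D)%:C * ((b i.+1)%:R * (gap u i)%:C)) * sum_at m v z); first by ring.
by rewrite key; ring.
Qed.

End SymmetricStep.

(** The relation of reflect_relation does not depend on the eigenvalue, hence
    holds for all v in U by U_split. The function whose pairing with v it
    expresses lies itself in U, so that it is orthogonal to itself and
    vanishes; at a vertex on the geodesic from x to z this says c_(D-i-1) =
    b_(i+1). *)
Lemma symmetric_step i : defect (th_ 1) (th_ dd) = 0 -> (i.+2 <= D)%N ->
  sym_upto i -> c (D - i.+1) = b i.+1.
Proof.
move=> d0 iD Hi.
have [o [z oz]] := exists_diameter.
have [|x ox xz] := @gdist_prefix i o z; first by rewrite oz; lia.
rewrite oz in xz.
have K y j := @antipode_dist i o z y j (ltnW iD) Hi oz.
have rel v : inU x v ->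
  (b i.+1)%:R * sum_at (D - i - 2) v z = (c (D - i.+1))%:R * sum_at i.+2 v o.
  move=> Uv; have [v1 [vd [U1 Ud ev F1 Fd]]] := U_split d0 Uv.
  rewrite ev !mulmxDr [X in _ * X = _]mxE [X in _ = _ * X]mxE !mulrDr.
  rewrite (reflect_relation iD Hi oz ox xz cosine1 gap_theta1_neq0 U1 F1).
  by rewrite (reflect_relation iD Hi oz ox xz cosined gap_thetad_neq0 Ud Fd).
pose bb : C := (b i.+1)%:R; pose cc : C := (c (D - i.+1))%:R.
(* The pairing of v in U with phi is the difference of the two sides of rel. *)
pose phi y : C := bb * (d y z == D - i - 2)%N%:R - cc * (d y o == i.+2)%:R.
pose w : 'cV[C]_#|X| := \col_p ((d x (enum_val p) == 2)%:R * phi (enum_val p)).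
have wE y : w (enum_rank y) 0 = (d x y == 2)%:R * phi y by rewrite mxE enum_rankK.
have Uw : inU x w.
  split; apply: colP_rank => r; rewrite -?mulmxA dual_mulv.
    by rewrite wE; case: (d x r == 2); rewrite ?(mul0r, mul1r).
  rewrite [RHS]mxE; case: (d x r =P 1%N) => [xr|_]; last by rewrite mul0r.
  rewrite mul1r adjmxE kmx_mulv.
  have xr' : adj x r by rewrite -gdist_eq1 xr.
  have rx' : adj r x by rewrite adjC.
  have e y : (adj r y)%:R * w (enum_rank y) 0
    = bb * ((adj r y)%:R * (d y z == D - i - 2)%N%:R)
      - cc * ((adj r y)%:R * (d y o == i.+2)%:R).
    rewrite wE; case ry : (adj r y); last by rewrite !mul0r !mulr0 subrr.
    rewrite !mul1r; case: (d x y =P 2) => [_|n2]; first by rewrite mul1r.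
    suff -> : y = x.
      have -> : (d x z == D - i - 2)%N = false by lia.
      have -> : (d x o == i.+2) = false by rewrite gdistC; lia.
      by rewrite !mulr0 mul0r subrr.
    have := gdist_adj_cases x ry; rewrite xr => -[h|[h]]; first by case: n2.
    by apply/eqP; rewrite eq_sym -gdist_eq0 -h.
  under eq_bigr => y _ do rewrite e.
  rewrite sumrB -!mulr_sumr (sum_neighbours (fun l => (l == D - i - 2)%N%:R)).
  rewrite (sum_neighbours (fun l => (l == i.+2)%N%:R)).
  have := gdist_adj_cases o xr'; rewrite ox => -[or|or].
    have rz := K _ _ or (leqnn _); rewrite rz (gdistC r o) or /=.
    have -> : ((D - i.+1).-1 == D - i - 2)%N by lia.
    have -> : ((D - i.+1).+1 == D - i - 2)%N = false by lia.
    have -> : (i == i.+2) = false by lia.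
    by rewrite eqxx !mulr0 !mulr1 add0r addr0 /bb /cc mulrC subrr.
  have ori : d o r = i.-1 by lia.
  have rz : d r z = (D - i.-1)%N by apply: K ori _; lia.
  rewrite rz (gdistC r o) ori.
  have -> : ((D - i.-1).-1 == D - i - 2)%N = false by lia.
  have -> : ((D - i.-1).+1 == D - i - 2)%N = false by lia.
  have -> : (i.-1.-1 == i.+2) = false by lia.
  have -> : (i.-1.+1 == i.+2) = false by lia.
  by rewrite !mulr0 !addr0 !mulr0 subrr.
have w0 : w = 0.
  apply: dot_eq0; rewrite mxE.
  have phiR y : (phi y)^*%R = phi y by rewrite /phi /bb /cc !(rmorphB, rmorphM, rmorph_nat).
  transitivity (\sum_y (w (enum_rank y) 0 * w (enum_rank y) 0)).
    rewrite -[RHS]sum_enum_val; apply: eq_bigr => p _; rewrite enum_valK !mxE; congr (_ * _).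
    by rewrite rmorphM rmorph_nat; congr (_ * _); exact: phiR.
  have := rel w Uw; rewrite !kmx_mulv => e.
  transitivity (bb * (\sum_y (d z y == D - i - 2)%N%:R * w (enum_rank y) 0)
     - cc * (\sum_y (d o y == i.+2)%N%:R * w (enum_rank y) 0)); last by rewrite e subrr.
  rewrite !mulr_sumr -sumrB; apply: eq_bigr => y _.
  rewrite !wE (gdistC z) (gdistC o); case: (d x y == 2); rewrite ?(mul1r, mul0r, mulr0, subr0) //.
  by rewrite {1}/phi; move: (phi y) (_ == _)%:R (_ == _)%:R => p q r; ring.
have [|y xy yz] := @gdist_prefix 2 x z; first by rewrite xz; lia.
have := wE y; rewrite w0 mxE xy eqxx mul1r /phi => /esym/eqP.
have -> : (d y z == D - i - 2)%N by lia.
rewrite mulr1 subr_eq0; case: (d y o == i.+2).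
  by rewrite mulr1 /bb /cc eqr_nat => /eqP->.
have : (0 < b i.+1)%N by apply: b_num_gt0; lia.
by rewrite mulr0 /bb pnatr_eq0 => h /eqP e; rewrite e in h.
Qed.

Lemma symmetric_all : defect (th_ 1) (th_ dd) = 0 -> sym_upto D.-1.
Proof.
move=> d0.
have h i : (i < D)%N -> sym_upto i.
  elim: i => [|i IH] iD j ji.
    have -> : j = 0%N by lia.
    by rewrite subn0 c_num_diameter.
  have [->|ne] := eqVneq j i.+1; last by apply: IH; lia.
  by apply: symmetric_step => //; apply: IH; lia.
apply: h; lia.
Qed.

Lemma antipode_all : defect (th_ 1) (th_ dd) = 0 ->
  forall o z y, d o z = D -> d y z = (D - d o y)%N.
Proof.
move=> d0 o z y oz; have [n Dn] : exists n, D = n.+1 by exists D.-1; lia.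
apply: (@antipode_dist D.-1 o z y _ _ (symmetric_all d0) oz erefl).
  by rewrite Dn /=.
by rewrite Dn -Dn; apply: gdist_diameter.
Qed.

(** Once the array is symmetric, a vertex at distance D from x determines all
    distances to it, hence is unique. *)
Lemma defect_antipodal : defect (th_ 1) (th_ dd) = 0 -> antipodal_2_cover adj.
Proof.
move=> d0 x.
have [|y xy _] := @exists_gdist_from x x D; first by rewrite gdistxx leqnn.
exists y; split=> // y' xy'.
apply/eqP; rewrite -gdist_eq0.
have := antipode_all d0 y xy'; rewrite xy subnn => e.
by rewrite e.
Qed.

(** * The tautness equation forces thin modules *)

Section ThinModule.
Variable x : X.

Local Notation T := (terwilliger (R := R) adj x).

Lemma terw0 : T 0.
Proof. by rewrite -(scale0r (1%:M : 'M[C]_#|X|)); apply/Terw_scale/Terw_one. Qed.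

Lemma terw_sum (I : Type) (r : seq I) (f : I -> 'M[C]_#|X|) :
  (forall i, T (f i)) -> T (\sum_(i <- r) f i).
Proof. by move=> h; apply: big_ind => //; [exact: terw0|exact: Terw_add]. Qed.

Lemma terw_dual i : T (E x i).
Proof.
have [iD|iD] := leqP i D; first exact: Terw_dual.
by rewrite dual_big //; apply: terw0.
Qed.

Lemma terw_Am j : T (Am j).
Proof.
suff [] : T (Am j) /\ T (Am j.+1) by [].
elim: j => [|j [IH1 IH2]].
  by rewrite Am0 Am1; split; [exact: Terw_one|exact: Terw_adj].
split=> //; have [jD|jD] := leqP j.+2 D; last by rewrite Am_big //; apply: terw0.
have cn : (c j.+2)%:R != 0 :> C by rewrite pnatr_eq0 -lt0n c_num_gt0.
have -> : Am j.+2 = (c j.+2)%:R^-1 *: (A *m Am j.+1 + (- (b j)%:R) *: Am j).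
  by rewrite adj_Am scaleNr addrAC addrN add0r scalerK.
apply: Terw_scale; apply: Terw_add; last exact: Terw_scale.
by apply: Terw_mul => //; apply: Terw_adj.
Qed.

Lemma terw_rad f : T (rad f).
Proof. by rewrite rad_sum; apply: terw_sum => j; apply/Terw_scale/terw_Am. Qed.

Lemma cosmx_vec th u v j : cosine_seq th u -> inU x v -> cosmx u *m v = 0 ->
  (gap u j)%:C *: (E x j.+2 *m Am j *m v) = (gap u j.+2)%:C *: (E x j.+2 *m Am j.+4 *m v).
Proof.
move=> cu Uv Fv; have h := U_rad (toC u) j Uv.
rewrite -[rad _]/(cosmx u) -mulmxA Fv mulmx0 in h.
by apply/eqP; rewrite -subr_eq0 !rmorphB -h.
Qed.

Section Span.
Variables (th : R) (u : nat -> R) (v : 'cV[C]_#|X|).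

(** The vectors obtained by raising v along geodesics. *)
Definition gen j := E x j.+2 *m Am j *m v.
Definition span_gen : {vspace 'cV[C]_#|X|} := << [seq gen j | j <- iota 0 (D - 3)] >>%VS.

Lemma span_genP (B : 'M[C]_#|X|) (Y : {vspace 'cV[C]_#|X|}) :
  (forall j, (j < D - 3)%N -> B *m gen j \in Y) ->
  forall y, y \in span_gen -> B *m y \in Y.
Proof.
move=> h y; have : (span_gen <= linfun (mulmx B) @^-1: Y)%VS.
  apply/span_subvP => z /mapP[j]; rewrite mem_iota add0n => /andP[_ jD] ->.
  by rewrite -memv_preim lfunE; apply: h.
by move=> /subvP sub /sub; rewrite -memv_preim lfunE.
Qed.

Lemma mem_gen j : (j < D - 3)%N -> gen j \in span_gen.
Proof. by move=> jD; apply/memv_span/map_f; rewrite mem_iota. Qed.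

Lemma dual_gen i j : E x i *m gen j = if i == j.+2 then gen j else 0.
Proof. by rewrite /gen !mulmxA dual_mul; case: eqP => [->|] //; rewrite !mul0mx. Qed.

Lemma gen0 : inU x v -> gen 0 = v.
Proof. by case=> e _; rewrite /gen Am0 mulmx1. Qed.

(** Since F v = 0, the lowered vectors E_(j+2) A_(j+4) v are multiples of the
    raised vectors E_(j+2) A_j v, so that the span of the latter is closed
    under raising and lowering. *)
Lemma Tmodule_span_gen : cosine_seq th u -> (forall j, (j.+2 <= D)%N -> gap u j != 0) ->
  inU x v -> cosmx u *m v = 0 -> Tmodule adj x span_gen.
Proof.
move=> cu tn Uv Fv.
have vec j := cosmx_vec j cu Uv Fv.
have tC j : (j.+2 <= D)%N -> (gap u j)%:C != 0 by move=> jD; rewrite fmorph_eq0 tn.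
have hA j : (j < D - 3)%N -> A *m gen j \in span_gen.
  move=> jD.
  have eg : gen j = E x j.+2 *m gen j by rewrite dual_gen eqxx.
  rewrite eg mulmxA adj_dual mulmxDl -!(mulmxA _ (E x j.+2)) -eg; apply: rpredD.
    rewrite /gen U_raise //; apply: rpredZ.
    have [jD'|jD'] := ltnP j.+1 (D - 3); first exact: mem_gen.
    suff -> : E x j.+3 *m Am j.+1 *m v = 0 by apply: mem0v.
    have := vec j.+1; rewrite (@Am_big j.+1.+4); last by lia.
    rewrite mulmx0 mul0mx scaler0 => /eqP.
    by rewrite scaler_eq0 (negbTE (tC _ _)) /=; [move/eqP|lia].
  have ep : gen j = ((gap u j)%:C^-1 * (gap u j.+2)%:C) *: (E x j.+2 *m Am j.+4 *m v).
    by rewrite -scalerA -vec scalerK //; apply: tC; lia.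
  case: j jD eg ep => [|j] jD eg ep.
    by rewrite gen0 // ; case: Uv => _ ->; apply: mem0v.
  rewrite ep -scalemxAr U_lower //; do 2!apply: rpredZ.
  have -> : E x j.+2 *m Am j.+4 *m v = ((gap u j.+2)%:C^-1 * (gap u j)%:C) *: gen j.
    by rewrite -scalerA /gen vec scalerK //; apply: tC; lia.
  by apply/rpredZ/mem_gen; lia.
move=> B; elim=> [|||||] {B}.
- exact: span_genP.
- move=> i iD; apply: span_genP => j jD; rewrite dual_gen.
  by case: eqP => _; [apply: mem_gen|apply: mem0v].
- by move=> w; rewrite mul1mx.
- by move=> B B' _ IH _ IH' w wS; rewrite mulmxDl rpredD ?IH ?IH'.
- by move=> a B _ IH w wS; rewrite -scalemxAl rpredZ ?IH.
- by move=> B B' _ IH _ IH' w wS; rewrite -mulmxA IH ?IH'.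
Qed.

Lemma thin_span_gen : thin adj x span_gen.
Proof.
move=> i iD; apply: leq_trans (_ : \dim <[gen i.-2]> <= 1)%N; last by rewrite dim_vline leq_b1.
apply: dimvS; apply/subvP => _ /memv_imgP[y yS ->]; rewrite lfunE /=.
apply: (span_genP _ yS) => j jD; rewrite dual_gen.
by case: eqP => [->|_]; [apply: memv_line|apply: mem0v].
Qed.

End Span.

Lemma Tmodule_gen W v j : Tmodule adj x W -> v \in W -> gen v j \in W.
Proof.
move=> TW vW; apply: TW => //; apply: Terw_mul; [exact: terw_dual|exact: terw_Am].
Qed.

Lemma endpoint2_inU W w : Tmodule adj x W -> dual_image adj x 1 W = 0%VS ->
  w \in W -> inU x (E x 2 *m w).
Proof.
move=> TW z wW; split; first by rewrite mulmxA dual_idem2.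
have h : A *m (E x 2 *m w) \in W.
  by apply: (TW); [exact: Terw_adj|apply: (TW) => //; exact: terw_dual].
have : linfun (mulmx (E x 1)) (A *m (E x 2 *m w)) \in dual_image adj x 1 W.
  exact: memv_img.
by rewrite z memv0 lfunE /= => /eqP h0; rewrite -[RHS]h0 !mulmxA.
Qed.

Lemma U_kill v : defect (th_ 1) (th_ dd) = 0 -> inU x v ->
  cosmx (cosine (th_ 1)) *m (E x 2 *m cosmx (cosine (th_ dd)) *m v) = 0.
Proof.
move=> d0 Uv; have e := proj_U_id (U_stable (toC (cosine (th_ dd))) Uv).
rewrite -[rad _]/(cosmx _) in e; rewrite -e -!mulmxA (mulmxA (proj_U x) (E x 2)) proj_U_dual2.
by rewrite !mulmxA (defect_cosmx_proj_cosmx x cosine1 cosined d0) mul0mx.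
Qed.

(** Let v in U be a nonzero bottom vector of an irreducible module of endpoint
    2. Either F_d v = 0, or v' = E_2 F_d v is a nonzero vector of U in the
    module with F_1 v' = 0. In both cases the module is the span of the
    vectors raised from v or v', which has one vector in each degree. *)
Lemma defect_two_thin : defect (th_ 1) (th_ dd) = 0 -> two_thin R adj x.
Proof.
move=> d0 W [TW W0 irr] [e2 e01].
have z1 := e01 1%N isT.
have [w wW w0] : exists2 w, w \in W & E x 2 *m w != 0.
  have : vpick (dual_image adj x 2 W) != 0 by rewrite vpick0; apply/eqP.
  have /memv_imgP[w wW ->] := memv_pick (dual_image adj x 2 W).
  by rewrite lfunE /= => h; exists w.
set v := E x 2 *m w in w0.
have Uv : inU x v := endpoint2_inU TW z1 wW.
have vW : v \in W by apply: TW => //; apply: terw_dual.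
have main th u v' : cosine_seq th u -> (forall j, (j.+2 <= D)%N -> gap u j != 0) ->
   inU x v' -> v' \in W -> v' != 0 -> cosmx u *m v' = 0 -> thin adj x W.
  move=> cu tn Uv' v'W v'0 Fv'.
  have sub : (span_gen v' <= W)%VS.
    by apply/span_subvP => _ /mapP[j _ ->]; apply: Tmodule_gen.
  have [z|<-] := irr _ sub (Tmodule_span_gen cu tn Uv' Fv'); last exact: thin_span_gen.
  have : v' \in span_gen v' by rewrite -{1}(gen0 Uv') mem_gen //; lia.
  by rewrite z memv0 (negbTE v'0).
have [Fd|Fd] := eqVneq (cosmx (cosine (th_ dd)) *m v) 0.
  exact: (main _ _ _ cosined gap_thetad_neq0 Uv vW).
set v' := E x 2 *m cosmx (cosine (th_ dd)) *m v.
have Uv' : inU x v' by apply: U_stable.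
have v'0 : v' != 0.
  apply: contraNneq Fd => z; apply/eqP/(cosmx_eq0 (x := x) cosined) => //.
  by case: Uv.
have v'W : v' \in W.
  by apply: TW => //; apply: Terw_mul; [exact: terw_dual|exact: terw_rad].
apply: (main _ _ _ cosine1 gap_theta1_neq0 Uv' v'W v'0).
exact: U_kill.
Qed.

End ThinModule.

(** * Thin modules force the tautness equation *)

Section Perp.
Variable W : {vspace 'cV[C]_#|X|}.

Definition perp_mx : 'M[C]_(\dim W, #|X|) :=
  \matrix_(i, j) ((vbasis W)`_i j 0)^*%R.
(** The orthogonal complement, for the Hermitian product, as the kernel of the
    conjugate transpose of a basis. *)
Definition perp : {vspace 'cV[C]_#|X|} := lker (linfun (mulmx perp_mx)).

Lemma perpP u : reflect (forall w, w \in W -> map_mx Num.conj w^T *m u = 0) (u \in perp).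
Proof.
rewrite memv_ker lfunE /=; apply: (iffP eqP) => [h w|h].
  move/coord_vbasis => ->; rewrite linear_sum map_mx_sum mulmx_suml big1 // => i _.
  rewrite linearZ map_mxZ -scalemxAl; apply/eqP; rewrite scaler_eq0; apply/orP; right.
  apply/eqP/matrixP => p q; rewrite !ord1 !mxE.
  have /colP/(_ i) := h; rewrite !mxE => e; rewrite -[RHS]e; apply: eq_bigr => j _.
  by rewrite !mxE.
apply/colP => i; rewrite !mxE.
have := h (vbasis W)`_i (vbasis_mem (mem_nth 0 _)); rewrite size_tuple ltn_ord => /(_ isT).
move=> /matrixP/(_ 0 0); rewrite !mxE => e; rewrite -[RHS]e; apply: eq_bigr => j _.
by rewrite !mxE.
Qed.

Lemma perp_cap : (W :&: perp = 0)%VS.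
Proof.
apply/eqP; rewrite -subv0; apply/subvP => u; rewrite memv_cap => /andP[uW /perpP up].
by rewrite memv0; apply/eqP/dot_eq0; rewrite up // mxE.
Qed.

Lemma perp_add : (W + perp = fullv)%VS.
Proof.
apply/eqP; rewrite eqEdim subvf /= dimv_disjoint_sum ?perp_cap //.
have e := limg_ker_dim (linfun (mulmx perp_mx) : 'Hom('cV[C]_#|X|, 'cV[C]_(\dim W))) fullv.
rewrite (capv_idPr (subvf _)) -/perp in e; rewrite -e.
rewrite addnC leq_add2r; apply: leq_trans (dimvS (subvf _)) _.
by rewrite dimvf dim_matrix; apply: eq_leq; apply: muln1.
Qed.

End Perp.

Section LowOrth.
Variable x : X.
Local Notation J := (rad (fun _ => 1)).
Local Notation T := (terwilliger (R := R) adj x).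

(** Orthogonality to the T-modules generated by x and by its neighbours; these
    contain all of the irreducible modules of endpoint 0 and 1. The space of
    such vectors is a T-module that contains U. *)
Definition low_orth (u : 'cV[C]_#|X|) :=
  (forall j, J *m (E x j *m u) = 0) /\ (forall j m, E x 1 *m Am m *m (E x j *m u) = 0).

Lemma J_dual_up j : J *m E x j *m A *m E x j.+1 = (c j.+1)%:R *: (J *m E x j.+1).
Proof.
rewrite adjmxE kmx_dual kmxM !kmx_dual kmxZ; apply: eq_kmx => z y.
case: (d x y =P j.+1) => [xy|_]; last by rewrite !mulr0.
have := sum_neighbours (fun i => (i == j)%:R) y x.
rewrite (gdistC y) xy /= eqxx (_ : (j.+2 == j) = false) ?mulr0 ?addr0 ?mulr1; last by lia.
move=> <-; apply: eq_bigr => t _.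
by rewrite mul1r mulrC (gdistC x t) -!gdist_eq1 (gdistC t y).
Qed.

Lemma J_dual_down j : J *m E x j.+1 *m A *m E x j = (b j)%:R *: (J *m E x j).
Proof.
rewrite adjmxE kmx_dual kmxM !kmx_dual kmxZ; apply: eq_kmx => z y.
case: (d x y =P j) => [xy|_]; last by rewrite !mulr0.
have := sum_neighbours (fun i => (i == j.+1)%:R) y x.
rewrite (gdistC y) xy /= eqxx (_ : (j.-1 == j.+1) = false) ?mulr0 ?add0r ?mulr1; last by lia.
move=> <-; apply: eq_bigr => t _.
by rewrite mul1r mulrC (gdistC x t) -!gdist_eq1 (gdistC t y).
Qed.

Lemma raise1 j : E x 1 *m Am j *m E x j.+1 *m A *m E x j.+2
  = (c j.+1)%:R *: (E x 1 *m Am j.+1 *m E x j.+2).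
Proof.
have := congr1 trmx (raise_Am x 1%N j).
by rewrite linearZ /= !trmx_mul !dual_tr A_tr !rad_tr !mulmxA.
Qed.

Lemma lower1 i : E x 1 *m Am i.+2 *m E x i.+1 *m A *m E x i
  = (b i.+1)%:R *: (E x 1 *m Am i.+1 *m E x i).
Proof.
have := congr1 trmx (lower_Am x 1%N i); rewrite !addn1.
by rewrite linearZ /= !trmx_mul !dual_tr A_tr !rad_tr !mulmxA.
Qed.

Lemma dual1_Am_dual m j : E x 1 *m Am m *m E x j.+1
  = if m == j then E x 1 *m Am j *m E x j.+1 else
    if m == j.+2 then E x 1 *m Am j.+2 *m E x j.+1 else 0.
Proof.
case: eqP => [->//|n1]; case: eqP => [->//|n2].
rewrite AmE dual_kmx kmx_dual; apply: kmx0 => z y.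
case: (d x z =P 1%N) => [xz|_]; last by rewrite !mul0r.
case: (d x y =P j.+1) => [xy|_]; last by rewrite mulr0.
case: (d z y =P m) => [zy|_]; last by rewrite mulr0 mul0r.
have h1 := gdist_triangle z x y; have h2 := odd_gdistD z x y.
have h3 := gdist_triangle x z y; rewrite (gdistC z x) xz xy zy in h1 h2 h3.
lia.
Qed.

Lemma dual1_Am_sum j : E x 1 *m Am j *m E x j.+1 + E x 1 *m Am j.+2 *m E x j.+1
  = E x 1 *m J *m E x j.+1.
Proof.
rewrite !AmE !dual_kmx !kmx_dual kmxD; apply: eq_kmx => z y.
case: (d x z =P 1%N) => [xz|_]; last by rewrite !mul0r addr0.
case: (d x y =P j.+1) => [xy|_]; last by rewrite !mulr0 addr0.
have h1 := gdist_triangle z x y; have h2 := odd_gdistD z x y.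
have h3 := gdist_triangle x z y; rewrite (gdistC z x) xz xy in h1 h2 h3.
rewrite !mul1r !mulr1; case: (d z y =P j) => [->|n1].
  have -> : (j == j.+2) = false by lia.
  by rewrite addr0.
have -> : (d z y == j.+2) by lia.
by rewrite add0r.
Qed.

Lemma dual0_adj_dual1 : E x 0 *m A = E x 0 *m A *m E x 1.
Proof.
rewrite adjmxE dual_kmx kmx_dual; apply: eq_kmx => z y.
case: (d x z =P 0%N) => [/eqP|_]; last by rewrite !mul0r.
rewrite gdist_eq0 => /eqP <-; rewrite !mul1r -gdist_eq1.
by case: (d x y == 1%N); rewrite ?mulr1 ?mulr0.
Qed.

(** By the raising and lowering identities, A maps into itself the space
    spanned by the columns of the matrices E_j J and E_j A_m E_1. *)
Lemma low_orth_adj u : low_orth u -> low_orth (A *m u).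
Proof.
case=> k1 k2; have hJ j : J *m (E x j *m (A *m u)) = 0.
  case: j => [|j].
    rewrite mulmxA (mulmxA _ A) -(mulmxA J) dual0_adj_dual1 !mulmxA J_dual_up.
    by rewrite -scalemxAl -mulmxA k1 scaler0.
  rewrite mulmxA (mulmxA _ A) -(mulmxA J) dual_adj mulmxDr mulmxDl !mulmxA.
  by rewrite J_dual_up J_dual_down -!scalemxAl -!mulmxA !k1 !scaler0 addr0.
split=> // j m; case: j => [|j].
  have := hJ 0%N; set y := E x 0 *m (A *m u) => Jy.
  have -> : y = 0; last by rewrite mulmx0.
  apply: colP_rank => z; rewrite /y dual_mulv [RHS]mxE.
  case: (d x z =P 0%N) => [xz|_]; last by rewrite mul0r.
  have /eqP := xz; rewrite gdist_eq0 => /eqP <-.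
  have := congr1 (fun w : 'cV[C]_#|X| => w (enum_rank x) 0) Jy.
  rewrite kmx_mulv [RHS]mxE (bigD1 x) //= big1 ?addr0 => [|t].
    by rewrite /y dual_mulv gdistxx eqxx mul1r.
  by rewrite eq_sym -gdist_eq0 /y dual_mulv => /negbTE->; rewrite mul0r mulr0.
rewrite !mulmxA dual1_Am_dual.
have e1 : E x 1 *m Am j *m E x j.+1 *m A *m u = 0.
  have eJ : E x 1 *m J *m E x j.+1 *m A *m E x j = (b j)%:R *: (E x 1 *m J *m E x j).
    by have := congr1 (mulmx (E x 1)) (J_dual_down j); rewrite -scalemxAr !mulmxA.
  rewrite -(mulmxA _ (E x j.+1) A) dual_adj mulmxDr mulmxDl !mulmxA raise1.
  have -> : E x 1 *m Am j *m E x j.+1 = E x 1 *m J *m E x j.+1 - E x 1 *m Am j.+2 *m E x j.+1.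
    by rewrite -dual1_Am_sum addrK.
  rewrite mulmxBl2 eJ lower1; apply: mulmx_comb_eq0; rewrite -(mulmxA _ (E x _) u).
  - exact: k2.
  - by rewrite -(mulmxA (E x 1)) k1 mulmx0.
  exact: k2.
case: eqP => _; first exact: e1.
case: eqP => _; last by rewrite !mul0mx.
have -> : E x 1 *m Am j.+2 *m E x j.+1 = E x 1 *m J *m E x j.+1 - E x 1 *m Am j *m E x j.+1.
  by rewrite -dual1_Am_sum [X in _ = X - _]addrC addrK.
rewrite mulmxBl2 e1 subr0.
have -> : E x 1 *m J *m E x j.+1 *m A *m u = E x 1 *m (J *m (E x j.+1 *m (A *m u))).
  by rewrite !mulmxA.
by rewrite hJ mulmx0.
Qed.

Lemma low_orth_dual i u : low_orth u -> low_orth (E x i *m u).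
Proof.
case=> k1 k2; split=> [j|j m]; rewrite (mulmxA (E x j)) dual_mul.
  by case: eqP => _; rewrite ?mul0mx ?mulmx0.
by case: eqP => _; rewrite ?mul0mx ?mulmx0.
Qed.

Lemma low_orth_U v : inU x v -> low_orth v.
Proof.
move=> Uv; have [e2 _] := Uv.
have h j : E x j *m v = if j == 2%N then v else 0.
  by rewrite -{1}e2 mulmxA dual_mul; case: eqP => [->//|_]; rewrite mul0mx.
split=> [j|j m]; rewrite h; case: eqP => _; rewrite ?mulmx0 //; first exact: (U_J Uv).
exact: (U_rad1 (fun i => (i == m)%:R) Uv).
Qed.

Lemma low_orth_vanish u : low_orth u -> E x 0 *m u = 0 /\ E x 1 *m u = 0.
Proof.
case=> k1 k2; split; last by have := k2 1%N 0%N; rewrite Am0 mulmx1 mulmxA dual_idem2.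
apply: colP_rank => z; rewrite dual_mulv [RHS]mxE.
case: (d x z =P 0%N) => [/eqP|_]; last by rewrite mul0r.
rewrite gdist_eq0 => /eqP <-.
have := congr1 (fun w : 'cV[C]_#|X| => w (enum_rank x) 0) (k1 0%N).
rewrite kmx_mulv [RHS]mxE (bigD1 x) //= big1 ?addr0 => [|t].
  by rewrite dual_mulv gdistxx eqxx mul1r.
by rewrite eq_sym -gdist_eq0 dual_mulv => /negbTE->; rewrite mul0r mulr0.
Qed.

Definition low_orth_space : {vspace 'cV[C]_#|X|} :=
  (\bigcap_(j < D.+1) lker (linfun (mulmx (J *m E x j)))
   :&: \bigcap_(p : 'I_D.+1 * 'I_D.+1) lker (linfun (mulmx (E x 1 *m Am p.2 *m E x p.1))))%VS.

Lemma low_orth_spaceP u : reflect (low_orth u) (u \in low_orth_space).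
Proof.
have big_vec (I : finType) (M : I -> 'M[C]_#|X|) :
    (u \in \bigcap_i lker (linfun (mulmx (M i))))%VS = [forall i, M i *m u == 0].
  rewrite memvE; apply/subv_bigcapP/forallP => h i; last move=> _.
    by have := h i isT; rewrite -memvE memv_ker lfunE.
  by rewrite -memvE memv_ker lfunE; apply: h.
rewrite memv_cap !big_vec; apply: (iffP andP) => [[/forallP h1 /forallP h2]|[k1 k2]].
  split=> [j|j m].
    have [jD|jD] := leqP j D; last by rewrite dual_big // mul0mx mulmx0.
    by have /eqP := h1 (Ordinal (jD : (j < D.+1)%N)); rewrite -mulmxA.
  have [jD|jD] := leqP j D; last by rewrite (@dual_big x j) // mul0mx mulmx0.
  have [mD|mD] := leqP m D; last by rewrite Am_big // mulmx0 mul0mx.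
  by have /eqP := h2 (Ordinal (jD : (j < D.+1)%N), Ordinal (mD : (m < D.+1)%N)); rewrite -mulmxA.
by split; apply/forallP => p; rewrite -mulmxA ?k1 ?k2.
Qed.

Lemma Tmodule_low_orth : Tmodule adj x low_orth_space.
Proof.
move=> B; elim=> [|i _||B1 B2 _ IH1 _ IH2|a B1 _ IH|B1 B2 _ IH1 _ IH2] w wK.
- by apply/low_orth_spaceP/low_orth_adj/low_orth_spaceP.
- by apply/low_orth_spaceP/low_orth_dual/low_orth_spaceP.
- by rewrite mul1mx.
- by rewrite mulmxDl rpredD ?IH1 ?IH2.
- by rewrite -scalemxAl rpredZ ?IH.
- by rewrite -mulmxA IH1 ?IH2.
Qed.

Lemma terw_ctr B : T B -> T (map_mx Num.conj B)^T.
Proof.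
elim=> [|i iD||B1 B2 _ IH1 _ IH2|a B1 _ IH|B1 B2 _ IH1 _ IH2].
- by rewrite conj_A A_tr; apply: Terw_adj.
- by rewrite conj_dual dual_tr; apply: Terw_dual.
- by rewrite map_mx1 trmx1; apply: Terw_one.
- by rewrite map_mxD linearD; apply: Terw_add.
- by rewrite map_mxZ linearZ; apply: Terw_scale.
- by rewrite map_mxM trmx_mul; apply: Terw_mul.
Qed.

(** T is closed under conjugate transposition. *)
Lemma Tmodule_perp W : Tmodule adj x W -> Tmodule adj x (perp W).
Proof.
move=> TW B TB u /perpP up; apply/perpP => w wW.
have := up _ (TW _ (terw_ctr TB) _ wW).
rewrite trmx_mul trmxK map_mxM.
have -> : map_mx Num.conj (map_mx Num.conj B) = B by apply/matrixP => i j; rewrite !mxE conjCK.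
by rewrite mulmxA.
Qed.

Lemma Tmodule_cap (W W' : {vspace 'cV[C]_#|X|}) : Tmodule adj x W -> Tmodule adj x W' -> Tmodule adj x (W :&: W').
Proof.
move=> TW TW' B TB u; rewrite !memv_cap => /andP[uW uW'].
by rewrite TW ?TW'.
Qed.

End LowOrth.

Section Cover.
Hypothesis cover : antipodal_2_cover adj.

(** Prolong a geodesic from z to y until length D: it ends at the unique
    antipode of z. *)
Lemma cover_dist y z z' : d z z' = D -> d y z' = (D - d z y)%N.
Proof.
move=> zz'; have [|w zw <-] := @exists_gdist_from z y D; first by rewrite gdist_diameter leqnn.
by have [t [_ tu]] := cover z; rewrite -(tu _ zz') (tu _ zw).
Qed.

(** The sums of v around a vertex at distance D - 1 from x are those around
    its antipode, which is a neighbour of x, where they vanish. *)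
Lemma cover_U_vanish x v m : inU x v -> E x D.-1 *m Am m *m v = 0.
Proof.
move=> Uv; have [mD|mD] := leqP m D; last by rewrite Am_big // mulmx0 mul0mx.
apply: colP_rank => z; rewrite -mulmxA dual_mulv [RHS]mxE.
case: (d x z =P D.-1) => [xz|_]; last by rewrite mul0r.
have [z' [zz' _]] := cover z.
have xz' : d x z' = 1%N by rewrite (cover_dist x zz') gdistC xz; lia.
have := congr1 (fun w : 'cV[C]_#|X| => w (enum_rank z') 0)
   (U_rad1 (fun i => (i == D - m)%N%:R) Uv).
rewrite -mulmxA dual_mulv xz' eqxx [RHS]mxE !mul1r => e; rewrite -[RHS]e.
rewrite !kmx_mulv; apply: eq_bigr => y _; congr (_%:R * _).
rewrite (gdistC z') (cover_dist y zz'); have := gdist_diameter z y; lia.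
Qed.

(** In a thin module the vectors E_i A_m v span at most a line for each i; the
    lines i = 0, 1 and i = D - 1 are zero. This is the situation of
    small_module_vanish. *)
Lemma thin_U_vanish x W v : Tmodule adj x W -> thin adj x W -> v \in W -> inU x v ->
  E x 2 *m cosmx (cosine (th_ 1)) *m (E x 2 *m cosmx (cosine (th_ dd)) *m v) = 0.
Proof.
move=> TW thW vW Uv.
(* In a thin module any nonzero vector of degree i spans the whole degree. *)
pose e i := if [|| i == 0, i == 1 | i == D.-1]%N then 0 else vpick (dual_image adj x i W).
have [|||| th nt Fv] := @small_module_vanish x v e.
- move=> m i; rewrite /e; case: ifP => [/or3P[]/eqP->|_].
  + by exists 0; rewrite U_rad0 // scaler0.
  + by exists 0; rewrite U_rad1 // scaler0.
  + by exists 0; rewrite cover_U_vanish // scaler0.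
  have [iD|iD] := leqP i D; last by exists 0; rewrite dual_big // !mul0mx scale0r.
  have h : E x i *m Am m *m v \in dual_image adj x i W.
    rewrite -mulmxA -[E x i *m _]/(mulmx (E x i) _) -(lfunE (mulmx (E x i))).
    by apply/memv_img/TW => //; apply: terw_Am.
  set Y := dual_image adj x i W in h *.
  have [z|nz] := eqVneq Y 0%VS.
    by exists 0; move: h; rewrite z memv0 scale0r => /eqP.
  have /vlineP[a ->] : E x i *m Am m *m v \in <[vpick Y]>%VS.
    suff -> : <[vpick Y]>%VS = Y by [].
    apply/eqP; rewrite eqEdim -memvE memv_pick dim_vline vpick0 nz /=.
    exact: thW.
  by exists a.
- by [].
- by [].
- by rewrite /e eqxx !orbT.
apply: (@extremal_vanish x th (cosine th)) => //.
exact/eig_cosine/nontriv_eig.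
Qed.

(** Decompose the module of all vectors orthogonal to the modules of endpoint
    0 and 1 by splitting off submodules and their complements; the components
    of a vector of U are in U again. An irreducible component that meets U has
    endpoint 2, hence is thin. *)
Lemma two_thin_U_vanish x : two_thin R adj x -> forall v, inU x v ->
  E x 2 *m cosmx (cosine (th_ 1)) *m (E x 2 *m cosmx (cosine (th_ dd)) *m v) = 0.
Proof.
move=> thin2.
suff h n (M : {vspace 'cV[C]_#|X|}) : (\dim M <= n)%N -> (M <= low_orth_space x)%VS ->
    Tmodule adj x M -> forall v, v \in M -> inU x v ->
    E x 2 *m cosmx (cosine (th_ 1)) *m (E x 2 *m cosmx (cosine (th_ dd)) *m v) = 0.
  move=> v Uv; apply: (h _ _ (leqnn _) (subvv _) (@Tmodule_low_orth x)) => //.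
  exact/low_orth_spaceP/low_orth_U.
elim: n M => [|n IH] M dM MK TM v vM Uv.
  have : v \in 0%VS by rewrite -(eqP (_ : M == 0%VS)) // -dimv_eq0; lia.
  by rewrite memv0 => /eqP->; rewrite !mulmx0.
have [->|v0] := eqVneq v 0; first by rewrite !mulmx0.
have Mn0 : M <> 0%VS by move=> z; rewrite z memv0 (negbTE v0) in vM.
have [[M' [sM' TM' M'0 M'M]]|irr] :=
  boolp.EM (exists M', [/\ (M' <= M)%VS, Tmodule adj x M', M' <> 0%VS & M' <> M]).
  have dM' : (\dim M' < \dim M)%N.
    by rewrite ltn_neqAle dimvS // andbT; apply/eqP => e; apply: M'M; apply/eqP; rewrite eqEdim sM' e leqnn.
  (* The complement of the submodule; both parts are smaller than M. *)
  pose N := (M :&: perp M')%VS.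
  have TN : Tmodule adj x N by apply: Tmodule_cap => //; apply: Tmodule_perp.
  have dN : (\dim N < \dim M)%N.
    rewrite ltn_neqAle dimvS ?capvSl // andbT; apply/eqP => e.
    have NM : N = M by apply/eqP; rewrite eqEdim capvSl e leqnn.
    apply: M'0; apply/eqP; rewrite -subv0 -(perp_cap M') subv_cap subvv /=.
    by apply: subv_trans sM' _; rewrite -NM capvSr.
  have /memv_addP[v1 v1M [v2 v2P ev]] : v \in (M' + perp M')%VS by rewrite perp_add memvf.
  have v2N : v2 \in N.
    rewrite memv_cap v2P andbT; have -> : v2 = v - v1 by rewrite ev addrC addKr.
    by rewrite rpredB // (subvP sM').
  have split0 B : terwilliger (R := R) adj x B -> B *m v = 0 -> B *m v1 = 0 /\ B *m v2 = 0.
    move=> TB; rewrite ev mulmxDr => /eqP; rewrite addr_eq0 => /eqP e.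
    have z : B *m v1 = 0.
      apply/eqP; rewrite -memv0 -(perp_cap M') memv_cap TM' //= e rpredN.
      exact: (Tmodule_perp TM' TB v2P).
    by split=> //; apply/eqP; rewrite -oppr_eq0 -e z.
  have [e2 e1] := Uv.
  have [||a1 a2] := split0 (E x 2 + (-1) *: 1%:M).
    by apply: Terw_add; [apply: terw_dual|apply: Terw_scale; apply: Terw_one].
    by rewrite mulmxDl -scalemxAl mul1mx e2 scaleN1r subrr.
  have [|c1 c2] := split0 (E x 1 *m A) _ e1.
    by apply: Terw_mul; [apply: terw_dual|apply: Terw_adj].
  have fix2 w : (E x 2 + (-1) *: 1%:M) *m w = 0 -> E x 2 *m w = w.
    by rewrite mulmxDl -scalemxAl mul1mx scaleN1r => /eqP; rewrite subr_eq0 => /eqP.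
  have U1 : inU x v1 by split; [apply: fix2|].
  have U2 : inU x v2 by split; [apply: fix2|].
  rewrite ev !mulmxDr (IH M') ?(IH N) ?addr0 //.
  - by rewrite -ltnS; apply: leq_trans dN dM.
  - by apply: subv_trans MK; apply: capvSl.
  - by rewrite -ltnS; apply: leq_trans dM' dM.
  - exact: subv_trans MK.
have irrM : irreducible_Tmodule adj x M.
  split=> // M' sM' TM'.
  have [->|/eqP n0] := eqVneq M' 0%VS; first by left.
  have [->|/eqP nM] := eqVneq M' M; first by right.
  by case: irr; exists M'.
have ep : has_endpoint adj x M 2.
  split=> [z|[|[|//]] _].
  - suff : v \in dual_image adj x 2 M by rewrite z memv0 (negbTE v0).
    have [e2 _] := Uv; rewrite -{1}e2 -[E x 2 *m v]/(mulmx (E x 2) v) -(lfunE (mulmx (E x 2))).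
    exact: memv_img.
  - apply/eqP; rewrite -subv0; apply/subvP => _ /memv_imgP[w wM ->].
    have /low_orth_spaceP/low_orth_vanish[h _] := subvP MK _ wM.
    by rewrite lfunE memv0 /= h.
  - apply/eqP; rewrite -subv0; apply/subvP => _ /memv_imgP[w wM ->].
    have /low_orth_spaceP/low_orth_vanish[_ h] := subvP MK _ wM.
    by rewrite lfunE memv0 /= h.
exact: thin_U_vanish (thin2 _ irrM ep) vM Uv.
Qed.

(** The trace of trace_defect is computed on U. *)
Lemma two_thin_defect x : two_thin R adj x -> defect (th_ 1) (th_ dd) = 0.
Proof.
move=> h; apply: (@defect_of_U x _ _ _ _ cosine1 cosined nontriv1 nontrivd).
exact: two_thin_U_vanish.
Qed.

End Cover.

(** * Two-homogeneity and the tautness equation *)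

Section HomogCount.
Local Open Scope nat_scope.
Variables (x y z : X).

Lemma common_card : d x y = 2 -> #|[set r | adj x r & d r y == 1]| = c 2.
Proof. by move=> xy2; have := card_closer x y; rewrite xy2. Qed.

Lemma homog_count_closer i : d x y = 2 -> d x z = i.+2 -> d y z = i ->
  two_homog_count adj i.+2 x y z = c 2.
Proof.
move=> xy xz yz; rewrite -(common_card xy); apply: eq_card => r; rewrite !inE gdistC gdist_eq1.
case xr : (adj x r) => //=; case: eqP => //= ry.
have := gdist_adj_cases z xr; rewrite !(gdistC z) xz.
by have := gdist_triangle r y z; rewrite ry yz; lia.
Qed.

Lemma homog_count_farther i : d x z = i -> d y z = i.+2 ->
  two_homog_count adj i x y z = 0.
Proof.
move=> xz yz; apply: eq_card0 => r; rewrite inE; apply/negP => /and3P[_ /eqP ry /eqP rz].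
by have := gdist_triangle y r z; rewrite (gdistC y r) ry yz rz; lia.
Qed.

End HomogCount.

(** The count of the definition of two-homogeneity as a function of y, for
    fixed x and z, is a combination of neighbourhoods of neighbours of x; this
    makes it orthogonal to U. *)
Lemma homog_countE j x y z : (two_homog_count adj j x y z)%:R
  = \sum_r (adj x r)%:R * (d r z == j.-1)%:R * (adj r y)%:R :> C.
Proof.
rewrite /two_homog_count -sum1_card natr_sum big_mkcond; apply: eq_bigr => r _.
rewrite !inE (gdistC r x) !gdist_eq1.
by case: (adj x r); case: (adj r y); case: (d r z == _); rewrite ?(mul0r, mulr0, mulr1).
Qed.

Lemma homog_count_orth x v j z : inU x v ->
  \sum_y (two_homog_count adj j x y z)%:R * v (enum_rank y) 0 = 0.
Proof.
case=> _ e1.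
transitivity (\sum_r (d r z == j.-1)%:R * (E x 1 *m A *m v) (enum_rank r) 0).
  under eq_bigr => y _ do rewrite homog_countE mulr_suml.
  rewrite exchange_big; apply: eq_bigr => r _.
  rewrite -mulmxA dual_mulv gdist_eq1 adjmxE kmx_mulv !mulr_sumr.
  by apply: eq_bigr => y _; ring.
by rewrite big1 // => r _; rewrite e1 mxE mulr0.
Qed.

Lemma U_supp x v y : inU x v -> v (enum_rank y) 0 = (d x y == 2)%:R * v (enum_rank y) 0.
Proof. by case=> e2 _; rewrite -{1}e2 dual_mulv. Qed.

(** The count takes the value c_2 at vertices nearer to z than x is, and 0 at
    vertices farther from z; on the others it is constant by assumption. *)
Lemma homog_count_relation x v j z (g : nat) : inU x v -> d x z = j.+2 ->
  (forall y, d x y = 2 -> d y z = j.+2 -> two_homog_count adj j.+2 x y z = g) ->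
  (c 2)%:R * (Am j *m v) (enum_rank z) 0 + g%:R * (Am j.+2 *m v) (enum_rank z) 0 = 0.
Proof.
move=> Uv xz hg; rewrite -[RHS](homog_count_orth j.+2 z Uv) !kmx_mulv !mulr_sumr -big_split.
apply: eq_bigr => y _ /=; rewrite (U_supp y Uv).
case: (d x y =P 2) => [xy|_]; last by rewrite !mul0r !mulr0 addr0.
rewrite mul1r !mulrA -mulrDl; congr (_ * _).
have := gdist2_cases z xy; rewrite !(gdistC z) xz => -[yz|yz|[yz]].
- rewrite (homog_count_farther xz yz) yz.
  have -> : (j.+4 == j) = false by lia.
  have -> : (j.+4 == j.+2) = false by lia.
  by rewrite !mulr0 addr0.
- rewrite (hg y xy yz) yz eqxx.
  have -> : (j.+2 == j) = false by lia.
  by rewrite mulr0 add0r mulr1.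
rewrite (homog_count_closer xy xz (esym yz)) -yz eqxx.
have -> : (j == j.+2) = false by lia.
by rewrite mulr0 addr0 mulr1.
Qed.

Section TwoHomogeneous.
Hypothesis hom2 : two_homogeneous adj.

Let triple i (t : X * X * X) :=
  [&& d t.1.1 t.1.2 == 2, d t.1.1 t.2 == i & d t.1.2 t.2 == i].
(** The common value of the counts, read off from an arbitrary triple. *)
Definition homog_const i :=
  if [pick t | triple i t] is Some t then two_homog_count adj i t.1.1 t.1.2 t.2 else 0%N.

Lemma homog_constE i x y z : (1 <= i <= D.-1)%N -> d x y = 2 -> d x z = i -> d y z = i ->
  two_homog_count adj i x y z = homog_const i.
Proof.
move=> iD xy xz yz; rewrite /homog_const; case: pickP => [[[x' y'] z'] /=|/(_ (x, y, z))].
  by move=> /and3P[/eqP e1 /eqP e2 /eqP e3]; apply: (hom2 iD).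
by rewrite /triple /= xy xz yz !eqxx.
Qed.

(** Two neighbours x, y of a vertex r at distance D from z are at distance D -
    1 from z, and r is a common neighbour that is not counted. *)
Lemma homog_const_last : (homog_const D.-1 < c 2)%N.
Proof.
have [r [z rz]] := exists_diameter.
have /card_gt1P[x [y [xI yI xy]]] : (1 < #|[set t | adj r t]|)%N.
  by rewrite card_neighbours; lia.
rewrite !inE in xI yI.
have far t : adj r t -> d t z = D.-1.
  move=> rt; have := gdist_adj_cases z rt; rewrite !(gdistC z) rz.
  by have := gdist_diameter t z; lia.
have rx : d x r = 1%N by apply/eqP; rewrite gdist_eq1 adjC.
have xy2 : d x y = 2.
  have := gdist_adj_cases x yI; rewrite rx; case=> // -[/esym/eqP].
  by rewrite gdist_eq0 (negbTE xy).
rewrite -(@homog_constE D.-1 x y z) ?far //; last by lia.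
rewrite -(common_card xy2).
apply/proper_card/properP; split; last first.
  by exists r; rewrite !inE ?rz; [rewrite -gdist_eq1 rx gdist_eq1 yI|lia].
by apply/subsetP => t; rewrite !inE => /and3P[tx ty _]; rewrite -gdist_eq1 gdistC tx.
Qed.

Section Small.
Variables (x : X) (v : 'cV[C]_#|X|).
Hypothesis Uv : inU x v.
Local Notation vm j := (E x j.+2 *m Am j *m v).
Local Notation vp j := (E x j.+2 *m Am j.+4 *m v).

Lemma U_mid j : E x j.+2 *m Am j.+2 *m v = - vm j - vp j.
Proof.
rewrite -[Am j.+2]/(rad (fun i => (i == j.+2)%:R)) (U_rad _ j Uv) eqxx.
have -> : (j == j.+2) = false by lia.
have -> : (j.+4 == j.+2) = false by lia.
by rewrite sub0r scaleN1r subr0 scale1r.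
Qed.

Lemma homog_vec j : (j.+2 <= D.-1)%N ->
  ((c 2)%:R - (homog_const j.+2)%:R) *: vm j = (homog_const j.+2)%:R *: vp j.
Proof.
move=> jD.
have : (c 2)%:R *: vm j + (homog_const j.+2)%:R *: (E x j.+2 *m Am j.+2 *m v) = 0.
  apply: colP_rank => z; rewrite lin2_entry [RHS]mxE -!mulmxA !dual_mulv.
  case: (d x z =P j.+2) => [xz|_]; last by rewrite !mul0r !mulr0 addr0.
  rewrite !mul1r; apply: (homog_count_relation Uv xz) => y xy yz.
  exact: homog_constE.
rewrite U_mid; move: (vm j) (vp j) => w w' h.
apply/eqP; rewrite -subr_eq0 -h; apply/eqP/colP => i; rewrite !mxE; ring.
Qed.

(** A generator of the line spanned by the E_i A_m v; the line vanishes for i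
    = D - 1 because of homog_const_last. *)
Definition homog_basis i :=
  if [|| i == 0, i == 1 | i == D.-1]%N then 0
  else if (i == D) || (homog_const i != 0%N) then E x i *m Am i.-2 *m v
  else E x i *m Am i.+2 *m v.

Lemma homog_basisP m i : exists a, E x i *m Am m *m v = a *: homog_basis i.
Proof.
rewrite /homog_basis; case: i => [|[|j]]; first by exists 0; rewrite U_rad0 // scaler0.
  by exists 0; rewrite U_rad1 // scaler0.
rewrite -/(homog_basis j.+2).
suff [a [b' [ea eb]]] : exists a b', vm j = a *: homog_basis j.+2 /\ vp j = b' *: homog_basis j.+2.
  rewrite -[Am m]/(rad (fun i => (i == m)%:R)) (U_rad _ j Uv) ea eb !scalerA -scalerBl.
  by eexists.
rewrite /homog_basis /=; have [jD|] := ltnP D j.+2.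
  by exists 0, 0; rewrite dual_big // !mul0mx !scale0r.
rewrite leq_eqVlt => /orP[/eqP e|jD].
  have -> : (j.+2 == D.-1) = false by lia.
  rewrite e eqxx /=; exists 1, 0; rewrite scale1r scale0r (@Am_big D.+2) ?mulmx0 ?mul0mx //; lia.
have h : (j.+2 <= D.-1)%N by lia.
have := homog_vec h; have -> : (j.+2 == D) = false by lia.
have c20 : (c 2)%:R != 0 :> C by rewrite pnatr_eq0 -lt0n c_num_gt0 //; lia.
have [e|ne] := eqVneq j.+2 D.-1.
  have -> : vp j = 0 by rewrite Am_big ?mulmx0 ?mul0mx //; lia.
  move/eqP; rewrite scaler0 scaler_eq0 subr_eq0 eqr_nat => /orP[/eqP g|/eqP->].
    by have := homog_const_last; rewrite -e g ltnn.
  by exists 0, 0; rewrite scale0r.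
rewrite /=; have [->|g0] := eqVneq (homog_const j.+2) 0%N.
  rewrite subr0 scale0r => /eqP; rewrite scaler_eq0 (negbTE c20) => /eqP->.
  by exists 0, 1; rewrite scale0r scale1r.
have gC : (homog_const j.+2)%:R != 0 :> C by rewrite pnatr_eq0.
move=> e; exists 1, ((homog_const j.+2)%:R^-1 * ((c 2)%:R - (homog_const j.+2)%:R)).
by rewrite scale1r -scalerA e scalerA (mulVf gC) scale1r.
Qed.

Lemma homog_U_vanish :
  E x 2 *m cosmx (cosine (th_ 1)) *m (E x 2 *m cosmx (cosine (th_ dd)) *m v) = 0.
Proof.
have [|||th nt Fv] := @small_module_vanish x v homog_basis homog_basisP.
- by [].
- by [].
- by rewrite /homog_basis eqxx !orbT.
by apply: (@extremal_vanish x th (cosine th)) => //; exact/eig_cosine/nontriv_eig.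
Qed.

End Small.

Lemma two_homogeneous_defect : defect (th_ 1) (th_ dd) = 0.
Proof.
have [x _] := exists_diameter.
apply: (@defect_of_U x _ _ _ _ cosine1 cosined nontriv1 nontrivd).
exact: homog_U_vanish.
Qed.

End TwoHomogeneous.

Section DeltaZero.
Hypotheses (d0 : defect (th_ 1) (th_ dd) = 0) (Delta0 : Delta R adj = 0).

(** If the discriminant vanishes, the tautness equation says that one of two
    factors is 0; that with theta_d is positive since theta_d^2 < b_2 and c_2
    + 2 <= k. *)
Lemma defect11 : defect (th_ 1) (th_ 1) = 0.
Proof.
have lt : 0 < (b 2)%:R * ((valency adj)%:R - 2) - ((c 2)%:R - 1) * th_ dd ^+ 2 :> R.
  have c1 : 1 <= (c 2)%:R :> R by rewrite ler1n c_num_gt0 //; lia.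
  have ck : (c 2)%:R + 2 <= (valency adj)%:R :> R.
    by rewrite -natrD ler_nat addn2 c2_lt_k.
  have := thetad_b2; have b0 : 0 < (b 2)%:R :> R by rewrite ltr0n b_num_gt0 //; lia.
  move: (b 2)%:R (valency adj)%:R (c 2)%:R (th_ dd) c1 ck b0 => bb kk cc t *; nra.
have b30 : (b 3)%:R != 0 :> R by rewrite pnatr_eq0 -lt0n b_num_gt0 //; lia.
move: d0; rewrite /defect Delta0 !mulr0 !mul0r !subr0 => /eqP.
rewrite mulf_eq0 (gt_eqF lt) orbF mulf_eq0 (negbTE b30) /= => /eqP->.
by rewrite mulr0.
Qed.

(** The product F_1 P F_1 vanishes by defect11, so that F_1 E_2 F_1 v = 0, and
    E_2 F_1 v has norm 0. *)
Lemma theta1_kills_U x v : inU x v -> cosmx (cosine (th_ 1)) *m v = 0.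
Proof.
move=> Uv; set F := cosmx _; set w := E x 2 *m F *m v.
have Fw : F *m w = 0.
  rewrite /w -(proj_U_id (U_stable (toC (cosine (th_ 1))) Uv)) -!mulmxA (mulmxA (proj_U x) (E x 2)) proj_U_dual2.
  by rewrite !mulmxA (defect_cosmx_proj_cosmx x cosine1 cosine1 defect11) mul0mx.
apply: (cosmx_eq0 (x := x) cosine1); first by case: Uv.
apply: dot_eq0; have [w2 _] := U_stable (toC (cosine (th_ 1))) Uv.
rewrite -/w in w2 *.
have -> : map_mx Num.conj w^T *m w = map_mx Num.conj (F *m w)^T *m v.
  have eE : map_mx Num.conj w^T = map_mx Num.conj w^T *m E x 2.
    by rewrite -{1}w2 trmx_mul map_mxM dual_tr conj_dual.
  rewrite (trmx_mul F w) map_mxM cosmx_tr conj_cosmx -/F {2}eE -!mulmxA.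
  by rewrite {2}/w -mulmxA.
by rewrite Fw trmx0 map_mx0 mul0mx mxE.
Qed.

Section Interior.
Variables (x z : X) (j : nat).
Hypotheses (xz : d x z = j.+2) (jD : (j.+4 <= D)%N).

Let t0 := gap (cosine (th_ 1)) j.
Let t2 := gap (cosine (th_ 1)) j.+2.

Let q l : C := t0%:C * (l == j)%:R - t2%:C * (l == j.+4)%:R.
Let h y : C := (two_homog_count adj j.+2 x y z)%:R.

(** The relation given by F_1 v = 0 on all of U, read as orthogonality of a
    function of the distance to z. *)
Lemma q_orth v : inU x v -> \sum_y q (d y z) * v (enum_rank y) 0 = 0.
Proof.
move=> Uv; have := cosmx_rel cosine1 Uv (theta1_kills_U Uv) xz.
rewrite !kmx_mulv => e.
transitivity (t0%:C * (\sum_y (d z y == j)%N%:R * v (enum_rank y) 0)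
     - t2%:C * (\sum_y (d z y == j.+4)%N%:R * v (enum_rank y) 0)); last by rewrite e subrr.
rewrite !mulr_sumr -sumrB; apply: eq_bigr => y _; rewrite /q !(gdistC z); ring.
Qed.

(** A neighbour of a neighbour r of x is x or at distance 2 from x. *)
Lemma sum_second f r : adj x r ->
  \sum_y (adj r y)%:R * ((d x y == 2)%:R * f y) = \sum_y (adj r y)%:R * f y - f x :> C.
Proof.
move=> xr; have rx : adj r x by rewrite adjC.
rewrite (bigD1 x) //= [in RHS](bigD1 x) //= gdistxx rx /= mul0r mulr0 add0r mul1r [RHS]addrC addKr.
apply: eq_bigr => y yx; case ry : (adj r y); last by rewrite !mul0r.
suff -> : d x y = 2 by rewrite eqxx mul1r.
have := gdist_adj_cases x ry; have /eqP-> : d x r == 1 by rewrite gdist_eq1.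
by case=> // -[/esym/eqP]; rewrite gdist_eq0 eq_sym (negbTE yx).
Qed.

Lemma h_sum r : adj x r -> \sum_y (adj r y)%:R * ((d x y == 2)%:R * h y)
  = (c j.+2)%:R * ((c 2)%:R - 1) + (d r z == j.+1)%:R * ((valency adj)%:R - (c 2)%:R).
Proof.
move=> xr.
have e r' : adj x r' -> \sum_y (adj r y)%:R * ((d x y == 2)%:R * (adj r' y)%:R)
   = ((c 2)%:R - 1) + (r' == r)%:R * ((valency adj)%:R - (c 2)%:R) :> C.
  move=> xr'; rewrite sum_second // (adjC r') xr'.
  under eq_bigr => y _ do rewrite (adjC r') -(gdist_eq1 y r').
  rewrite (sum_neighbours (fun l => (l == 1%N)%:R)).
  have [->|ne] := eqVneq r' r.
    by rewrite gdistxx c_num0 /= mul0r add0r mulr1 mul1r /valency; ring.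
  have -> : d r r' = 2.
    have rx : d r x = 1%N by apply/eqP; rewrite gdist_eq1 adjC.
    have := gdist_adj_cases r xr'; rewrite rx; case=> // -[/esym/eqP].
    by rewrite gdist_eq0 eq_sym (negbTE ne).
  by rewrite /= mulr1 mulr0 addr0 mul0r addr0.
transitivity (\sum_r' (adj x r')%:R * (d r' z == j.+1)%:R *
   ((c 2)%:R - 1 + (r' == r)%:R * ((valency adj)%:R - (c 2)%:R)) : C).
  under eq_bigr => y _ do rewrite /h homog_countE !mulr_sumr.
  rewrite exchange_big; apply: eq_bigr => r' _ /=.
  case xr' : (adj x r'); last first.
    by rewrite !mul0r big1 // => y _; rewrite !mul0r !mulr0.
  rewrite -e // mulr_sumr; apply: eq_bigr => y _; rewrite mul1r; ring.
under eq_bigr => r' _ do rewrite mulrDr.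
rewrite big_split /= -mulr_suml (sum_neighbours (fun l => (l == j.+1)%:R)) xz /=.
rewrite eqxx mulr1; have -> : (j.+3 == j.+1) = false by lia.
rewrite mulr0 addr0; congr (_ + _).
rewrite (bigD1 r) //= eqxx xr big1 ?addr0 => [|r' /negbTE->]; first by rewrite !mul1r.
by rewrite mul0r mulr0.
Qed.

Lemma q_sum r : adj x r -> \sum_y (adj r y)%:R * ((d x y == 2)%:R * q (d y z))
  = if d r z == j.+1 then t0%:C * (c j.+1)%:R else - (t2%:C * (b j.+3)%:R).
Proof.
move=> xr; rewrite (sum_second (fun y => q (d y z)) xr) xz sum_neighbours.
have rz := gdist_adj_cases z xr; rewrite !(gdistC z) xz in rz.
have n1 m n : (m + n.+1 == m)%N = false by lia.
have n2 m n : (m == m + n.+1)%N = false by lia.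
rewrite /q; have := (n1 j 1%N, n1 j 3%N, n1 j.+1 1%N, n2 j.+2 1%N, n2 j 3%N).
rewrite !addnS !addn0 => ns; case: rz => [->|[<-]] /=; rewrite ?eqxx ?ns /=; ring.
Qed.

(** The function q and the count are both orthogonal to U, and their sums over
    the neighbourhood of a neighbour r of x take two values according to the
    distance from r to z. Some combination of them with the constant function
    therefore lies in U; being orthogonal to U, it vanishes. The values at
    vertices nearer to z and farther from z than x determine the coefficients,
    and q is 0 at the vertices as far from z as x is, which gives the count
    there. *)
Lemma homog_count_interior y : d x y = 2 -> d y z = j.+2 ->
  (t0 + t2)%:C * h y = t2%:C * (c 2)%:R.
Proof.
have conjC_t (a : R) : (a%:C)^*%R = a%:C by exact: conj_realC.
have kc0 : (valency adj)%:R - (c 2)%:R != 0 :> C.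
  have lt := c2_lt_k; rewrite subr_eq0 eqr_nat; apply/eqP => e; lia.
have k10 : (valency adj)%:R - 1 != 0 :> C.
  by rewrite subr_eq0 pnatr_eq1; apply/eqP => e; lia.
(* The sums of q over the neighbourhood of a neighbour r of x, for r nearer to
   z than x and for r farther. *)
pose q1 : C := t0%:C * (c j.+1)%:R; pose q0 : C := - (t2%:C * (b j.+3)%:R).
pose be : C := (q1 - q0) / ((valency adj)%:R - (c 2)%:R).
have beE : be * ((valency adj)%:R - (c 2)%:R) = q1 - q0 by rewrite divfK.
have q1R : q1^*%R = q1 by rewrite /q1 rmorphM /= conjC_t rmorph_nat.
have q0R : q0^*%R = q0 by rewrite /q0 rmorphN rmorphM /= conjC_t rmorph_nat.
have beR : be^*%R = be.
  by rewrite /be fmorph_div rmorphB /= q1R q0R rmorphB /= !rmorph_nat.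
clearbody be.
pose al : C := (q0 - be * ((c j.+2)%:R * ((c 2)%:R - 1))) / ((valency adj)%:R - 1).
have alE : al * ((valency adj)%:R - 1) = q0 - be * ((c j.+2)%:R * ((c 2)%:R - 1)) by rewrite divfK.
have alR : al^*%R = al.
  rewrite /al fmorph_div !(rmorphB, rmorphM) /= beR /q0 rmorphN rmorphM /= conjC_t.
  by rewrite !rmorph1 !rmorph_nat.
clearbody al.
pose phi y : C := q (d y z) - al - be * h y.
pose w : 'cV[C]_#|X| := \col_p ((d x (enum_val p) == 2)%:R * phi (enum_val p)).
have wE t : w (enum_rank t) 0 = (d x t == 2)%:R * phi t by rewrite mxE enum_rankK.
have Uw : inU x w.
  split; apply: colP_rank => r; rewrite -?mulmxA dual_mulv.
    by rewrite wE; case: (d x r == 2); rewrite ?(mul0r, mul1r).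
  rewrite [RHS]mxE; case: (d x r =P 1%N) => [xr|_]; last by rewrite mul0r.
  have xr' : adj x r by rewrite -gdist_eq1 xr.
  rewrite mul1r adjmxE kmx_mulv.
  transitivity (\sum_t (adj r t)%:R * ((d x t == 2)%:R * q (d t z))
     - al * (\sum_t (adj r t)%:R * ((d x t == 2)%:R * 1))
     - be * (\sum_t (adj r t)%:R * ((d x t == 2)%:R * h t))).
    rewrite !mulr_sumr -!sumrB; apply: eq_bigr => t _; rewrite wE /phi; ring.
  rewrite q_sum // h_sum // (sum_second (fun _ => 1)) //.
  have -> : \sum_t (adj r t)%:R * 1 = (valency adj)%:R :> C.
    rewrite -(card_neighbours r) -sum1_card natr_sum [RHS]big_mkcond.
    by apply: eq_bigr => t _; rewrite inE mulr1; case: (adj r t).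
  have q1E : q1 = q0 + be * ((valency adj)%:R - (c 2)%:R) by rewrite beE addrC subrK.
  by rewrite alE; case: ifP => _ /=; rewrite -/q0 -/q1 ?q1E; ring.
have w0 : w = 0.
  apply: dot_eq0; rewrite mxE.
  have qR l : (q l)^*%R = q l by rewrite /q rmorphB !rmorphM /= !conjC_t !rmorph_nat.
  have phiR t : (phi t)^*%R = phi t.
    by rewrite /phi rmorphB /= rmorphB /= qR alR rmorphM /= beR /h rmorph_nat.
  transitivity (\sum_t phi t * w (enum_rank t) 0).
    rewrite -[RHS]sum_enum_val; apply: eq_bigr => p _; rewrite enum_valK !mxE.
    rewrite rmorphM rmorph_nat /= phiR; case: (_ == _); rewrite ?(mul1r, mul0r, mulr0) //.
  transitivity (\sum_t q (d t z) * w (enum_rank t) 0 - al * \sum_t 1 * w (enum_rank t) 0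
      - be * \sum_t h t * w (enum_rank t) 0).
    rewrite !mulr_sumr -!sumrB; apply: eq_bigr => t _; rewrite /phi; ring.
  have eJ : \sum_t 1 * w (enum_rank t) 0 = 0.
    have := congr1 (fun w' : 'cV[C]_#|X| => w' (enum_rank x) 0) (U_J Uw).
    by rewrite kmx_mulv mxE.
  by rewrite q_orth // eJ homog_count_orth // !mulr0 !subr0.
have key t : d x t = 2 -> q (d t z) = al + be * h t.
  move=> xt; have := wE t; rewrite w0 mxE xt eqxx mul1r /phi => /esym/eqP.
  by rewrite -addrA -opprD subr_eq0 => /eqP.
have [|y1 xy1 yz1] := @gdist_prefix 2 x z; first by rewrite xz.
rewrite xz !subSS subn0 in yz1.
have [|y2 zy2 xy2] := @exists_gdist_from z x j.+4; first by rewrite gdistC xz jD; lia.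
rewrite (gdistC z x) xz in xy2; have {}xy2 : d x y2 = 2 by rewrite xy2; lia.
move=> xy yz; have := key _ xy1; have := key _ xy2; have := key _ xy.
rewrite /h (homog_count_closer xy1 xz yz1).
rewrite (@homog_count_farther x y2 z j.+2 xz) ?(gdistC y2) // yz1 zy2 yz /q.
have -> : (j == j.+4) = false by lia.
have -> : (j.+4 == j) = false by lia.
have -> : (j.+2 == j.+4) = false by lia.
have -> : (j.+2 == j) = false by lia.
rewrite !eqxx -/(h y) /= !mulr0 !mulr1 subrr sub0r subr0 addr0 => e1 e2 e3.
rewrite -e2 in e1 e3; rewrite rmorphD /= e3.
have -> : (- t2%:C + be * (c 2)%:R + t2%:C) * h y = (c 2)%:R * (be * h y) by ring.
have -> : be * h y = t2%:C by apply/eqP; rewrite -subr_eq0 e1 addrC.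
by rewrite mulrC.
Qed.

End Interior.

(** For 2 <= i <= D - 2 the count is given by the cosines of theta_1; for i =
    1 it is 1; for i = D - 1 pass to the antipode of z, a common neighbour of
    x and y, which is the only one that is not counted. *)
Lemma defect_two_homogeneous : two_homogeneous adj.
Proof.
move=> i /andP[i1 iD] x y z x' y' z' xy xz yz xy' xz' yz'.
have [e1|n1] := eqVneq i 1%N.
  suff one u v w : d u v = 2 -> d u w = i -> d v w = i -> two_homog_count adj i u v w = 1%N.
    by rewrite !one.
  move=> _ uw vw; rewrite /two_homog_count; apply/eqP/cards1P; exists w.
  apply/setP => r; rewrite !inE e1 /= gdist_eq0.
  by case: (r =P w) => [->|_]; rewrite ?andbF // !(gdistC w) uw vw e1.
have [eD|nD] := eqVneq i D.-1.
  suff one u v w : d u v = 2 -> d u w = i -> d v w = i -> two_homog_count adj i u v w = (c 2).-1.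
    by rewrite !one.
  move=> uv uw vw; have [w' [ww' _]] := defect_antipodal d0 w.
  have anti t := antipode_all d0 t ww'.
  have uw' : d u w' = 1%N by rewrite anti gdistC uw eD; lia.
  have vw' : d v w' = 1%N by rewrite anti gdistC vw eD; lia.
  rewrite -(common_card uv) (cardsD1 w') !inE -gdist_eq1 uw' gdistC vw' /=.
  apply: eq_card => r; rewrite !inE (gdistC r u) gdist_eq1.
  case ur : (adj u r) => /=; last by rewrite andbF.
  case: (d r v == 1%N) => /=; rewrite ?andbF // andbT.
  have := gdist_adj_cases w ur; rewrite !(gdistC w) uw.
  rewrite -(gdist_eq0 r w') (anti r).
  by rewrite (gdistC w); have := gdist_diameter r w; lia.
have [j ij] : exists j, i = j.+2 by exists i.-2; lia.
rewrite {}ij in i1 iD n1 nD xz yz xz' yz' *.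
have jD : (j.+4 <= D)%N by lia.
have e := homog_count_interior xz jD xy yz; have e' := homog_count_interior xz' jD xy' yz'.
have tp : (gap (cosine (th_ 1)) j + gap (cosine (th_ 1)) j.+2)%:C != 0.
  by rewrite fmorph_eq0 lt0r_neq0 // addr_gt0 // gap_theta1_gt0 //; lia.
by have /eqP := mulfI tp (etrans e (esym e')); rewrite eqr_nat => /eqP.
Qed.

End DeltaZero.

(** * The equivalence *)

Lemma defect_eq0 : defect (th_ 1) (th_ dd) = 0 <-> taut R adj \/ two_homogeneous adj.
Proof.
split=> [d0|[[_ e]|hom2]]; last exact: two_homogeneous_defect.
  have [/(defect_two_homogeneous d0) hom2|D0] := eqVneq (Delta R adj) 0; first by right.
  by left; split; [exact/eqP|apply/eqP; rewrite -subr_eq0; apply/eqP].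
by apply/eqP; rewrite subr_eq0; apply/eqP.
Qed.

End Main.

Local Open Scope nat_scope.

Theorem theorem16p7 (R : realType) (X : finType) (adj : rel X)
    (graph_adj : connected_simple_graph adj)
    (drg_adj : distance_regular adj)
    (bip_adj : bipartite adj)
    (diam_ge4 : 4 <= diameter adj)
    (val_ge3 : 3 <= valency adj)
    (diam_odd : odd (diameter adj)) :
  let i := taut R adj \/ two_homogeneous adj in
  let ii := antipodal_2_cover adj /\ (forall x : X, two_thin R adj x) in
  let iii := antipodal_2_cover adj /\ (exists x : X, two_thin R adj x) in
  (i <-> ii) /\ (ii <-> iii).
Proof.
move=> i ii iii.
have ieq := defect_eq0 R graph_adj drg_adj bip_adj diam_ge4 val_ge3 diam_odd.
have i_ii : i -> ii.
  move=> /ieq d0; split.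
    exact: (defect_antipodal graph_adj drg_adj bip_adj diam_ge4 val_ge3 diam_odd d0).
  move=> x.
  exact: (defect_two_thin graph_adj drg_adj bip_adj diam_ge4 val_ge3 diam_odd d0).
have ii_iii : ii -> iii.
  case=> cov thin; split=> //; have [x _] := exists_diameter diam_ge4.
  by exists x.
have iii_i : iii -> i.
  case=> cov [x thin]; apply/ieq.
  exact: (two_thin_defect graph_adj drg_adj bip_adj diam_ge4 val_ge3 diam_odd cov thin).
split; split.
- exact: i_ii.
- by move=> h; apply/iii_i/ii_iii.
- exact: ii_iii.
- by move=> h; apply/i_ii/iii_i.
Qed.
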